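(* Let $f\in\mathbb{Z}[X,Y]$ be a nonzero quasi-homogeneous polynomial. There exist a finite set $\mathcal{P}(f)$ of prime numbers and constants $C,c,c'>0$, where $C,c,c'$ depend only on the degree of $f$, such that the following hold. (a) Suppose $f\notin E_m$ for every $m\ge 1$. Then for every prime $p\notin\mathcal{P}(f)$ and every integer $s\ge 1$, $$c\,s^{\nu(f)}\,p^{-s/h(f)}\,p^{-2}\le\mathcal{N}(f;p^s)\le C\,s^{\nu(f)}\,p^{-s/h(f)},$$ and for every prime $p\notin\mathcal{P}(f)$ the lower bound $$c'\,s^{\nu(f)}\,p^{-s/h(f)}\le\mathcal{N}(f;p^s)$$ holds for infinitely many integers $s\ge 1$. (b) Suppose $f\in E_m$ for some $m\ge 1$. Then for every prime $p\notin\mathcal{P}(f)$ the estimates in (a) hold (the two-sided bound for every $s\ge 1$, the last lower bound for infinitely many $s\ge 1$) with $\nu(f)$ replaced by $\nu_p(f)$, where $\nu_p(f)=1$ if the two roots of $f$ (a conjugate pair of algebraic numbers of degree $2$ over $\mathbb{Q}$) lie in the $p$-adic field $\mathbb{Q}_p$, and $\nu_p(f)=0$ otherwise.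
   Context: Normalised number of solutions: for a prime $p$ and $s\ge 1$, $$\mathcal{N}(f;p^s)=p^{-2s}\,\#\{(x,y)\in(\mathbb{Z}/p^s\mathbb{Z})^2: f(x,y)\equiv 0 \bmod p^s\}.$$ Quasi-homogeneous: there are real numbers $\kappa_1,\kappa_2>0$ with $f(r^{\kappa_1}x,r^{\kappa_2}y)=r f(x,y)$ for all $r\ge 0$; equivalently $\kappa_1 j+\kappa_2 k=1$ for every monomial $x^jy^k$ occurring in $f$ with nonzero coefficient. Normal form (with $K=\mathbb{Q}$): if $f$ has more than one monomial, then $\kappa_1,\kappa_2$ are uniquely determined by $f$ and rational. Interchanging $x$ and $y$ if necessary, assume $\kappa_2\ge\kappa_1$ and write $\kappa_2/\kappa_1=r/t$ with coprime integers $r\ge t\ge 1$. Then, over an algebraic closure of $K$, $$f(x,y)=a\,x^{\alpha}y^{\beta}\prod_{j=1}^{M}(y^t-\zeta_jx^r)^{n_j},$$ with $a\ne 0$, integers $\alpha,\beta\ge 0$, $n_j\ge 1$, and distinct nonzero $\zeta_1,\dots,\zeta_M$ algebraic over $K$ (the nonzero roots of $f$, with multiplicities $n_j$). Put $n=\sum_{j}n_j$. Homogeneous distance: $d(f)=\frac{1}{\kappa_1+\kappa_2}=\frac{t\alpha+r\beta+trn}{t+r}$. Maximal order over $K$: $m_K(f)=\max(\alpha,\beta,\max\{n_j:\zeta_j\in K\})$ (the inner maximum being omitted if no $\zeta_j$ lies in $K$). Height: $h(f)=\max(m_K(f),d(f))$ if $f$ has more than one monomial; $h(f)=\max(\alpha,\beta)$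 if $f=ax^{\alpha}y^{\beta}$ is a single monomial. Exponent $\nu(f)\in\{0,1\}$: if $f$ has more than one monomial, $\nu(f)=1$ if $m_K(f)=d(f)$, and $\nu(f)=0$ otherwise. If $f=ax^{\alpha}y^{\beta}$, then $\nu(f)=1$ if $\alpha=\beta$, and $\nu(f)=0$ otherwise. Exceptional classes: $E_m$ is the class of polynomials $f(x,y)=a(by^2+cxy+dx^2)^m$ with $a\neq 0$ and $by^2+cxy+dx^2$ irreducible over $\mathbb{Q}$; the roots of such $f$ are the two roots $\zeta,\zeta^*$ of $bw^2+cw+d$. *)

(* Defs.v *)
From HB Require Import structures.
From mathcomp Require Import all_boot all_order all_algebra all_field.
From mathcomp Require Import boolp classical_sets reals exp.

Set Implicit Arguments.
Unset Strict Implicit.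
Unset Printing Implicit Defensive.

Import Order.TTheory GRing.Theory Num.Theory.

Local Open Scope ring_scope.

(* The inverse limit of the rings Z/p^n: the n-th entry is the representative
   in [0, p^n[ of the residue class modulo p^n. The primality proof is a
   parameter of the type so that canonical structures can depend on it. *)
Record padic_int (p : nat) (p_pr : prime p) := PadicInt {
  padic_seq :> nat -> int;
  padic_seqP : `[< forall n,
    padic_seq n = (padic_seq n.+1 %% (p ^ n)%N%:Z)%Z >] }.

Section PadicIntegers.

Variables (p : nat) (p_pr : prime p).
Local Notation padic_int := (padic_int p_pr).

HB.instance Definition _ := [isSub of padic_int for @padic_seq p p_pr].
HB.instance Definition _ := [Choice of padic_int by <:].

Let q n : int := (p ^ n)%N%:Z.

Let q_neq0 n : q n != 0.
Proof. by rewrite /q eqz_nat -lt0n expn_gt0 prime_gt0. Qed.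

Let modq_trunc (a : int) n : ((a %% q n.+1)%Z = a %[mod q n])%Z.
Proof.
apply/eqP; rewrite eqz_mod_dvd {2}(divz_eq a (q n.+1)) opprD addrCA subrr addr0.
by rewrite rpredN dvdz_mull // /q expnS PoszM dvdz_mull.
Qed.

Lemma padic_seqS (x : padic_int) n : x n = (x n.+1 %% q n)%Z.
Proof. by have /asboolP := padic_seqP x. Qed.

Lemma padic_seq_mod (x : padic_int) n : (x n %% q n)%Z = x n.
Proof. by rewrite padic_seqS modz_mod. Qed.

Lemma padic_eqP (x y : padic_int) :
  (forall n, (x n = y n %[mod q n])%Z) -> x = y.
Proof.
by move=> xy; apply/val_inj/funext => n /=; rewrite -padic_seq_mod xy padic_seq_mod.
Qed.

Lemma padic_mk_subproof (u : nat -> int) :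
  (forall n, (u n.+1 = u n %[mod q n])%Z) ->
  `[< forall n, (u n %% q n)%Z = ((u n.+1 %% q n.+1)%Z %% (p ^ n)%N%:Z)%Z >].
Proof. by move=> uS; apply/asboolP => n; rewrite modq_trunc uS. Qed.

Definition padic_mk u uS : padic_int := PadicInt p_pr (@padic_mk_subproof u uS).

Lemma padic_mkE u uS n : (@padic_mk u uS n = u n %[mod q n])%Z.
Proof. by rewrite /= modz_mod. Qed.

Let seqS (x : padic_int) n : (x n.+1 = x n %[mod q n])%Z.
Proof. by rewrite -padic_seqS padic_seq_mod. Qed.

Let cstS (a : int) n : (a = a %[mod q n])%Z. Proof. by []. Qed.

Let oppS (x : padic_int) n : (- x n.+1 = - x n %[mod q n])%Z.
Proof. by rewrite -modzNm seqS modzNm. Qed.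

Let addS (x y : padic_int) n : (x n.+1 + y n.+1 = x n + y n %[mod q n])%Z.
Proof. by rewrite -modzDm !seqS modzDm. Qed.

Let mulS (x y : padic_int) n : (x n.+1 * y n.+1 = x n * y n %[mod q n])%Z.
Proof. by rewrite -modzMm !seqS modzMm. Qed.

Definition padic_cst (a : int) := padic_mk (cstS a).
Definition padic_opp x := padic_mk (oppS x).
Definition padic_add x y := padic_mk (addS x y).
Definition padic_mul x y := padic_mk (mulS x y).

Let cstE a n : (padic_cst a n = a %[mod q n])%Z.
Proof. exact: padic_mkE. Qed.
Let oppE x n : (padic_opp x n = - x n %[mod q n])%Z.
Proof. exact: padic_mkE. Qed.
Let addE x y n : (padic_add x y n = x n + y n %[mod q n])%Z.
Proof. exact: padic_mkE. Qed.
Let mulE x y n : (padic_mul x y n = x n * y n %[mod q n])%Z.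
Proof. exact: padic_mkE. Qed.

Fact padic_addA : associative padic_add.
Proof.
move=> x y z; apply: padic_eqP => n; rewrite !addE.
by rewrite -modzDmr addE modzDmr -[RHS]modzDml addE modzDml addrA.
Qed.

Fact padic_addC : commutative padic_add.
Proof. by move=> x y; apply: padic_eqP => n; rewrite !addE addrC. Qed.

Fact padic_add0 : left_id (padic_cst 0) padic_add.
Proof.
by move=> x; apply: padic_eqP => n; rewrite addE -modzDml cstE modzDml add0r.
Qed.

Fact padic_addN : left_inverse (padic_cst 0) padic_opp padic_add.
Proof.
move=> x; apply: padic_eqP => n.
by rewrite addE -modzDml oppE modzDml addNr cstE.
Qed.

HB.instance Definition _ := GRing.isZmodule.Build padic_int
  padic_addA padic_addC padic_add0 padic_addN.

Fact padic_mulA : associative padic_mul.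
Proof.
move=> x y z; apply: padic_eqP => n; rewrite !mulE.
by rewrite -modzMmr mulE modzMmr -[RHS]modzMml mulE modzMml mulrA.
Qed.

Fact padic_mulC : commutative padic_mul.
Proof. by move=> x y; apply: padic_eqP => n; rewrite !mulE mulrC. Qed.

Fact padic_mul1 : left_id (padic_cst 1) padic_mul.
Proof.
by move=> x; apply: padic_eqP => n; rewrite mulE -modzMml cstE modzMml mul1r.
Qed.

Fact padic_mulDl : left_distributive padic_mul padic_add.
Proof.
move=> x y z; apply: padic_eqP => n; rewrite mulE addE.
by rewrite -modzMml addE modzMml -[RHS]modzDm !mulE modzDm mulrDl.
Qed.

Fact padic_1neq0 : padic_cst 1 != padic_cst 0.
Proof.
apply/eqP => /(congr1 (fun x : padic_int => (x 1%N %% q 1)%Z)).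
rewrite !cstE mod0z /q expn1 modz_small //.
by rewrite lez_nat ltz_nat prime_gt1.
Qed.

HB.instance Definition _ := GRing.Zmodule_isComNzRing.Build padic_int
  padic_mulA padic_mulC padic_mul1 padic_mulDl padic_1neq0.

Definition padic_unit : {pred padic_int} :=
  fun x => `[< exists y : padic_int, y * x = 1 >].

Definition padic_inv (x : padic_int) : padic_int :=
  if pselect (exists y : padic_int, y * x = 1) is left e
  then projT1 (cid e) else x.

Fact padic_mulVx : {in padic_unit, left_inverse 1 padic_inv *%R}.
Proof.
move=> x /asboolP xU; rewrite /padic_inv; case: pselect => // e.
exact: projT2 (cid e).
Qed.

Fact padic_unitP (x y : padic_int) : y * x = 1 -> padic_unit x.
Proof. by move=> yx; apply/asboolP; exists y. Qed.

Fact padic_inv_out : {in [predC padic_unit], padic_inv =1 id}.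
Proof.
move=> x xNU; rewrite /padic_inv; case: pselect => // -[y yx].
by case/negP: xNU; apply: padic_unitP yx.
Qed.

HB.instance Definition _ := GRing.ComNzRing_hasMulInverse.Build padic_int
  padic_mulVx padic_unitP padic_inv_out.

Let seq_trunc (x : padic_int) m n : (x (n + m)%N = x n %[mod q n])%Z.
Proof.
elim: m => [|m IHm]; first by rewrite addn0.
rewrite addnS -{}IHm; apply/eqP; rewrite eqz_mod_dvd.
apply: (@dvdz_trans (q (n + m))); first by rewrite /q expnD PoszM dvdz_mulr.
by rewrite -eqz_mod_dvd; apply/eqP/seqS.
Qed.

Fact padic_idomain : GRing.integral_domain_axiom padic_int.
Proof.
move=> x y xy0; apply: contraT => /norP[x0 y0].
have nz (z : padic_int) : z != 0 -> exists n, ~~ (q n %| z n)%Z.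
  move=> z0; apply: contrapT => zN; case/eqP: z0; apply: padic_eqP => n.
  rewrite cstE mod0z; apply/dvdz_mod0P.
  by apply: contrapT => /negP zn; apply: zN; exists n.
have [m xm] := nz _ x0; have [n yn] := nz _ y0.
have dvd_lt k (a : int) : ~~ (q k %| a)%Z ->
    (0 < `|a|)%N /\ (logn p `|a| < k)%N.
  rewrite dvdzE absz_nat => ka.
  have a0 : (0 < `|a|)%N by rewrite lt0n; apply: contra ka => /eqP->.
  by rewrite pfactor_dvdn // -ltnNge in ka.
have [a0 la] : (0 < `|x (m + n)%N|)%N /\ (logn p `|x (m + n)%N| < m)%N.
  apply: dvd_lt; apply: contra xm => /dvdz_mod0P xm.
  by apply/dvdz_mod0P; rewrite -(seq_trunc x n).
have [b0 lb] : (0 < `|y (m + n)%N|)%N /\ (logn p `|y (m + n)%N| < n)%N.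
  apply: dvd_lt; apply: contra yn => /dvdz_mod0P yn.
  by apply/dvdz_mod0P; rewrite -(seq_trunc y m) addnC.
have : (q (m + n) %| x (m + n)%N * y (m + n)%N)%Z.
  by apply/dvdz_mod0P; rewrite -mulE [padic_mul x y]xy0 cstE mod0z.
rewrite dvdzE absz_nat abszM pfactor_dvdn ?muln_gt0 ?a0 ?b0 // lognM //.
by rewrite leqNgt -addSn leq_add // ltnW.
Qed.

HB.instance Definition _ := GRing.ComUnitRing_isIntegral.Build padic_int
  padic_idomain.

End PadicIntegers.

Definition padic (p : nat) (p_pr : prime p) := {fraction padic_int p_pr}.
HB.instance Definition _ p (p_pr : prime p) := GRing.Field.on (padic p_pr).

(* Bivariate polynomials follow the conventions of polyXY: in
   f : {poly {poly K}} the outer variable is 'X and the inner one is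
   'Y = 'X%:P, so the coefficient of x^j y^k is f`_j`_k. *)

Definition map_bipoly (A B : nzRingType) (g : A -> B) (f : {poly {poly A}}) :
  {poly {poly B}} := map_poly (map_poly g) f.

Definition monomials (A : nzRingType) (f : {poly {poly A}}) : seq (nat * nat) :=
  [seq jk <- [seq (j, k) | j <- iota 0 (size f), k <- iota 0 (size f`_j)]
     | f`_(jk.1)`_(jk.2) != 0].

Definition total_degree (A : nzRingType) (f : {poly {poly A}}) : nat :=
  \max_(jk <- monomials f) (jk.1 + jk.2)%N.

(* 'Z_n is Z/nZ only for n > 1, which holds for n = p ^ s with p prime and
   s >= 1. *)
Definition nsol (R : realType) (f : {poly {poly int}}) (p s : nat) : R :=
  #|[set u : 'Z_(p ^ s) * 'Z_(p ^ s) |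
      (map_bipoly intr f).[u.1, u.2] == 0]|%:R / (p ^ (2 * s))%:R.

Section Height.

Variable R : realType.
Implicit Type f : {poly {poly int}}.

Definition quasi_homogeneous_for f (k1 k2 : R) : Prop :=
  [/\ 0 < k1, 0 < k2 &
    forall r x y : R, 0 <= r ->
      (map_bipoly intr f).[r `^ k1 * x, r `^ k2 * y] =
      r * (map_bipoly intr f).[x, y]].

Definition quasi_homogeneous f : Prop :=
  exists k1 k2 : R, quasi_homogeneous_for f k1 k2.

(* The list zs holds the pairs (zeta_j, n_j). *)
Definition normal_form f (a : algC) (alpha beta t r : nat)
    (zs : seq (algC * nat)) : Prop :=
  [/\ exists k1 k2 : R,
        [/\ quasi_homogeneous_for f k1 k2, k1 <= k2 & k2 / k1 = r%:R / t%:R],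
      [/\ (1 <= t)%N, (t <= r)%N & coprime r t],
      [/\ a != 0, uniq (unzip1 zs) &
          all (fun z : algC * nat => (z.1 != 0) && (1 <= z.2)%N) zs] &
      map_bipoly intr f =
        a%:P%:P * 'X ^+ alpha * 'Y ^+ beta *
        \prod_(z <- zs) ('Y ^+ t - z.1%:P%:P * 'X ^+ r) ^+ z.2].

(* The maximal order over Q. A normal form may exist only after interchanging
   x and y. *)
Definition is_max_order f (m : nat) : Prop :=
  exists a alpha beta t r zs,
    (normal_form f a alpha beta t r zs \/
     normal_form (swapXY f) a alpha beta t r zs) /\
    m = maxn (maxn alpha beta) (\max_(z <- zs | z.1 \in Crat) z.2).

(* max_order and hdist are meant for f with more than one monomial, where the
   normal form and the weights exist and determine these values uniquely. *)
Definition max_order f : nat := xget 0%N [set m | is_max_order f m].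

Definition hdist f : R :=
  xget 0 [set d | exists k1 k2, quasi_homogeneous_for f k1 k2 /\
                                d = 1 / (k1 + k2)].

Definition height f : R :=
  if (1 < size (monomials f))%N then Num.max (max_order f)%:R (hdist f)
  else let jk := head (0, 0)%N (monomials f) in (maxn jk.1 jk.2)%:R.

Definition nu f : nat :=
  if (1 < size (monomials f))%N then (max_order f)%:R == hdist f
  else let jk := head (0, 0)%N (monomials f) in jk.1 == jk.2.

End Height.

Definition irreducible_elt (A : unitRingType) (q : A) : Prop :=
  [/\ q != 0, q \isn't a GRing.unit &
      forall u v : A, q = u * v ->
        u \is a GRing.unit \/ v \is a GRing.unit].

Definition quad_form (b c d : rat) : {poly {poly rat}} :=
  b%:P%:P * 'Y ^+ 2 + c%:P%:P * 'X * 'Y + d%:P%:P * 'X ^+ 2.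

Definition exceptional_with (m : nat) (f : {poly {poly int}})
    (a b c d : rat) : Prop :=
  [/\ a != 0, irreducible_elt (quad_form b c d) &
      map_bipoly intr f = a%:P%:P * quad_form b c d ^+ m].

Definition exceptional (m : nat) (f : {poly {poly int}}) : Prop :=
  exists a b c d : rat, exceptional_with m f a b c d.

(* Whether the two roots of b w^2 + c w + d lie in Q_p; they are distinct when
   the quadratic form is irreducible over Q. *)
Definition nu_padic (p : nat) (p_pr : prime p) (b c d : rat) : nat :=
  `[< exists z z' : padic p_pr,
        [/\ z != z',
            ratr b * z ^+ 2 + ratr c * z + ratr d = 0 &
            ratr b * z' ^+ 2 + ratr c * z' + ratr d = 0] >].

Definition two_sided_bound (R : realType) (C c : R) (f : {poly {poly int}})
    (p e s : nat) : Prop :=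
  c * s%:R ^+ e * p%:R `^ (- (s%:R / height R f)) * p%:R ^- 2 <= nsol R f p s
    <= C * s%:R ^+ e * p%:R `^ (- (s%:R / height R f)).

Definition sharp_lower_bound (R : realType) (c' : R) (f : {poly {poly int}})
    (p e s : nat) : Prop :=
  c' * s%:R ^+ e * p%:R `^ (- (s%:R / height R f)) <= nsol R f p s.

Definition estimates (R : realType) (C c c' : R) (f : {poly {poly int}})
    (p e : nat) : Prop :=
  (forall s, (1 <= s)%N -> two_sided_bound C c f p e s) /\
  (forall s0, exists2 s, (s0 < s)%N & sharp_lower_bound c' f p e s).

(* Main.v *)
Require Import Defs.
From mathcomp Require Import all_boot all_order all_algebra all_field.
From mathcomp Require Import boolp classical_sets reals exp.
From mathcomp Require Import zify ring lra.
From mathcomp Require cyclic.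

Set Implicit Arguments.
Unset Strict Implicit.
Unset Printing Implicit Defensive.

Import Order.TTheory GRing.Theory Num.Theory.

Local Open Scope ring_scope.

(** Why the estimates hold.

    Write f(x,y) = x^al y^be F*(x^r, y^t), where F* is the homogenization of a
    univariate integer polynomial F of degree n with F(0) <> 0 ([qhpoly]); the
    nonzero roots of f are the roots of F, and a monomial is the case n = 0.
    Put De = t al + r be + t r n, so that d = De / (t + r). All the primes
    dividing some nonzero integer attached to f are discarded.

    Let i and j be the valuations of x and y. Off the ray r i = t j the
    valuation of f(x,y) is a linear form in (i,j) on each side. On the ray,
    (i,j) = (t l, r l), it is De l plus the valuation of F at the unit
    w = y'^t / x'^r, where x' and y' are the unit parts. If e is the largest
    multiplicity of a root of F, then F divides a multiple of G^e, with G the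
    squarefree part of F; so p^k | F(w) forces a power p^a | G(w) with
    e a >= k, and as G has only simple roots modulo p this holds for a
    proportion O(p^-a) of the w ([count_simple_roots], [exists_order_le]).
    Therefore the density of solutions is at most a constant times three sums
    of p^(-weight), over the lattice points of three plane cones where the
    valuation is at least s ([nsols_le]). Call exponent of an edge the ratio
    of valuation to weight along it. The cones have edges of exponents
    (al, d), (be, d) and (d, e), and such a sum is O(p^(-s/h)) with h the
    largest exponent, except when both exponents are equal to h: then the
    bound is O(s p^(-s/h)) ([cone_bound], [nsols_upper]). This is the meaning
    of nu = 1.

    Conversely the vertex and each edge carry an explicit set of solutions of
    the right density: x and y divisible by p^(s t/De) and p^(s r/De); one
    coordinate divisible by p^(s/h), for h = al or be; or y close to z x^r for
    a root z of order h ([nsols_ge_vertex], [nsols_ge_alpha],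
    [nsols_ge_beta], [nsols_ge_root]). When d = h too, each of the last three
    can be repeated for a positive proportion of the valuations up to s/h,
    which produces the factor s. Rounding the exponents up costs at most p^2,
    and nothing for infinitely many s.

    It remains to see that only rational roots matter. For an irrational root
    of order e, the e-th power of its minimal polynomial divides F, so that
    2 e <= n; since t + r <= 2 t r this gives e <= d, and e = d happens only if
    al = be = 0, t = r = 1 and F is a constant times the e-th power of an
    irreducible quadratic polynomial Q, that is, in the exceptional class
    ([irrational_multiplicity], [irrational_weight]). In that class h = d = m,
    and the logarithm appears exactly when Q has a root modulo p. By Hensel's
    lemma in one direction, and reduction of the square root of the
    discriminant in the other, this means that its roots lie in Q_p
    ([quadp_two_roots], [quadp_root_solvable]).

    The constants depend on D only because the exponents are fractions with
    denominator t + r <= 2 D and size at most D, so that two distinct ones are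
    at a relative distance of 1/(2 D^2) at least ([gap]). *)

(** * Counting residues by integers of an interval *)

Section Counting.
Local Open Scope nat_scope.

Lemma sum_dvd_block d m (P : pred nat) : 0 < d ->
  \sum_(1 <= x < (d * m).+1) ((d %| x) && P (x %/ d) : nat) =
  \sum_(1 <= x < m.+1) (P x : nat).
Proof.
move=> d0; elim: m => [|m IH]; first by rewrite muln0 !big_nil.
have le_dm : d * m <= d * m.+1 by rewrite leq_mul.
rewrite (@big_cat_nat _ _ _ (d * m).+1) //=.
rewrite {}IH [RHS]big_nat_recr //=; congr (_ + _).
have lt_dm : d * m < d * m.+1 by rewrite ltn_mul2l d0 /=.
rewrite big_nat_recr //=.
rewrite dvdn_mulr // mulKn //= big_nat big1 ?add0n // => x /andP[x1 x2].
case: (boolP (d %| x)) => //= /dvdnP[k xk]; move: x1 x2.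
by rewrite xk ![d * _]mulnC !ltn_mul2r d0 /= ltnS => /leq_trans h /h; rewrite ltnn.
Qed.

Lemma sum_periodic d m (P : pred nat) :
  (forall x, P (x + d) = P x) ->
  \sum_(1 <= x < (d * m).+1) (P x : nat) = m * \sum_(1 <= x < d.+1) (P x : nat).
Proof.
move=> perP; have perPm k x : P (x + d * k) = P x.
  by elim: k => [|k IH]; rewrite ?muln0 ?addn0 // mulnS addnCA [d + _]addnC perP.
elim: m => [|m IH]; first by rewrite muln0 big_nil.
have le_dm : d * m <= d * m.+1 by rewrite leq_mul.
rewrite (@big_cat_nat _ _ _ (d * m).+1) //=.
rewrite IH mulSnr; congr (_ + _).
rewrite -[(d * m).+1]add1n big_addn mulnS -addSn addnK.
by apply: eq_bigr => x _; rewrite perPm.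
Qed.

End Counting.

(** * Homogenized polynomials *)

Definition homog (A : comNzRingType) (n : nat) (F : {poly A}) (X Y : A) : A :=
  \sum_(k < n.+1) F`_k * X ^+ (n - k) * Y ^+ k.

Section Hom.
Variable A : comNzRingType.
Implicit Types (F : {poly A}) (X Y c w : A).

Lemma homog_scale n F c X Y : homog n F (c * X) (c * Y) = c ^+ n * homog n F X Y.
Proof.
rewrite /homog mulr_sumr; apply: eq_bigr => k _.
have -> : c ^+ n = c ^+ (n - k) * c ^+ k by rewrite -exprD subnK // -ltnS.
by rewrite !exprMn; ring.
Qed.

Lemma homog_mul n F X w : (size F <= n.+1)%N -> homog n F X (X * w) = X ^+ n * F.[w].
Proof.
move=> sF; rewrite (horner_coef_wide _ sF) /homog mulr_sumr; apply: eq_bigr => k _.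
have -> : X ^+ n = X ^+ (n - k) * X ^+ k by rewrite -exprD subnK // -ltnS.
by rewrite exprMn; ring.
Qed.

Lemma homog0l n F Y : homog n F 0 Y = F`_n * Y ^+ n.
Proof.
rewrite /homog big_ord_recr /= big1 ?add0r ?subnn ?mulr1 // => k _.
by rewrite expr0n subn_eq0 leqNgt ltn_ord /= mulr0 mul0r.
Qed.

Lemma homog0r n F X : homog n F X 0 = F`_0 * X ^+ n.
Proof.
rewrite /homog big_ord_recl /= big1 ?addr0 ?subn0 ?expr0 ?mulr1 // => k _.
by rewrite /bump /= add1n expr0n /= mulr0.
Qed.

Lemma homogZ n F c X Y : homog n (c *: F) X Y = c * homog n F X Y.
Proof. by rewrite /homog mulr_sumr; apply: eq_bigr => k _; rewrite coefZ !mulrA. Qed.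

Lemma homogMXsubC n F c X Y : (size F <= n.+1)%N ->
  homog n.+1 (('X - c%:P) * F) X Y = (Y - c * X) * homog n F X Y.
Proof.
move=> sF; rewrite /homog [RHS]mulrBl; set S := (X in Y * X); rewrite [Y * S]mulr_sumr.
rewrite [c * X * S]mulr_sumr {S}.
under eq_bigr do rewrite mulrBl coefB coefXM coefCM !mulrBl.
rewrite sumrB; congr (_ - _).
  rewrite big_ord_recl /= !mul0r add0r; apply: eq_bigr => k _.
  by rewrite /bump /= add1n subSS exprS; ring.
rewrite big_ord_recr /= (nth_default _ sF) mulr0 !mul0r addr0.
by apply: eq_bigr => k _; rewrite subSn -1?ltnS // exprS; ring.
Qed.

End Hom.

(** * Divisibility in [int] *)

Lemma dvdz_horner (d : int) (F : {poly int}) x y :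
  (d %| x - y)%Z -> (d %| F.[x] - F.[y])%Z.
Proof.
move=> dxy; have /factor_theorem[q qE] : root (F - F.[y]%:P) y.
  by rewrite /root !hornerE subrr.
have -> : F.[x] - F.[y] = q.[x] * (x - y).
  by move/(congr1 (fun p : {poly int} => p.[x])): qE; rewrite !hornerE.
exact: dvdz_mull.
Qed.

Lemma dvdz_homog (d : int) n (F : {poly int}) X X' Y Y' :
  (d %| X - X')%Z -> (d %| Y - Y')%Z -> (d %| homog n F X Y - homog n F X' Y')%Z.
Proof.
move=> dX dY; rewrite /homog -sumrB; apply: rpred_sum => k _.
have dexp (x y : int) m : (d %| x - y)%Z -> (d %| x ^+ m - y ^+ m)%Z.
  by move=> h; rewrite subrXX dvdz_mulr.
have -> (f a b a' b' : int) :
    f * a * b - f * a' * b' = f * (a - a') * b + f * a' * (b - b') by ring.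
by apply: rpredD; [rewrite dvdz_mulr // dvdz_mull|rewrite dvdz_mull] => //; apply: dexp.
Qed.

Section PrimePowers.
Variable p : nat.
Hypothesis p_pr : prime p.
Local Notation q k := ((p ^ k)%N%:Z).

Lemma prime_dvdz_mul (a b : int) : (p %| a * b)%Z = (p %| a)%Z || (p %| b)%Z.
Proof. by rewrite !dvdzE abszM Euclid_dvdM. Qed.

Lemma prime_dvdz_exp (a : int) n : (0 < n)%N -> (p %| a ^+ n)%Z = (p %| a)%Z.
Proof. by move=> n0; rewrite !dvdzE abszX Euclid_dvdX // n0 andbT. Qed.

Lemma prime_dvdz_expN (a : int) n : ~~ (p %| a)%Z -> ~~ (p %| a ^+ n)%Z.
Proof.
case: n => [|n] pa; last by rewrite prime_dvdz_exp.
by rewrite expr0 dvdzE /= dvdn1; apply: contraL p_pr => /eqP ->.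
Qed.

Lemma Gauss_pexp k (u a : int) : ~~ (p %| u)%Z -> (q k %| u * a)%Z = (q k %| a)%Z.
Proof.
move=> pu; rewrite !dvdzE abszM Gauss_dvdr //.
by rewrite absz_nat coprimeXl // prime_coprime // -dvdzE.
Qed.

Lemma dvdz_expl k l (a : int) : (k <= l)%N -> (q l %| a)%Z -> (q k %| a)%Z.
Proof. by move=> kl; apply: dvdz_trans; rewrite dvdzE !absz_nat dvdn_exp2l. Qed.

Lemma pexpz_neq0 k : q k != 0.
Proof. by rewrite eqz_nat -lt0n expn_gt0 prime_gt0. Qed.

Lemma pexpzD k l : q (k + l) = q k * q l.
Proof. by rewrite expnD PoszM. Qed.

Lemma pexpzX k l : (q k) ^+ l = q (k * l).
Proof. by rewrite expnM -!natz -natrX. Qed.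

Lemma dvdz_pexp_mul k s (a : int) : (q s %| q k * a)%Z = (q (s - k) %| a)%Z.
Proof.
case: (leqP k s) => ks; first by rewrite -{1}(subnKC ks) pexpzD dvdz_mul2l ?pexpz_neq0.
by rewrite (eqP (ltnW ks)) dvd1z dvdz_mulr // dvdzE !absz_nat dvdn_exp2l // ltnW.
Qed.

Lemma dvdz_pexp_unit s (a : int) : ~~ (p %| a)%Z -> (q s %| a)%Z -> s = 0%N.
Proof.
by move=> pa; case: s => // s /(@dvdz_expl 1) - /(_ isT); rewrite expn1 (negPf pa).
Qed.

(** The witness is k itself when a = 0 and min(k, v(a)) otherwise, which keeps
    b <= k; this bound is what makes the congruence modulo p^b meaningful for
    residues known modulo p^k only. *)
Lemma dvdz_pexp_root k e (a : int) : (0 < e)%N -> (q k %| a ^+ e)%Z ->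
  exists b, [/\ (b <= k)%N, (k <= e * b)%N & (q b %| a)%Z].
Proof.
move=> e0; have [->|a0] := eqVneq a 0.
  by move=> _; exists k; split; rewrite ?leq_pmull ?dvdz0.
have a1 : (0 < `|a|)%N by rewrite absz_gt0.
rewrite dvdzE abszX pfactor_dvdn ?expn_gt0 ?a1 // lognX => h.
exists (minn k (logn p `|a|)); rewrite geq_minl dvdzE absz_nat pfactor_dvdn // geq_minr.
by split => //; rewrite /minn; case: ifP; rewrite ?leq_pmull.
Qed.

End PrimePowers.

(** * Hensel's lemma *)

(** The second-order term is only needed to be an integer: it makes the
    linear term decide all the divisibilities below. *)
Lemma horner_taylor2 (g : {poly int}) x y :
  exists h, g.[y] = g.[x] + (y - x) * (g^`().[x] + (y - x) * h).
Proof.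
have /factor_theorem[q qE] : root (g - g.[x]%:P) x by rewrite /root !hornerE subrr.
have gE : g = q * ('X - x%:P) + g.[x]%:P by rewrite -qE subrK.
have /factor_theorem[q1 q1E] : root (q - q.[x]%:P) x by rewrite /root !hornerE subrr.
exists q1.[y]; have -> : g^`().[x] = q.[x].
  by rewrite gE derivD derivM derivXsubC derivC !hornerE subrr mulr0 add0r.
have -> : g.[y] = q.[y] * (y - x) + g.[x] by rewrite {1}gE !hornerE.
have -> : q.[y] = q1.[y] * (y - x) + q.[x].
  apply/eqP; rewrite -subr_eq; apply/eqP.
  by move/(congr1 (fun p : {poly int} => p.[y])): q1E; rewrite !hornerE.
ring.
Qed.

Lemma intr_Fp_eq0 p (x : int) : prime p -> (x%:~R == 0 :> 'F_p) = (p %| x)%Z.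
Proof.
move=> p_pr; rewrite dvdzE; case: x => n.
  by rewrite -pmulrn -(dvdn_pcharf (pchar_Fp p_pr)).
by rewrite NegzE mulrNz oppr_eq0 -pmulrn -(dvdn_pcharf (pchar_Fp p_pr)) abszN.
Qed.

Lemma sum_pred_size (T : Type) (r : seq T) (P : pred T) :
  (\sum_(x <- r) (P x : nat))%N = size (filter P r).
Proof. by elim: r => [|x r IH]; rewrite ?big_nil //= big_cons IH; case: (P x). Qed.

(** Two roots modulo p^k that agree modulo p are equal: by [horner_taylor2]
    their difference times a unit is 0. So reduction modulo p is injective on
    them, and the polynomial g modulo p has at most deg g roots. *)
Lemma count_simple_roots p k (g : {poly int}) (P : pred nat) :
  prime p -> (0 < k)%N -> (0 < size g)%N ->
  (forall y : nat, P y -> (p %| g.[y%:Z])%Z -> ~~ (p %| (g^`()).[y%:Z])%Z) ->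
  (\sum_(1 <= y < (p ^ k).+1) (P y && ((p ^ k)%N %| g.[y%:Z])%Z : nat) <= (size g).-1)%N.
Proof.
move=> p_pr k0 g0 simple; rewrite sum_pred_size.
set s := filter _ _.
have pk1 (a : int) : ((p ^ k)%N %| a)%Z -> (p %| a)%Z.
  by move/(dvdz_expl k0); rewrite expn1.
pose red := fun y : nat => (y%:Z)%:~R : 'F_p.
have sP y : y \in s -> [/\ (0 < y <= p ^ k)%N, P y & ((p ^ k)%N %| g.[y%:Z])%Z].
  by rewrite mem_filter mem_index_iota ltnS => /andP[/andP[]].
have inj : {in s &, injective red}.
  move=> x y /sP[/andP[x0 xq] Px gx] /sP[/andP[y0 yq] Py gy] /eqP.
  rewrite -subr_eq0 /red -rmorphB /= intr_Fp_eq0 // => pxy.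
  have [h hE] := horner_taylor2 g x%:Z y%:Z.
  have u : ~~ (p %| g^`().[x%:Z] + (y%:Z - x%:Z) * h)%Z.
    apply: contra (simple _ Px (pk1 _ gx)) => /rpredB/(_ (_ : (p %| (y%:Z - x%:Z) * h)%Z)).
    by rewrite addrK; apply; rewrite dvdz_mulr // -opprB rpredN.
  have : ((p ^ k)%N %| y%:Z - x%:Z)%Z.
    rewrite -(@Gauss_pexp p p_pr k _ _ u) mulrC.
    by move: gy; rewrite hE rpredDl.
  wlog le_xy : x y {Px Py gx gy u hE pxy} x0 y0 xq yq / (x <= y)%N.
    move=> H; case: (leqP x y) => [|/ltnW] le_xy d; first exact: (H x y).
    by apply/esym/(H y x) => //; rewrite -opprB rpredN.
  rewrite subzn // dvdzE !absz_nat => d.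
  have [/eqP|xy0] := posnP (y - x)%N; first by rewrite subn_eq0 => ?; apply/eqP; rewrite eqn_leq le_xy.
  have := dvdn_leq xy0 d; rewrite leqNgt => /negP[].
  by apply: leq_trans yq; rewrite ltn_subrL x0 (leq_trans x0 le_xy).
have us : uniq s by rewrite filter_uniq // iota_uniq.
case: (posnP (size s)) => [-> //|/(mem_nth 0%N)].
set y0 := nth _ _ _ => y0s.
have hornerp (f : {poly int}) y :
    (map_poly intr f : {poly 'F_p}).[red y] = (f.[y%:Z])%:~R.
  by rewrite /red horner_map.
pose gp : {poly 'F_p} := map_poly intr g.
have gp0 : gp != 0.
  have [_ Py /pk1 /(simple _ Py)] := sP _ y0s.
  rewrite -intr_Fp_eq0 // -hornerp -deriv_map -/gp.
  by apply: contraNneq => ->; rewrite deriv0 horner0.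
have rs : all (root gp) (map red s).
  apply/allP => _ /mapP[y /sP[_ _ /pk1]] gy ->.
  by rewrite /root hornerp intr_Fp_eq0.
have := max_poly_roots gp0 rs; rewrite size_map map_inj_in_uniq // => /(_ us) lt_s.
by rewrite -ltnS prednK // (leq_trans lt_s) // size_poly.
Qed.

(** * Counting solutions from above *)

(** The representatives range over [1, p^s] and not over [0, p^s[: in that way
    every coordinate has a valuation, which is at most s. *)
Definition nsols (p s : nat) (f : int -> int -> int) : nat :=
  \sum_(1 <= x < (p ^ s).+1) \sum_(1 <= y < (p ^ s).+1)
    ((p ^ s)%N %| f x%:Z y%:Z)%Z.

(** With n = deg F and F(0) <> 0, the value at (x, y) of a quasi-homogeneous
    polynomial of weights proportional to (t, r): the Newton polygon is the
    segment from (al + r n, be) to (al, be + t n). *)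
Definition qhom al be t r n (F : {poly int}) (x y : int) : int :=
  x ^+ al * y ^+ be * homog n F (x ^+ r) (y ^+ t).

Lemma sum_dvd_pow p i s : prime p -> (i <= s)%N ->
  (\sum_(1 <= x < (p ^ s).+1) (p ^ i %| x : nat) = p ^ (s - i))%N.
Proof.
move=> p_pr le_is; have pi0 : (0 < p ^ i)%N by rewrite expn_gt0 prime_gt0.
rewrite -{1}(subnKC le_is) expnD.
under eq_bigr do rewrite -[(_ %| _)%N]andbT.
by rewrite (sum_dvd_block _ (fun=> true) pi0) sum_nat_const_nat subn1 muln1.
Qed.

Lemma exchange_big4 (I1 I2 I3 I4 : Type) (r1 : seq I1) (r2 : seq I2) (r3 : seq I3)
    (r4 : seq I4) (f : I1 -> I2 -> I3 -> I4 -> nat) :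
  (\sum_(a <- r1) \sum_(b <- r2) \sum_(c <- r3) \sum_(d <- r4) f a b c d =
   \sum_(c <- r3) \sum_(d <- r4) \sum_(a <- r1) \sum_(b <- r2) f a b c d)%N.
Proof.
under eq_bigr do rewrite exchange_big /=.
rewrite exchange_big /=; apply: eq_bigr => c _.
by under eq_bigr do rewrite exchange_big /=; rewrite exchange_big.
Qed.

Lemma sum2_ge1 m n (P : nat -> nat -> bool) i j :
  (i < m)%N -> (j < n)%N -> P i j ->
  (1 <= \sum_(0 <= i < m) \sum_(0 <= j < n) (P i j : nat))%N.
Proof.
move=> im jn Pij; rewrite (big_rem i) ?mem_index_iota //=.
by rewrite (big_rem j) ?mem_index_iota //= Pij -addnA.
Qed.

Lemma sub2_split i j s : (i <= s -> j <= s ->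
  (i + j <= 2 * s) = true /\ 2 * s - (i + j) = (s - i) + (s - j))%N.
Proof. by move=> *; split; [apply/idP|]; lia. Qed.

Lemma and_le (a b c d : bool) : ([&& a, b & c] && d <= [&& a, d & c])%N.
Proof. by case: a b c d => [] [] [] []. Qed.

(** The solutions are covered by three families of sets, indexed by lattice
    points: [T1] and [T2] for the pairs of valuations (i, j) on one or the
    other side of the ray r i = t j, where the valuation of the form is
    determined by (i, j), and [T3] on the ray, where it also depends on the
    unit y'^t / x'^r. The parameter U of [T1] and [T2] is the distance
    |t j - r i| to the ray, so that the cones become quadrants. *)
Section Upper.

Variables (p s : nat) (al be t r n e : nat) (F G : {poly int}).
Hypotheses (p_pr : prime p) (t0 : (0 < t)%N) (r0 : (0 < r)%N) (cop : coprime t r).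
Let De := (t * al + r * be + t * r * n)%N.
Hypotheses (rDe : (r <= De)%N) (pt : ~~ (p %| t)%N).
Hypotheses (sF : (size F <= n.+1)%N) (pF0 : ~~ (p %| F`_0)%Z) (pFn : ~~ (p %| F`_n)%Z).
Hypothesis simpleG : forall w : int, (p %| G.[w])%Z -> ~~ (p %| (G^`()).[w])%Z.
Hypothesis rootFG : forall (k : nat) (w : int), ((p ^ k)%N %| F.[w])%Z ->
  exists a, [/\ (a <= k)%N, (k <= e * a)%N & ((p ^ a)%N %| G.[w])%Z].

(* the inverse of a unit modulo p^s, by Euler's theorem *)
Let inv (x : nat) : nat := (x ^ (totient (p ^ s)).-1)%N.

Let p_gt0 k : (0 < p ^ k)%N. Proof. by rewrite expn_gt0 prime_gt0. Qed.

Let inv_unit x : ~~ (p %| x)%N -> ~~ (p %| inv x)%N.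
Proof. by apply: contra; rewrite Euclid_dvdX // => /andP[]. Qed.

Let invP x : ~~ (p %| x)%N -> ((p ^ s)%N %| (x%:Z * (inv x)%:Z - 1)%R)%Z.
Proof.
move=> px; rewrite -eqz_mod_dvd -PoszM /inv -expnS prednK ?totient_gt0 //.
rewrite !modz_nat eqz_nat; apply/eqP/cyclic.Euler_exp_totient.
by rewrite coprime_sym coprimeXl // prime_coprime.
Qed.

Let T1 (x y U i : nat) : bool :=
  let j := ((U + r * i) %/ t)%N in
  [&& [&& (t %| U + r * i)%N, (j <= s)%N & (t * s <= be * U + De * i)%N],
      (p ^ i %| x)%N & (p ^ j %| y)%N].

Let T2 (x y U j : nat) : bool :=
  let i := ((U + t * j) %/ r)%N in
  [&& [&& (r %| U + t * j)%N, (i <= s)%N & (r * s <= al * U + De * j)%N],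
      (p ^ i %| x)%N & (p ^ j %| y)%N].

Let Q (a : nat) (c : int) (y : nat) : bool :=
  ~~ (p %| y)%N && ((p ^ a)%N %| G.[c * y%:Z ^+ t])%Z.

(* x = p^(t l) x', y = p^(r l) y', with units x' and y' and p^a dividing
   G at y'^t / x'^r *)
Let T3 (x y l a : nat) : bool :=
  [&& [&& (t * l <= s)%N, (r * l + a <= s)%N & (s <= e * a + De * l)%N],
      (p ^ (t * l) %| x)%N && ~~ (p %| x %/ p ^ (t * l))%N &
      (p ^ (r * l) %| y)%N &&
        Q a ((inv (x %/ p ^ (t * l)))%:Z ^+ r) (y %/ p ^ (r * l))].

(* dehomogenizing at a unit X with inverse X' modulo p^s *)
Let homog_unit (X X' Y : int) k : (k <= s)%N -> ~~ (p %| X)%Z ->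
  ((p ^ s)%N %| (X * X' - 1)%R)%Z -> ((p ^ k)%N %| homog n F X Y)%Z ->
  ((p ^ k)%N %| F.[Y * X'])%Z.
Proof.
move=> ks pX /(dvdz_expl ks) XX' dk.
rewrite -(@Gauss_pexp p p_pr k (X ^+ n)) ?prime_dvdz_expN // -homog_mul //.
have := @dvdz_homog (p ^ k)%N n F X X (X * (Y * X')) Y.
rewrite subrr dvdz0 => /(_ isT) h.
rewrite -[homog _ _ _ _](subrK (homog n F X Y)) rpredD //; apply: h.
have -> : X * (Y * X') - Y = Y * (X * X' - 1) by ring.
exact: dvdz_mull.
Qed.

Let unit_r (X Y : int) : ~~ (p %| X)%Z -> (p %| Y)%Z -> ~~ (p %| homog n F X Y)%Z.
Proof.
move=> pX pY; apply: contra pF0 => h.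
have := @dvdz_homog p n F X X Y 0; rewrite subrr dvdz0 subr0 => /(_ isT pY) /(rpredB h).
by rewrite subKr homog0r prime_dvdz_mul // (negPf (prime_dvdz_expN p_pr n pX)) ?orbF.
Qed.

Let unit_l (X Y : int) : (p %| X)%Z -> ~~ (p %| Y)%Z -> ~~ (p %| homog n F X Y)%Z.
Proof.
move=> pX pY; apply: contra pFn => h.
have := @dvdz_homog p n F X 0 Y Y; rewrite subrr dvdz0 subr0 => /(_ pX isT) /(rpredB h).
by rewrite subKr homog0l prime_dvdz_mul // (negPf (prime_dvdz_expN p_pr n pY)) ?orbF.
Qed.

Let cover x y : (0 < x <= p ^ s)%N -> (0 < y <= p ^ s)%N ->
  ((p ^ s)%N %| qhom al be t r n F x%:Z y%:Z)%Z ->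
  [\/ exists U i, [/\ (U <= t * s)%N, (i <= s)%N & T1 x y U i],
      exists U i, [/\ (U <= r * s)%N, (i <= s)%N & T2 x y U i] |
      exists l a, [/\ (l <= s)%N, (a <= s)%N & T3 x y l a]].
Proof.
move=> /andP[x0 xs] /andP[y0 ys].
have [i [x' px' xE]] : exists i, exists2 x', ~~ (p %| x')%N & x = (p ^ i * x')%N.
  have [x' cx xE] := pfactor_coprime p_pr x0; exists (logn p x); exists x'.
    by rewrite -prime_coprime.
  by rewrite {1}xE mulnC.
have [j [y' py' yE]] : exists i, exists2 x', ~~ (p %| x')%N & y = (p ^ i * x')%N.
  have [y' cy yE] := pfactor_coprime p_pr y0; exists (logn p y); exists y'.
    by rewrite -prime_coprime.
  by rewrite {1}yE mulnC.
have le_s k z : (0 < p ^ k * z <= p ^ s)%N -> (k <= s)%N.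
  case/andP=> z0 le_z; rewrite -(leq_exp2l _ _ (prime_gt1 p_pr)).
  by apply: leq_trans le_z; rewrite leq_pmulr //; move: z0; rewrite muln_gt0 => /andP[].
have le_is : (i <= s)%N by apply: (@le_s _ x'); rewrite -xE x0.
have le_js : (j <= s)%N by apply: (@le_s _ y'); rewrite -yE y0.
have px'z : ~~ (p %| x'%:Z)%Z by rewrite dvdzE.
have py'z : ~~ (p %| y'%:Z)%Z by rewrite dvdzE.
have qE m k z : (p ^ m * z)%N%:Z ^+ k = (p ^ (m * k))%N%:Z * z%:Z ^+ k.
  by rewrite PoszM exprMn pexpzX.
(* factoring the powers of p out of f *)
have key A X Y : (p ^ (r * i))%N%:Z * x'%:Z ^+ r = (p ^ A)%N%:Z * X ->
    (p ^ (t * j))%N%:Z * y'%:Z ^+ t = (p ^ A)%N%:Z * Y ->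
    ((p ^ s)%N %| qhom al be t r n F x%:Z y%:Z)%Z =
    ((p ^ (s - (al * i + be * j + n * A)))%N %| homog n F X Y)%Z.
  move=> XE YE; rewrite /qhom xE yE !qE [(i * r)%N]mulnC [(j * t)%N]mulnC.
  rewrite XE YE homog_scale pexpzX.
  have -> (a b c d x1 y1 : int) : a * x1 * (b * y1) * (c * d) = a * b * c * (x1 * y1 * d).
    by move=> *; ring.
  rewrite -!pexpzD dvdz_pexp_mul // Gauss_pexp //.
    by rewrite ![(_ * al)%N]mulnC ![(_ * be)%N]mulnC [(A * n)%N]mulnC.
  by rewrite prime_dvdz_mul // negb_or !prime_dvdz_expN.
have unit_le X Y k : ((p ^ (s - k))%N %| homog n F X Y)%Z -> ~~ (p %| homog n F X Y)%Z ->
   (s <= k)%N.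
  by move=> d u; apply/eqP; apply: (@dvdz_pexp_unit p _ (homog n F X Y)).
case: (ltngtP (r * i) (t * j)) => [lt|lt|eq_ij].
- rewrite (@key (r * i)%N (x'%:Z ^+ r) ((p ^ (t * j - r * i))%N%:Z * y'%:Z ^+ t)) //; last first.
    by rewrite mulrA -pexpzD subnKC // ltnW.
  move/unit_le => h; have {h} : (s <= al * i + be * j + n * (r * i))%N.
    apply: h; apply: unit_r; first exact: prime_dvdz_expN.
    rewrite dvdz_mulr // dvdzE !absz_nat -{1}[p]expn1 dvdn_exp2l //.
    by rewrite subn_gt0.
  move=> h; apply: Or31; exists (t * j - r * i)%N, i.
  have Uj : (t * j - r * i + r * i = t * j)%N by rewrite subnK // ltnW.
  split => //; first by rewrite (leq_trans (leq_subr _ _)) // leq_mul2l le_js orbT.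
  rewrite /T1 Uj mulKn // le_js dvdn_mulr // xE yE !dvdn_mulr //= !andbT /De.
  apply: leq_trans (leq_mul (leqnn t) h) _; rewrite leq_eqVlt; apply/orP; left; apply/eqP.
  transitivity (t * al * i + be * (t * j) + t * r * n * i)%N; first by ring.
  by rewrite -[in LHS]Uj; ring.
- rewrite (@key (t * j)%N ((p ^ (r * i - t * j))%N%:Z * x'%:Z ^+ r) (y'%:Z ^+ t)) //; last first.
    by rewrite mulrA -pexpzD subnKC // ltnW.
  move/unit_le => h; have {h} : (s <= al * i + be * j + n * (t * j))%N.
    apply: h; apply: unit_l; last exact: prime_dvdz_expN.
    rewrite dvdz_mulr // dvdzE !absz_nat -{1}[p]expn1 dvdn_exp2l //.
    by rewrite subn_gt0.
  move=> h; apply: Or32; exists (r * i - t * j)%N, j.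
  have Uj : (r * i - t * j + t * j = r * i)%N by rewrite subnK // ltnW.
  split => //; first by rewrite (leq_trans (leq_subr _ _)) // leq_mul2l le_is orbT.
  rewrite /T2 Uj mulKn // le_is dvdn_mulr // xE yE !dvdn_mulr //= !andbT /De.
  apply: leq_trans (leq_mul (leqnn r) h) _; rewrite leq_eqVlt; apply/orP; left; apply/eqP.
  transitivity (al * (r * i) + r * be * j + t * r * n * j)%N; first by ring.
  by rewrite -[in LHS]Uj; ring.
have [l iE] : exists l, i = (t * l)%N.
  have /dvdnP[l ->] : (t %| i)%N; last by exists l; rewrite mulnC.
  by rewrite -(Gauss_dvdr _ cop) eq_ij dvdn_mulr.
have jE : j = (r * l)%N.
  by apply/eqP; rewrite -(eqn_pmul2l t0) -eq_ij iE mulnCA.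
have ls : (l <= s)%N by rewrite (leq_trans _ le_is) // iE leq_pmull.
rewrite (@key (r * i)%N (x'%:Z ^+ r) (y'%:Z ^+ t)) //; last by rewrite eq_ij.
have -> : (al * i + be * j + n * (r * i) = De * l)%N by rewrite iE jE /De; ring.
have inv_r : ((p ^ s)%N %| (x'%:Z ^+ r * (inv x')%:Z ^+ r - 1)%R)%Z.
  by rewrite -exprMn -(expr1n _ r) subrXX dvdz_mulr // invP.
move/(homog_unit (leq_subr _ _) (prime_dvdz_expN p_pr r px'z) inv_r).
move/rootFG => [a [a1 a2 da]]; apply: Or33; exists l, a; split => //.
  by rewrite (leq_trans a1) // leq_subr.
rewrite /T3 -iE -jE le_is /= xE yE !dvdn_mulr // !mulKn // px' /= /Q py' mulrC da.
rewrite !andbT; apply/andP; split; last by rewrite addnC -leq_subLR.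
rewrite jE; case: (leqP (De * l) s) => h; last first.
  by move: a1; rewrite (eqP (ltnW h)) leqn0 => /eqP ->; rewrite addn0 -jE.
have rl : (r * l <= De * l)%N by rewrite leq_mul2r rDe orbT.
by rewrite (leq_trans (leq_add rl a1)) // subnKC.
Qed.

Let N := (size G).-1.

(* the roots y of G(c y^t) are simple as well, because t is prime to p *)
Let count_Q a (c : int) m : ~~ (p %| c)%Z -> (a <= m)%N ->
  (\sum_(1 <= y < (p ^ m).+1) (Q a c y : nat) <= p ^ (m - a) * (t * N).+1)%N.
Proof.
move=> pc am; have [->|a0] := posnP a.
  apply: (@leq_trans (\sum_(1 <= y < (p ^ m).+1) 1)).
    by apply: leq_sum => y _; case: (Q _ _ _).
  by rewrite sum_nat_const_nat subn1 muln1 /= subn0 leq_pmulr.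
have G0 : G != 0.
  apply: contraT; rewrite negbK => /eqP G0; have := @simpleG 0.
  by rewrite G0 deriv0 !horner0 dvdz0 => /(_ isT).
have c0 : c != 0 by apply: contraNneq pc => ->; rewrite dvdz0.
pose g := G \Po (c *: 'X^t).
have sct : size (c *: 'X^t : {poly int}) = t.+1 by rewrite size_scale // size_polyXn.
have g0 : g != 0 by rewrite /g comp_poly_eq0 // sct ltnS.
have hg y : g.[y] = G.[c * y ^+ t] by rewrite horner_comp !hornerE.
have per y : Q a c (y + p ^ a) = Q a c y.
  rewrite /Q dvdn_addl ?(dvdn_exp a0) //; congr (_ && _); rewrite -!hg.
  rewrite -(@subrK _ g.[y%:Z] g.[(y + p ^ a)%N%:Z]) rpredDl //; apply: dvdz_horner.
  by rewrite PoszD addrAC subrr add0r.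
rewrite -{1}(subnKC am) expnD sum_periodic // leq_mul2l; apply/orP; right.
have -> : (\sum_(1 <= y < (p ^ a).+1) (Q a c y : nat) = \sum_(1 <= y < (p ^ a).+1)
     (~~ (p %| y)%N && ((p ^ a)%N %| g.[y%:Z])%Z : nat))%N.
  by apply: eq_bigr => y _; rewrite /Q hg.
apply: leqW; apply: leq_trans (count_simple_roots _ a0 _ _) _ => //.
- by rewrite size_poly_gt0.
- move=> y py; rewrite hg => /simpleG pG'.
  have -> : g^`().[y%:Z] = G^`().[c * y%:Z ^+ t] * (c * (y%:Z ^+ t.-1 * t%:Z)).
    rewrite /g deriv_comp hornerM horner_comp derivZ derivXn !hornerZ hornerMn !hornerXn.
    by rewrite -mulr_natr natz.
  by rewrite !prime_dvdz_mul // !negb_or pG' pc prime_dvdz_expN ?dvdzE.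
- by rewrite size_comp_poly sct mulnC.
Qed.

(** Union bound over the three families. *)
Lemma nsols_le :
  (nsols p s (qhom al be t r n F) <=
   \sum_(0 <= U < (t * s).+1) \sum_(0 <= i < s.+1)
      ([&& t %| U + r * i, i + (U + r * i) %/ t <= 2 * s & t * s <= be * U + De * i] *
       p ^ (2 * s - (i + (U + r * i) %/ t))) +
   \sum_(0 <= U < (r * s).+1) \sum_(0 <= i < s.+1)
      ([&& r %| U + t * i, i + (U + t * i) %/ r <= 2 * s & r * s <= al * U + De * i] *
       p ^ (2 * s - (i + (U + t * i) %/ r))) +
   (t * N).+1 * \sum_(0 <= l < s.+1) \sum_(0 <= a < s.+1)
      (((t + r) * l + a <= 2 * s) && (s <= e * a + De * l)) *
       p ^ (2 * s - ((t + r) * l + a)))%N.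
Proof.
pose q := (p ^ s)%N.
pose S (T : nat -> nat -> nat -> nat -> bool) m := (\sum_(1 <= x < q.+1) \sum_(1 <= y < q.+1)
  \sum_(0 <= u < m.+1) \sum_(0 <= v < s.+1) (T x y u v : nat))%N.
have le_S : (nsols p s (qhom al be t r n F) <= S T1 (t * s) + S T2 (r * s) + S T3 s)%N.
  rewrite /nsols /S -!big_split /= big_nat [leqRHS]big_nat; apply: leq_sum => x xq.
  rewrite -!big_split /= big_nat [leqRHS]big_nat; apply: leq_sum => y yq.
  case: (boolP (_ %| _)%Z) => //= /(cover xq yq).
  case=> [[u [i [ui is_ T]]]|[u [i [ui is_ T]]]|[u [i [ui is_ T]]]].
  - by rewrite -addnA; apply: ltn_addr; apply: sum2_ge1 T.
  - by apply: ltn_addr; apply: ltn_addl; apply: sum2_ge1 T.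
  - by apply: ltn_addl; apply: sum2_ge1 T.
apply: (leq_trans le_S).
have SE T m : S T m = (\sum_(0 <= u < m.+1) \sum_(0 <= v < s.+1)
  \sum_(1 <= x < q.+1) \sum_(1 <= y < q.+1) (T x y u v : nat))%N by exact: exchange_big4.
rewrite !SE {SE le_S S}.
have half (c : bool) i j : (c -> i <= s)%N -> (c -> j <= s)%N ->
    (\sum_(1 <= x < q.+1) \sum_(1 <= y < q.+1)
       ([&& c, p ^ i %| x & p ^ j %| y] : nat) <=
     (c && (i + j <= 2 * s)) * p ^ (2 * s - (i + j)))%N.
  case: c => [/(_ isT) is_ /(_ isT) js|_ _]; last by rewrite big1 // => x _; rewrite big1.
  have [-> ->] := sub2_split is_ js.
  rewrite mul1n expnD -!sum_dvd_pow // big_distrl /=; apply: leq_sum => x _.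
  by rewrite big_distrr /=; apply: leq_sum => y _; rewrite mulnb.
apply: leq_add; first apply: leq_add.
- rewrite big_nat [leqRHS]big_nat; apply: leq_sum => u _.
  rewrite big_nat [leqRHS]big_nat; apply: leq_sum => i /andP[_ is_].
  apply: leq_trans (half _ _ _ _ _) _ => //; first by case/and3P.
  by rewrite leq_mul // and_le.
- rewrite big_nat [leqRHS]big_nat; apply: leq_sum => u _.
  rewrite big_nat [leqRHS]big_nat; apply: leq_sum => i /andP[_ is_].
  rewrite [(i + _)%N]addnC; apply: leq_trans (half _ _ _ _ _) _ => //; first by case/and3P.
  by rewrite leq_mul // and_le.
- rewrite big_distrr /= big_nat [leqRHS]big_nat; apply: leq_sum => l _.
  rewrite big_distrr /= big_nat [leqRHS]big_nat; apply: leq_sum => a _.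
  rewrite /T3; case: (boolP [&& _, _ & _]) => [/and3P[tls rls ->]|_] /=; last first.
    by rewrite big1 // => x _; rewrite big1.
  have rl : (r * l <= s)%N by exact: leq_trans (leq_addr _ _) rls.
  have [] := sub2_split tls rls; rewrite addnA -mulnDl => -> ->.
  rewrite mul1n expnD mulnCA -(sum_dvd_pow p_pr tls) big_distrl /=; apply: leq_sum => x _.
  case: (boolP (p ^ (t * l) %| x)%N) => //= _; last by rewrite big1.
  rewrite mul1n; case: (boolP (p %| _)%N) => /= [_|px]; first by rewrite big1.
  rewrite /q -{1}(subnKC rl) expnD.
  rewrite (sum_dvd_block _ (Q a ((inv (x %/ p ^ (t * l)))%:Z ^+ r))) // [leqRHS]mulnC.
  rewrite subnDA; apply: count_Q; last by rewrite leq_subRL.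
  by rewrite prime_dvdz_expN // dvdzE inv_unit.
Qed.

End Upper.

(** * Sums over lattice points of a cone *)

Section Cone.
Variable R : realType.
Implicit Types (b c w S T : R).

Definition geom w : R := (1 - 2 `^ (- w))^-1.

Lemma powRN_le w b : 0 <= w -> 2 <= b -> b `^ (- w) <= 2 `^ (- w).
Proof.
move=> w0 b2; rewrite !powRN lef_pV2 ?posrE ?powR_gt0 //; last by lra.
by apply: ge0_ler_powR => //; rewrite nnegrE; lra.
Qed.

Lemma two_powN_lt1 w : 0 < w -> 2 `^ (- w) < 1 :> R.
Proof.
move=> w0; rewrite powRN invf_lt1 ?powR_gt0 //.
have : 1 `^ w < 2 `^ w :> R by rewrite gt0_ltr_powR ?nnegrE //; lra.
by rewrite powR1.
Qed.

Lemma geom_ge1 w : 0 < w -> 1 <= geom w.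
Proof.
move=> w0; have := two_powN_lt1 w0; have := powR_gt0 (- w) (ltr0Sn R 1) => h1 h2.
by rewrite /geom invf_ge1; lra.
Qed.

Lemma geom_anti w w' : 0 < w -> w <= w' -> geom w' <= geom w.
Proof.
move=> w0 ww'; have h1 := two_powN_lt1 w0; have h2 := two_powN_lt1 (lt_le_trans w0 ww').
rewrite /geom lef_pV2 ?posrE; [|lra|lra].
suff : 2 `^ (- w') <= 2 `^ (- w) :> R by lra.
by rewrite ler_powR ?lerN2 //; lra.
Qed.

Lemma geom_sum w b c m : 0 < w -> 2 <= b ->
  \sum_(0 <= k < m) b `^ (- (c + w * k%:R)) <= b `^ (- c) * geom w.
Proof.
move=> w0 b2; have b0 : 0 < b by lra.
have h1 := two_powN_lt1 w0; have := geom_ge1 w0 => g1.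
elim: m c => [|m IH] c.
  by rewrite big_nil mulr_ge0 ?powR_ge0 //; lra.
rewrite big_nat_recl //= mulr0 addr0.
under eq_bigr do rewrite -natr1 mulrDr mulr1 [w * _ + w]addrC addrA.
apply: le_trans (_ : b `^ (- c) + b `^ (- (c + w)) * geom w <= _); first by rewrite lerD2l.
rewrite opprD powRD ?(gt_eqF b0) ?implybT // -mulrA -{1}[b `^ (- c)]mulr1 -mulrDr.
rewrite ler_wpM2l ?powR_ge0 //.
have : b `^ (- w) * geom w <= 2 `^ (- w) * geom w.
  by rewrite ler_wpM2r ?powRN_le //; lra.
have : geom w - 2 `^ (- w) * geom w = 1.
  by rewrite -[X in X - _]mul1r -mulrBl mulfV //; lra.
lra.
Qed.

Lemma geom_sum_tail w b c T m : 0 < w -> 2 <= b ->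
  \sum_(0 <= k < m) (T <= c + w * k%:R)%R%:R * b `^ (- (c + w * k%:R)) <= b `^ (- T) * geom w.
Proof.
move=> w0 b2; have b0 : 0 < b by lra.
have := geom_ge1 w0 => g1.
elim: m c => [|m IH] c.
  by rewrite big_nil mulr_ge0 ?powR_ge0 //; lra.
have [Tc|cT] := leP T c.
  apply: (@le_trans _ _ (b `^ (- c) * geom w)); last first.
    by rewrite ler_wpM2r ?ler_powR ?lerN2 //; lra.
  apply: le_trans (geom_sum _ m.+1 w0 b2); apply: ler_sum => k _.
  by rewrite ler_piMl ?powR_ge0 // lern1 leq_b1.
rewrite big_nat_recl //= mulr0 addr0 (lt_geF cT) mul0r add0r.
under eq_bigr do rewrite -natr1 mulrDr mulr1 [w * _ + w]addrC addrA.
exact: IH.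
Qed.

(** The sum over j is geometric and costs a bounded factor, whatever its first
    term; the slack [dl * i] in the exponent is then the decay available for
    the sum over i. There is none if [dl = 0], and that sum counts its terms. *)
Lemma cone_sum (w1 w2 S dl b : R) (P : nat -> nat -> bool) m1 m2 :
  0 < w2 -> 0 <= dl -> 2 <= b ->
  (forall i j, P i j -> S + dl * i%:R <= w1 * i%:R + w2 * j%:R) ->
  \sum_(0 <= i < m1) \sum_(0 <= j < m2) (P i j)%:R * b `^ (- (w1 * i%:R + w2 * j%:R))
  <= b `^ (- S) * geom w2 * \sum_(0 <= i < m1) 2 `^ (- (dl * i%:R)).
Proof.
move=> w20 dl0 b2 HP; rewrite mulr_sumr; apply: ler_sum => i _.
have b0 : 0 < b by lra.
apply: le_trans (_ : b `^ (- (S + dl * i%:R)) * geom w2 <= _); last first.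
  rewrite opprD powRD ?(gt_eqF b0) ?implybT // mulrAC ler_wpM2l //.
    by rewrite mulr_ge0 ?powR_ge0 //; have := geom_ge1 w20; lra.
  by apply: powRN_le => //; rewrite mulr_ge0.
apply: le_trans (geom_sum_tail (w1 * i%:R) (S + dl * i%:R) m2 w20 b2).
apply: ler_sum => j _; rewrite ler_wpM2r ?powR_ge0 // ler_nat.
by case: (boolP (P i j)) => // /HP ->.
Qed.

(** A point of the quadrant has weight w1 i + w2 j, and the form has valuation
    h1 w1 i + h2 w2 j there, so reaching valuation s takes weight s / h at
    least, and strictly more away from an axis of exponent less than h. If an
    axis has exponent less than h, one first sums along the other one and the
    total is a constant times p^(-s/h); if both have exponent h, one gets one
    such term for each of the m1 lines: this is where the logarithmic factor
    comes from. *)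
Lemma cone_bound (w1 w2 h1 h2 h om ga b : R) (s : nat) (P : nat -> nat -> bool) m1 m2 :
  0 < om -> om <= w1 -> om <= w2 -> 0 < h -> h1 <= h -> h2 <= h -> 0 < ga -> 2 <= b ->
  (forall i j, P i j -> s%:R <= h1 * w1 * i%:R + h2 * w2 * j%:R) ->
  let Sm := \sum_(0 <= i < m1) \sum_(0 <= j < m2)
       (P i j)%:R * b `^ (- (w1 * i%:R + w2 * j%:R)) in
  (ga <= 1 - h1 / h \/ ga <= 1 - h2 / h ->
     Sm <= geom om * geom (ga * om) * b `^ (- (s%:R / h))) /\
  Sm <= geom om * m1%:R * b `^ (- (s%:R / h)).
Proof.
move=> om0 ow1 ow2 h0 h1h h2h ga0 b2 HP Sm.
have d1 : 0 <= 1 - h1 / h by rewrite subr_ge0 ler_pdivrMr // mul1r.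
have d2 : 0 <= 1 - h2 / h by rewrite subr_ge0 ler_pdivrMr // mul1r.
have w10 : 0 < w1 by lra.
have w20 : 0 < w2 by lra.
have og0 : 0 < ga * om by rewrite mulr_gt0.
have gg : 0 < geom om by have := geom_ge1 om0; lra.
have key i j : P i j -> s%:R / h + (1 - h1 / h) * w1 * i%:R + (1 - h2 / h) * w2 * j%:R
     <= w1 * i%:R + w2 * j%:R.
  move/HP => /(ler_wpM2r (ltW (_ : 0 < h^-1))); rewrite invr_gt0 => /(_ h0).
  rewrite -subr_ge0 => H; rewrite -subr_ge0; apply: le_trans H _.
  by rewrite le_eqVlt; apply/orP; left; apply/eqP; ring.
have sumG dl m : ga * om <= dl -> \sum_(0 <= i < m) 2 `^ (- (dl * i%:R)) <= geom (ga * om).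
  move=> dlg; have dl0 : 0 < dl by lra.
  apply: le_trans (geom_anti og0 dlg).
  have := @geom_sum dl 2 0 m dl0 (lexx _); rewrite oppr0 powRr0 mul1r.
  by under eq_bigr do rewrite add0r.
have bp x : 0 <= b `^ x by apply: powR_ge0.
have ns i : 0 <= i%:R :> R by [].
split=> [[g1|g2]|].
- have dl0 : 0 <= (1 - h1 / h) * w1 by rewrite mulr_ge0 // ltW.
  apply: le_trans (cone_sum (w2 := w2) (S := s%:R / h) m1 m2 w20 dl0 b2 _) _.
    move=> i j /key; have : 0 <= (1 - h2 / h) * w2 * j%:R by rewrite !mulr_ge0 // ltW.
    by lra.
  rewrite -mulrA mulrC ler_wpM2r // ler_pM //.
  + by rewrite invr_ge0 subr_ge0 ltW // two_powN_lt1.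
  + by apply: sumr_ge0 => i _; exact: powR_ge0.
  + exact: geom_anti.
  + by apply: sumG; rewrite ler_pM // ltW.
- have dl0 : 0 <= (1 - h2 / h) * w2 by rewrite mulr_ge0 // ltW.
  rewrite /Sm exchange_big /=.
  under eq_bigr do under eq_bigr do rewrite [w1 * _ + _]addrC.
  apply: le_trans (cone_sum (w2 := w1) (S := s%:R / h) (P := fun j i => P i j) m2 m1 w10 dl0 b2 _) _.
    move=> j i /key; have : 0 <= (1 - h1 / h) * w1 * i%:R by rewrite !mulr_ge0 // ltW.
    by lra.
  rewrite -mulrA mulrC ler_wpM2r // ler_pM //.
  + by rewrite invr_ge0 subr_ge0 ltW // two_powN_lt1.
  + by apply: sumr_ge0 => i _; exact: powR_ge0.
  + exact: geom_anti.
  + by apply: sumG; rewrite ler_pM // ltW.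
- apply: le_trans (cone_sum (w2 := w2) (S := s%:R / h) m1 m2 w20 (lexx 0) b2 _) _.
    move=> i j /key; have : 0 <= (1 - h2 / h) * w2 * j%:R by rewrite !mulr_ge0 // ltW.
    have : 0 <= (1 - h1 / h) * w1 * i%:R by rewrite !mulr_ge0 // ltW.
    by lra.
  rewrite -mulrA mulrC ler_wpM2r // ler_pM //.
  + by rewrite invr_ge0 subr_ge0 ltW // two_powN_lt1.
  + by apply: sumr_ge0 => i _; exact: powR_ge0.
  + exact: geom_anti.
  + under eq_bigr do rewrite mul0r oppr0 powRr0.
    by rewrite sumr_const_nat subn0.
Qed.

End Cone.

(** * The upper bound *)

Section UpperReal.
Variable R : realType.

Definition cone_const (D : nat) (ga : R) : R :=
  geom D%:R^-1 * (geom (ga / D%:R) + D.+1%:R).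

Definition upper_const (D : nat) (ga : R) : R :=
  (D * D).+3%:R * cone_const D ga.

Lemma cone_const_gt0 D ga : (0 < D)%N -> 0 < ga -> 0 < cone_const D ga.
Proof.
move=> D0 ga0; have D0' : 0 < D%:R :> R by rewrite ltr0n.
have g1 : 1 <= geom D%:R^-1 :> R by rewrite geom_ge1 ?invr_gt0.
have g2 : 1 <= geom (ga / D%:R) by rewrite geom_ge1 ?divr_gt0.
have g3 : 0 <= D.+1%:R :> R by [].
by rewrite /cone_const mulr_gt0 //; lra.
Qed.

Lemma powR_pdiv (p m k : nat) : (0 < p)%N -> (m <= k)%N ->
  (p ^ (k - m))%:R / (p ^ k)%:R = p%:R `^ (- m%:R) :> R.
Proof.
move=> p0 mk; have p0' : p%:R != 0 :> R by rewrite pnatr_eq0 -lt0n.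
rewrite powR_invn // !natrX -{2}(subnK mk) exprD invfM mulrA mulfV ?mul1r //.
exact: expf_neq0.
Qed.

(** The bound D on the slopes makes the constant independent of the cone; the
    number m1 of lines is O(s), whence the factor s^nu. *)
Lemma cone_sum_density (p s m1 m2 D nu : nat) (f : nat -> nat -> nat) (P : nat -> nat -> bool)
    (w1 w2 h1 h2 h ga : R) :
  (1 < p)%N -> (0 < D)%N -> (0 < s)%N -> (m1 <= (D * s).+1)%N -> (nu <= 1)%N ->
  D%:R^-1 <= w1 -> D%:R^-1 <= w2 -> 0 < h -> h1 <= h -> h2 <= h -> 0 < ga ->
  (nu = 0%N -> ga <= 1 - h1 / h \/ ga <= 1 - h2 / h) ->
  (forall i j, P i j -> [/\ (f i j <= 2 * s)%N,
     (f i j)%:R = w1 * i%:R + w2 * j%:R & s%:R <= h1 * w1 * i%:R + h2 * w2 * j%:R]) ->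
  (\sum_(0 <= i < m1) \sum_(0 <= j < m2) (P i j * p ^ (2 * s - f i j)))%N%:R / (p ^ (2 * s))%:R
  <= cone_const D ga * s%:R ^+ nu * p%:R `^ (- (s%:R / h)).
Proof.
move=> p1 D0 s0 m1D nu1 ow1 ow2 h0 h1h h2h ga0 gap HP.
have om0 : 0 < D%:R^-1 :> R by rewrite invr_gt0 ltr0n.
have p2 : 2 <= p%:R :> R by rewrite ler_nat.
have HP' i j : P i j -> s%:R <= h1 * w1 * i%:R + h2 * w2 * j%:R by case/HP.
have [B1 B2] := @cone_bound R w1 w2 h1 h2 h _ ga p%:R s P m1 m2 om0 ow1 ow2 h0 h1h h2h ga0 p2 HP'.
rewrite natr_sum mulr_suml.
have -> : \sum_(0 <= i < m1) (\sum_(0 <= j < m2) P i j * p ^ (2 * s - f i j))%N%:R / (p ^ (2 * s))%:R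
  = \sum_(0 <= i < m1) \sum_(0 <= j < m2) (P i j)%:R * p%:R `^ (- (w1 * i%:R + w2 * j%:R)) :> R.
  apply: eq_bigr => i _; rewrite natr_sum mulr_suml; apply: eq_bigr => j _.
  rewrite natrM -mulrA; case: (boolP (P i j)) => [/HP[f2 <- _]|_]; last by rewrite !mul0r.
  by rewrite powR_pdiv // ltnW.
have g1 : 1 <= geom D%:R^-1 :> R by rewrite geom_ge1 // invr_gt0 ltr0n.
have g2 : 1 <= geom (ga / D%:R) by rewrite geom_ge1 // divr_gt0 // ltr0n.
have bp : 0 <= p%:R `^ (- (s%:R / h)) by apply: powR_ge0.
case: nu nu1 gap => [|[]] // _ gap.
  apply: le_trans (B1 (gap erefl)) _; rewrite expr0 mulr1 ler_wpM2r // /cone_const.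
  by rewrite ler_wpM2l ?lerDl //; lra.
apply: le_trans B2 _; rewrite expr1 ler_wpM2r // /cone_const -mulrA ler_wpM2l //; first by lra.
apply: (@le_trans _ _ (D.+1 * s)%N%:R); first by rewrite ler_nat (leq_trans m1D) // mulSn -add1n leq_add2r.
rewrite natrM ler_wpM2r // lerDr; lra.
Qed.

(** The three cones have axes of exponents (be, d), (al, d) and (d, e); the
    hypothesis on [nu = 0] says that none of them has both exponents equal
    to h. *)
Theorem nsols_upper (D p s al be t r n e nu : nat) (F G : {poly int}) (h ga : R) :
  let De := (t * al + r * be + t * r * n)%N in
  let d := De%:R / (t + r)%:R in
  prime p -> (0 < D)%N -> (0 < s)%N -> (0 < t <= D)%N -> (0 < r <= D)%N ->
  coprime t r -> (r <= De)%N -> ~~ (p %| t)%N ->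
  (size F <= n.+1)%N -> ~~ (p %| F`_0)%Z -> ~~ (p %| F`_n)%Z ->
  (forall w : int, (p %| G.[w])%Z -> ~~ (p %| (G^`()).[w])%Z) ->
  (forall (k : nat) (w : int), ((p ^ k)%N %| F.[w])%Z ->
     exists a, [/\ (a <= k)%N, (k <= e * a)%N & ((p ^ a)%N %| G.[w])%Z]) ->
  ((size G).-1 <= D)%N ->
  0 < h -> al%:R <= h -> be%:R <= h -> e%:R <= h -> d <= h -> 0 < ga -> (nu <= 1)%N ->
  (nu = 0%N -> ga <= 1 - d / h \/
     [/\ ga <= 1 - al%:R / h, ga <= 1 - be%:R / h & ga <= 1 - e%:R / h]) ->
  (nsols p s (qhom al be t r n F))%:R / (p ^ (2 * s))%:R <=
    upper_const D ga * s%:R ^+ nu * p%:R `^ (- (s%:R / h)).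
Proof.
move=> De d p_pr D0 s0 /andP[t0 tD] /andP[r0 rD] cop rDe pt sF pF0 pFn simpleG rootFG sG.
move=> h0 alh beh eh dh ga0 nu1 gap.
have p1 := prime_gt1 p_pr.
have pos k : 0 < (p ^ k)%:R :> R by rewrite ltr0n expn_gt0 ltnW.
have tR : t%:R != 0 :> R by rewrite pnatr_eq0 -lt0n.
have rR : r%:R != 0 :> R by rewrite pnatr_eq0 -lt0n.
have trR : t%:R + r%:R != 0 :> R by rewrite -natrD pnatr_eq0 -lt0n addn_gt0 t0.
have t1 : 1 <= t%:R :> R by rewrite ler1n.
have r1 : 1 <= r%:R :> R by rewrite ler1n.
have DV k : (0 < k <= D)%N -> D%:R^-1 <= k%:R^-1 :> R.
  by case/andP=> k0 kD; rewrite lef_pV2 ?posrE ?ltr0n // ler_nat.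
have D1 : D%:R^-1 <= 1 :> R by rewrite -[leRHS]invr1; apply: (DV 1%N).
have := nsols_le s p_pr t0 r0 cop rDe pt sF pF0 pFn simpleG rootFG.
have ip : 0 < (p ^ (2 * s))%:R^-1 :> R by rewrite invr_gt0.
rewrite -(ler_nat R) -(ler_pM2r ip) => /le_trans; apply.
rewrite natrD natrD natrM 2!mulrDl -[X in _ + X]mulrA.
set K := cone_const D ga * s%:R ^+ nu * p%:R `^ (- (s%:R / h)).
have K0 : 0 <= K.
  by rewrite mulr_ge0 ?powR_ge0 // mulr_ge0 ?exprn_ge0 // ltW // cone_const_gt0.
have -> : upper_const D ga * s%:R ^+ nu * p%:R `^ (- (s%:R / h)) = K + K + (D * D).+1%:R * K.
  rewrite /upper_const /K -addn2 natrD; ring.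
apply: lerD; first apply: lerD.
- apply: (@cone_sum_density _ _ _ _ _ _ _ _ t%:R^-1 ((t + r)%:R / t%:R) be%:R d) => //.
  + by rewrite ltnS leq_mul2r tD orbT.
  + by apply: DV; rewrite t0.
  + by rewrite natrD mulrDl mulfV //; apply: le_trans D1 _; rewrite lerDl divr_ge0.
  + by case/gap => [|[]]; [right|left].
  + move=> U i /and3P[tU le2 cond]; split => //.
      rewrite natrD -[(_ %/ t)%:R](mulfK tR) -natrM divnK // natrD natrM natrD; field.
      exact: tR.
    have : (t * s)%N%:R <= (be * U + De * i)%N%:R :> R by rewrite ler_nat.
    rewrite natrD !natrM natrD => cR.
    rewrite -(ler_pM2l (_ : 0 < t%:R)); last by rewrite ltr0n.
    apply: le_trans cR _; rewrite le_eqVlt; apply/orP; left; apply/eqP.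
    by rewrite /d natrD; field; rewrite trR tR.
- apply: (@cone_sum_density _ _ _ _ _ _ _ _ r%:R^-1 ((t + r)%:R / r%:R) al%:R d) => //.
  + by rewrite ltnS leq_mul2r rD orbT.
  + by apply: DV; rewrite r0.
  + by rewrite natrD mulrDl mulfV //; apply: le_trans D1 _; rewrite lerDr divr_ge0.
  + by case/gap => [|[]]; [right|left].
  + move=> U i /and3P[tU le2 cond]; split => //.
      rewrite natrD -[(_ %/ r)%:R](mulfK rR) -natrM divnK // natrD natrM natrD; field.
      exact: rR.
    have : (r * s)%N%:R <= (al * U + De * i)%N%:R :> R by rewrite ler_nat.
    rewrite natrD !natrM natrD => cR.
    rewrite -(ler_pM2l (_ : 0 < r%:R)); last by rewrite ltr0n.
    apply: le_trans cR _; rewrite le_eqVlt; apply/orP; left; apply/eqP.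
    by rewrite /d natrD; field; rewrite trR rR.
- apply: ler_pM => //.
  + by rewrite mulr_ge0 // invr_ge0.
  + by rewrite ler_nat ltnS leq_mul.
  apply: (@cone_sum_density _ _ _ _ _ _ _ _ (t + r)%:R 1 d e%:R) => //.
  + by rewrite ltnS leq_pmull.
  + by apply: le_trans D1 _; rewrite ler1n addn_gt0 t0.
  + by case/gap => [|[]]; [left|right].
  + move=> l a /andP[le2 cond]; split => //; first by rewrite natrD natrM mul1r.
    have : s%:R <= (e * a + De * l)%N%:R :> R by rewrite ler_nat.
    move/le_trans; apply; rewrite le_eqVlt; apply/orP; left; apply/eqP.
    by rewrite !natrD !natrM /d natrD; field; rewrite trR.
Qed.

End UpperReal.

(** * Counting solutions from below *)

Lemma nsols_swap p s f : nsols p s (fun x y => f y x) = nsols p s f.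
Proof. exact: exchange_big. Qed.

Lemma ge_half a b c : (a + b = c -> 2 * b <= c -> c <= 2 * a)%N.
Proof. by lia. Qed.

Lemma split_sub i N s : (i <= N -> N <= s ->
  (2 * s - N = (s - i) + (s - (N - i))) /\ N - i <= s)%N.
Proof. by lia. Qed.

Section Lower.
Variables (p : nat).
Hypothesis p_pr : prime p.
Local Notation q k := ((p ^ k)%N%:Z).

Let p_gt0 k : (0 < p ^ k)%N. Proof. by rewrite expn_gt0 prime_gt0. Qed.

Lemma count_congr m s (c : int) : (m <= s)%N ->
  (p ^ (s - m) <= \sum_(1 <= y < (p ^ s).+1) (q m %| (y%:Z - c)%R)%Z)%N.
Proof.
move=> ms; rewrite -{2}(subnKC ms) expnD (sum_periodic _ (P := fun y => (q m %| (y%:Z - c)%R)%Z)).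
  rewrite leq_pmulr //.
  have [y /andP[y0 yq] dy] : exists2 y : nat, (0 < y <= p ^ m)%N & (q m %| (y%:Z - c)%R)%Z.
    have q0 : q m != 0 by rewrite eqz_nat -lt0n.
    have c0 := modz_ge0 c q0.
    have cq : (c %% q m)%Z < q m by rewrite ltz_pmod // ltz_nat.
    have dc : (q m %| (c %% q m)%Z - c)%Z by rewrite -eqz_mod_dvd modz_mod.
    move: c0 cq dc; case: (c %% q m)%Z => // -[|k] _ cq dc.
      exists (p ^ m)%N; first by rewrite p_gt0 leqnn.
      by rewrite -[X in (_ %| X)%Z]addr0 -[X in (_ %| X)%Z]addrA rpredD // -[- c + 0]addrC.
    by exists k.+1 => //=; rewrite ltnW.
  by rewrite (big_rem y) ?mem_index_iota ?ltnS ?y0 //= dy.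
by move=> y; rewrite PoszD addrAC rpredDr.
Qed.

Lemma count_val i s : (i <= s)%N ->
  (p ^ (s - i) <= 2 * \sum_(1 <= x < (p ^ s).+1) (logn p x == i : nat))%N.
Proof.
move=> is_; have -> : (\sum_(1 <= x < (p ^ s).+1) (logn p x == i : nat) =
    \sum_(1 <= x < (p ^ s).+1) ((p ^ i %| x) && ~~ (p %| x %/ p ^ i) : nat))%N.
  rewrite big_nat [RHS]big_nat; apply: eq_bigr => x /andP[x0 _]; congr nat_of_bool.
  rewrite eqn_leq -pfactor_dvdn // -ltnS ltnNge -pfactor_dvdn // andbC.
  case: (boolP (p ^ i %| x)%N) => //= d; congr (~~ _).
  by rewrite -[in RHS](@dvdn_pmul2r (p ^ i)) // divnK // expnS.
rewrite -{2}(subnKC is_) expnD (sum_dvd_block _ (fun x => ~~ (p %| x)%N)) //.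
set k := (s - i)%N.
have tot : (\sum_(1 <= x < (p ^ k).+1) (~~ (p %| x)%N : nat) +
            \sum_(1 <= x < (p ^ k).+1) ((p %| x)%N : nat) = p ^ k)%N.
  rewrite -big_split /= -[RHS](muln1 (p ^ k)%N) -[X in (X * 1)%N](subn1 (p ^ k).+1%N).
  by rewrite -sum_nat_const_nat; apply: eq_bigr => x _; case: (_ %| _)%N.
have [k0|k0] := posnP k.
  by rewrite k0 expn0 big_nat1 dvdn1; case: eqP p_pr => // ->.
have := @sum_dvd_pow p 1 k p_pr k0; rewrite expn1 => e; rewrite e in tot.
have : (2 * p ^ (k - 1) <= p ^ k)%N.
  by rewrite -[k in leqRHS](subnK k0) addn1 expnS leq_mul2r prime_gt1 // orbT.
exact: ge_half tot.
Qed.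

(** All the large sets of solutions have one shape: v(x) = i exactly, and y in
    a residue class modulo p^(N-i) that depends on x. Each has density about
    p^-N, and distinct values of i give disjoint sets, so the number of
    admissible i is the logarithmic factor. *)
Lemma lower_sets (f : int -> int -> int) (g : nat -> int) (I : pred nat) N s :
  (N <= s)%N ->
  (forall i x y, (i <= N)%N -> I i -> (0 < x)%N -> logn p x = i ->
     (q (N - i) %| (y%:Z - g x)%R)%Z -> (q s %| f x%:Z y%:Z)%Z) ->
  (p ^ (2 * s - N) * \sum_(0 <= i < N.+1) (I i : nat) <= 2 * nsols p s f)%N.
Proof.
move=> Ns H.
pose B i x y := [&& I i, logn p x == i & (q (N - i) %| (y%:Z - g x)%R)%Z].
have le : (\sum_(0 <= i < N.+1) \sum_(1 <= x < (p ^ s).+1) \sum_(1 <= y < (p ^ s).+1)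
      (B i x y : nat) <= nsols p s f)%N.
  rewrite exchange_big /= /nsols big_nat [leqRHS]big_nat; apply: leq_sum => x /andP[x0 _].
  rewrite exchange_big /=; apply: leq_sum => y _.
  case: (boolP (_ %| f _ _)%Z) => [_|nf] /=.
    apply: (@leq_trans (\sum_(0 <= i < N.+1) (i == logn p x : nat))).
      by apply: leq_sum => i _; rewrite /B eq_sym; case: (I i); case: (i == _) => //; case: (_ %| _)%Z.
    by rewrite sum_pred_size size_filter count_uniq_mem ?iota_uniq // leq_b1.
  rewrite big_nat big1 // => i /andP[_ iN]; rewrite /B.
  case: (boolP (I i)) => //= Ii; case: eqP => //= xi.
  case: (boolP (_ %| _)%Z) => //= d.
  by case/negP: nf; apply: H xi d => //.
apply: leq_trans (leq_mul (leqnn 2) le).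
rewrite !big_distrr /= big_nat [leqRHS]big_nat; apply: leq_sum => i /andP[_]; rewrite ltnS => iN.
have is_ : (i <= s)%N by apply: leq_trans Ns.
rewrite /B; case: (I i) => /=; last by rewrite muln0.
have -> : (p ^ (2 * s - N) * 1 = p ^ (s - i) * p ^ (s - (N - i)))%N.
  by rewrite muln1 -expnD; case: (split_sub iN Ns) => <-.
apply: leq_trans (leq_mul (count_val is_) (leqnn _)) _.
rewrite -mulnA leq_mul2l /= big_distrl /=; apply: leq_sum => x _.
case: (_ == i) => //; rewrite mul1n.
by apply: count_congr; case: (split_sub iN Ns).
Qed.

Lemma count_mul_le A B N : (0 < A)%N -> (N <= B)%N ->
  (N <= A * \sum_(0 <= i < N.+1) (A * i <= B : nat))%N.
Proof.
move=> A0 NB; have kN : ((N %/ A).+1 <= N.+1)%N by rewrite ltnS leq_div.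
apply: (@leq_trans (A * (N %/ A).+1)).
  by rewrite mulnC ltnW // ltn_ceil.
rewrite leq_mul2l; apply/orP; right.
rewrite (@big_cat_nat _ _ _ (N %/ A).+1) //=; apply: leq_trans (leq_addr _ _).
rewrite -[leqLHS]muln1 -[X in (X * 1)%N]subn0 -sum_nat_const_nat.
rewrite big_nat [leqRHS]big_nat; apply: leq_sum => i /andP[_ iA].
suff -> : (A * i <= B)%N by [].
apply: leq_trans NB; apply: (@leq_trans (A * (N %/ A))); first by rewrite leq_mul2l -ltnS iA orbT.
by rewrite mulnC leq_divM.
Qed.

(** For [nu = 0] the single value i = 0 is kept; for [nu = 1] a fixed
    proportion of the i <= N is. *)
Lemma lower_sets_nu (f : int -> int -> int) (g : nat -> int) A B nu N s :
  (N <= s)%N -> (0 < A)%N -> (N <= B)%N -> (nu <= 1)%N ->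
  (forall i x y, (i <= N)%N -> (A * i <= B)%N -> (nu = 0 -> i = 0)%N ->
     (0 < x)%N -> logn p x = i -> (p ^ i %| x)%N ->
     (q (N - i) %| (y%:Z - g x)%R)%Z -> (q s %| f x%:Z y%:Z)%Z) ->
  (p ^ (2 * s - N) * N ^ nu <= 2 * A * nsols p s f)%N.
Proof.
move=> Ns A0 NB nu1 H.
pose I i := (A * i <= B)%N && ((nu == 1)%N || (i == 0)%N).
have := @lower_sets f g I N s Ns _.
have HI : forall i x y, (i <= N)%N -> I i -> (0 < x)%N -> logn p x = i ->
     (q (N - i) %| (y%:Z - g x)%R)%Z -> (q s %| f x%:Z y%:Z)%Z.
  move=> i x y iN /andP[AB nui] x0 xi; apply: H => //; first by case: nu nu1 nui {I} => [|[]] //= _ /eqP.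
  by rewrite pfactor_dvdn // xi.
move=> /(_ HI) h; rewrite [(2 * A)%N]mulnC -mulnA.
apply: leq_trans (leq_mul (leqnn A) h).
rewrite mulnCA leq_mul2l; apply/orP; right; rewrite /I {H HI h I}.
case: nu nu1 => [|[]] // _.
  rewrite expn0; apply: leq_trans A0 _; rewrite leq_pmulr //.
  by rewrite big_nat_recl //= muln0.
rewrite expn1; under eq_bigr do rewrite andbT.
exact: count_mul_le.
Qed.

End Lower.

Lemma lower_arith_edge t r n a b i N s nu : (0 < t)%N ->
  (i <= N -> (t + r) * i <= r * N -> (nu = 0 -> i = 0) -> s <= a * N ->
   (nu = 0 \/ a <= b + t * n) ->
   s <= a * (N - i) + b * i + n * minn (r * (N - i)) (t * i))%N.
Proof.
move=> t0 iN le nui sN hyp; have ti : (t * i <= r * (N - i))%N.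
  by rewrite mulnBr leq_subRL ?leq_mul // -mulnDl addnC.
rewrite (minn_idPr ti).
have -> : (a * (N - i) + b * i + n * (t * i) = a * (N - i) + (b + t * n) * i)%N by ring.
case: hyp => [/nui ->|ab]; first by rewrite subn0 muln0 addn0.
by apply: leq_trans sN _; rewrite -{1}(subnK iN) mulnDr leq_add2l leq_mul2r ab orbT.
Qed.

Lemma lower_arith_root e r D i N s nu : (i <= N -> (1 + r) * i <= N ->
   (nu = 0 -> i = 0) -> s <= e * N -> (nu = 0 \/ e * (1 + r) <= D) ->
   s <= D * i + e * (N - (1 + r) * i))%N.
Proof.
move=> iN le nui sN; case=> [/nui ->|eD]; first by rewrite !muln0 subn0 add0n.
apply: leq_trans sN _; rewrite -{1}(subnKC le) mulnDr leq_add2r mulnA.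
by rewrite leq_mul2r eD orbT.
Qed.

Lemma lower_arith_vertex t r n a b D i j s :
  (D = t * a + r * b + t * r * n -> 0 < D -> t * s <= D * i -> r * s <= D * j ->
   s <= a * i + b * j + n * minn (r * i) (t * j))%N.
Proof.
move=> DE D0 ti rj; rewrite -(leq_pmul2l D0).
have m : (t * r * s <= D * minn (r * i) (t * j))%N.
  rewrite /minn; case: ifP => _.
    by rewrite mulnAC [(D * _)%N]mulnCA [leqLHS]mulnC leq_mul2l ti orbT.
  by rewrite -mulnA [(D * _)%N]mulnCA leq_mul2l rj orbT.
have -> : (D * s = a * (t * s) + b * (r * s) + n * (t * r * s))%N by rewrite DE; ring.
have -> : (D * (a * i + b * j + n * minn (r * i) (t * j)) =
  a * (D * i) + b * (D * j) + n * (D * minn (r * i) (t * j)))%N by ring.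
by rewrite !leq_add // leq_mul2l ?ti ?rj ?m orbT.
Qed.

Section LowerData.
Variables (p : nat) (al be t r n : nat) (F : {poly int}).
Hypotheses (p_pr : prime p) (t0 : (0 < t)%N) (r0 : (0 < r)%N).
Local Notation q k := ((p ^ k)%N%:Z).
Let De := (t * al + r * be + t * r * n)%N.
Local Notation f := (qhom al be t r n F).

(** Divisibility of the coordinates bounds the valuation from below by the
    value of the Newton polygon. *)
Lemma qhom_dvd i j (x y : int) : (q i %| x)%Z -> (q j %| y)%Z ->
  (q (al * i + be * j + n * minn (r * i) (t * j)) %| f x y)%Z.
Proof.
move=> /dvdzP[x' ->] /dvdzP[y' ->]; rewrite /qhom.
set m := minn _ _.
have qE k a (z : int) : (z * q a) ^+ k = q (k * a) * z ^+ k.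
  by rewrite exprMn pexpzX mulrC [(a * k)%N]mulnC.
have [A rA] : exists A, (r * i = m + A)%N by exists (r * i - m)%N; rewrite subnKC ?geq_minl.
have [B tB] : exists B, (t * j = m + B)%N by exists (t * j - m)%N; rewrite subnKC ?geq_minr.
rewrite !qE rA tB ![q (m + _)]pexpzD -!mulrA homog_scale pexpzX !pexpzD [(m * n)%N]mulnC.
set H := homog _ _ _ _.
have -> (a b c d g : int) : a * (b * (c * (d * (g * H)))) = a * c * g * (b * d * H) by move=> *; ring.
exact: dvdz_mulr.
Qed.

(** The edge of exponent al: for [nu = 1] the form al i + (be + t n) j, which
    gives the valuation between this edge and the ray, is at least al (i + j),
    and the points with i + j = N are all good. *)
Lemma nsols_ge_alpha N s nu : (N <= s)%N -> (s <= al * N)%N -> (nu <= 1)%N ->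
  (nu = 0 \/ al <= be + t * n)%N ->
  (p ^ (2 * s - N) * N ^ nu <= 2 * (t + r) * nsols p s f)%N.
Proof.
move=> Ns sN nu1 hyp; rewrite -nsols_swap.
apply: (lower_sets_nu p_pr (g := fun=> 0) (B := (r * N)%N)) => //.
- by rewrite addn_gt0 t0.
- by rewrite leq_pmull.
move=> i x y iN le nui x0 _ dx; rewrite subr0 => dy.
apply: dvdz_trans (qhom_dvd dy (_ : (q i %| x%:Z)%Z)); last by rewrite dvdzE.
rewrite dvdzE !absz_nat dvdn_exp2l //.
exact: (lower_arith_edge (nu := nu)).
Qed.

(** Symmetric to [nsols_ge_alpha]. *)
Lemma nsols_ge_beta N s nu : (N <= s)%N -> (s <= be * N)%N -> (nu <= 1)%N ->
  (nu = 0 \/ be <= al + r * n)%N ->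
  (p ^ (2 * s - N) * N ^ nu <= 2 * (t + r) * nsols p s f)%N.
Proof.
move=> Ns sN nu1 hyp.
apply: (lower_sets_nu p_pr (g := fun=> 0) (B := (t * N)%N)) => //.
- by rewrite addn_gt0 t0.
- by rewrite leq_pmull.
move=> i x y iN le nui x0 _ dx; rewrite subr0 => dy.
apply: dvdz_trans (qhom_dvd (_ : (q i %| x%:Z)%Z) dy); last by rewrite dvdzE.
rewrite dvdzE !absz_nat dvdn_exp2l // minnC [(al * i + _)%N]addnC.
by apply: (lower_arith_edge (nu := nu)) => //; rewrite addnC.
Qed.

(** The points near the branch y = z x^r. With v(x) = i and y = z x^r modulo
    p^(r i + k), the valuation is at least De i + e k; taking (1 + r) i + k = N
    makes it at least e N when De >= e (1 + r), that is d >= e, or when i = 0. *)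
Lemma nsols_ge_root e z N s nu : t = 1%N -> (N <= s)%N -> (s <= e * N)%N -> (nu <= 1)%N ->
  (nu = 0 \/ e * (1 + r) <= De)%N -> (size F <= n.+1)%N ->
  (forall k (w : int), (k <= s)%N -> (q k %| (w - z)%R)%Z -> (q (e * k) %| F.[w])%Z) ->
  (p ^ (2 * s - N) * N ^ nu <= 2 * (t + r) * nsols p s f)%N.
Proof.
move=> t1 Ns sN nu1 hyp sF Fz; subst t.
apply: (lower_sets_nu p_pr (g := fun x : nat => z * x%:Z ^+ r) (B := N)) => //.
move=> i x y iN le nui x0 xi dx dy.
set k := (N - (1 + r) * i)%N.
have kE : (N - i = r * i + k)%N.
  by rewrite /k mulnDl mul1n subnDA subnKC // leq_subRL //
       -[X in (X + _)%N]mul1n -mulnDl.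
have ks : (k <= s)%N by rewrite (leq_trans (leq_subr _ _)).
(* x = p^i X and y = p^(r i) Y *)
have [X xE] : exists X : nat, x = (p ^ i * X)%N by case/dvdnP: dx => X ->; exists X; rewrite mulnC.
have pX : ~~ (p %| X%:Z)%Z.
  rewrite dvdzE /= -(dvdn_pmul2l (_ : 0 < p ^ i)%N) ?expn_gt0 ?prime_gt0 // -xE.
  by rewrite mulnC -expnS pfactor_dvdn // xi ltnn.
have xrE : x%:Z ^+ r = q (r * i) * X%:Z ^+ r by rewrite xE PoszM exprMn pexpzX [(i * r)%N]mulnC.
move: dy; rewrite kE xrE mulrCA => dy.
have [Y yE] : exists Y : int, y%:Z = q (r * i) * Y.
  have : (q (r * i) %| y%:Z)%Z.
    rewrite -(subrK (q (r * i) * (z * X%:Z ^+ r)) y%:Z) rpredD ?dvdz_mulr //.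
    by apply: dvdz_expl dy; rewrite leq_addr.
  by case/dvdzP => Y ->; exists Y; rewrite mulrC.
move: dy; rewrite yE -mulrBr pexpzD dvdz_mul2l ?pexpz_neq0 // => dY.
(* the inverse of X modulo a large power of p *)
pose S := (e * k + k)%N.
pose X' := (X ^ (totient (p ^ S)).-1)%N.
have XX' : (q S %| (X%:Z ^+ r * X'%:Z ^+ r - 1)%R)%Z.
  rewrite -exprMn -(expr1n _ r) subrXX dvdz_mulr //.
  rewrite -eqz_mod_dvd -PoszM /X' -expnS prednK ?totient_gt0 ?expn_gt0 ?prime_gt0 //.
  rewrite !modz_nat eqz_nat; apply/eqP/cyclic.Euler_exp_totient.
  by rewrite coprime_sym coprimeXl // prime_coprime.
have dF : (q (e * k) %| F.[Y * X'%:Z ^+ r])%Z.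
  apply: Fz => //.
  have -> : Y * X'%:Z ^+ r - z = (Y - z * X%:Z ^+ r) * X'%:Z ^+ r + z * (X%:Z ^+ r * X'%:Z ^+ r - 1).
    by ring.
  apply: rpredD; first exact: dvdz_mulr.
  by apply: dvdz_mull; apply: dvdz_expl XX'; rewrite leq_addl.
have dH : (q (e * k) %| homog n F (X%:Z ^+ r) Y)%Z.
  have d1 : (q (e * k) %| homog n F (X%:Z ^+ r) (X%:Z ^+ r * (Y * X'%:Z ^+ r)))%Z.
    by rewrite homog_mul // dvdz_mull.
  rewrite -[homog _ _ _ _](subrK (homog n F (X%:Z ^+ r) (X%:Z ^+ r * (Y * X'%:Z ^+ r)))) rpredD //.
  apply: dvdz_homog; first by rewrite subrr dvdz0.
  have -> : Y - X%:Z ^+ r * (Y * X'%:Z ^+ r) = - (Y * (X%:Z ^+ r * X'%:Z ^+ r - 1)) by ring.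
  by rewrite rpredN; apply: dvdz_mull; apply: dvdz_expl XX'; rewrite leq_addr.
have -> : qhom al be 1%N r n F x%:Z (q (r * i) * Y) =
    q (De * i) * (X%:Z ^+ al * Y ^+ be * homog n F (X%:Z ^+ r) Y).
  rewrite /qhom xrE expr1 homog_scale xE PoszM !exprMn !pexpzX /De.
  have -> : ((1 * al + r * be + 1 * r * n) * i = i * al + r * i * be + r * i * n)%N by ring.
  by rewrite !pexpzD; ring.
rewrite dvdz_pexp_mul //; apply: dvdz_mull; apply: dvdz_expl dH.
by rewrite leq_subLR; apply: lower_arith_root le nui sN hyp.
Qed.

(** For x and y divisible by p^(k1 s) and p^(k2 s), with k1 = t / De and
    k2 = r / De the weights of the form, every monomial is divisible by p^s;
    [i] and [j] are these two exponents rounded up. *)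
Lemma nsols_ge_vertex i j s : (0 < De)%N -> (i <= s)%N -> (j <= s)%N ->
  (t * s <= De * i)%N -> (r * s <= De * j)%N ->
  (p ^ (2 * s - (i + j)) <= nsols p s f)%N.
Proof.
move=> De0 is_ js ti rj.
have -> : (p ^ (2 * s - (i + j)) = p ^ (s - i) * p ^ (s - j))%N.
  by rewrite -expnD; case: (sub2_split is_ js) => _ ->.
rewrite -!sum_dvd_pow // big_distrl /=; apply: leq_sum => x _.
rewrite big_distrr /=; apply: leq_sum => y _.
case: (boolP (p ^ i %| x)%N) => // dx; case: (boolP (p ^ j %| y)%N) => //= dy.
suff -> : (q s %| f x%:Z y%:Z)%Z by [].
apply: dvdz_trans (qhom_dvd (_ : (q i %| x%:Z)%Z) (_ : (q j %| y%:Z)%Z)); rewrite ?dvdzE //.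
rewrite !absz_nat dvdn_exp2l //.
exact: (lower_arith_vertex (t := t) (r := r) (D := De)).
Qed.

End LowerData.

(** * Densities *)

Lemma horner2_morph (A B : comNzRingType) (g : {rmorphism A -> B}) (f : {poly {poly A}}) x y :
  (map_bipoly g f).[g x, g y] = g f.[x, y].
Proof. by rewrite /map_bipoly -map_polyC horner_map horner_map. Qed.

Section Density.
Variable R : realType.

(** Solutions modulo p^s are counted on integer representatives. *)
Lemma nsol_nsols (f : {poly {poly int}}) p s : prime p -> (0 < s)%N ->
  nsol R f p s = (nsols p s (fun x y => f.[x, y]))%:R / (p ^ (2 * s))%:R.
Proof.
move=> p_pr s0; rewrite /nsol; congr (_%:R / _).
have q1 : (1 < p ^ s)%N by rewrite -(exp1n s) ltn_exp2r // prime_gt1.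
have e0 (x : int) : (x%:~R == 0 :> 'Z_(p ^ s)) = ((p ^ s)%N %| x)%Z.
  have e1 k : (k%:R == 0 :> 'Z_(p ^ s)) = (p ^ s %| k)%N by rewrite -val_eqE /= val_Zp_nat.
  rewrite dvdzE absz_nat; case: x => k; first by rewrite -pmulrn e1.
  by rewrite NegzE mulrNz oppr_eq0 -pmulrn abszN e1.
pose T x y : nat := ((p ^ s)%N %| f.[x%:Z, y%:Z])%Z.
have TP x y : T (x + p ^ s)%N y = T x y /\ T x (y + p ^ s)%N = T x y.
  rewrite /T -!e0 -!(horner2_morph (intr : {rmorphism int -> 'Z_(p ^ s)})).
  by rewrite /= -!pmulrn !natrD (pchar_Zp q1) !addr0.
rewrite cardsE -sum1_card big_mkcond /=.
transitivity (\sum_(0 <= x < p ^ s) \sum_(0 <= y < p ^ s) T x y)%N; last first.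
  have sh (P : nat -> nat) : P (p ^ s)%N = P 0%N ->
      (\sum_(0 <= x < p ^ s) P x = \sum_(1 <= x < (p ^ s).+1) P x)%N.
    move=> PE; rewrite [LHS]big_ltn ?(ltnW q1) // [RHS]big_nat_recr ?(ltnW q1) //= PE.
    exact: addnC.
  rewrite sh; last by apply: eq_bigr => y _; rewrite -[X in T X y]add0n; case: (TP 0%N y).
  by apply: eq_bigr => x _; rewrite sh //; rewrite -[X in T x X]add0n; case: (TP x 0%N).
under [RHS]eq_bigr do rewrite big_mkord.
rewrite big_mkord -(Zp_cast q1) pair_bigA; apply: eq_bigr => -[x y] _ /=.
rewrite /T -e0 -(horner2_morph (intr : {rmorphism int -> 'Z_(p ^ s)})) /= -!pmulrn !natr_Zp.
set b := (_ \in _); have -> : b = ((map_bipoly intr f).[x, y] == 0) by [].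
by case: (_ == _).
Qed.

End Density.

(** * From counts to densities, lower bounds *)

(** The formula (s - 1) / m + 1 is the ceiling of s / m. *)
Lemma ceil_spec m s : (0 < m -> 0 < s ->
  let N := (s.-1 %/ m).+1 in [/\ N <= s, s <= m * N & m * N <= s + m])%N.
Proof.
move=> m0 s0 N; rewrite /N; split.
- by rewrite -(prednK s0) ltnS leq_div.
- by rewrite -{1}(prednK s0) mulnC ltn_ceil.
- by rewrite mulnS addnC leq_add2r mulnC (leq_trans (leq_divM _ _)) // leq_pred.
Qed.

Section LowerReal.
Variable R : realType.

Definition lower_const (D : nat) : R := (4 * D * D)%:R^-1.

Lemma lower_const_gt0 D : (0 < D)%N -> 0 < lower_const D.
Proof. by move=> D0; rewrite invr_gt0 ltr0n !muln_gt0 D0. Qed.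

(** An integral height m: N is s / m rounded up, which loses a factor p at
    most, and nothing when m divides s. *)
Lemma lower_integral (m nu A D p : nat) (S : nat -> nat) :
  (1 < p)%N -> (0 < m <= D)%N -> (0 < A <= 4 * D)%N -> (nu <= 1)%N ->
  (forall N s, (N <= s)%N -> (s <= m * N)%N -> (p ^ (2 * s - N) * N ^ nu <= A * S s)%N) ->
  (forall s, (0 < s)%N ->
     lower_const D * s%:R ^+ nu * p%:R `^ (- (s%:R / m%:R)) * p%:R ^- 2 <=
     (S s)%:R / (p ^ (2 * s))%:R) /\
  (forall s0, exists2 s, (s0 < s)%N &
     lower_const D * s%:R ^+ nu * p%:R `^ (- (s%:R / m%:R)) <=
     (S s)%:R / (p ^ (2 * s))%:R).
Proof.
move=> p1 /andP[m0 mD] /andP[A0 AD] nu1 H.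
have p1R : 1 < p%:R :> R by rewrite ltr1n.
have mR : 0 < m%:R :> R by rewrite ltr0n.
have DR : 0 < D%:R :> R by rewrite ltr0n (leq_trans m0).
have AR : 0 < A%:R :> R by rewrite ltr0n.
have main N s : (N <= s)%N -> (s <= m * N)%N ->
    lower_const D * s%:R ^+ nu * p%:R `^ (- N%:R) <= (S s)%:R / (p ^ (2 * s))%:R.
  move=> Ns sN; have Ns2 : (N <= 2 * s)%N by rewrite (leq_trans Ns) // leq_pmull.
  have q0 : 0 < (p ^ (2 * s))%:R :> R by rewrite ltr0n expn_gt0 ltnW.
  have := H N s Ns sN; rewrite -(ler_nat R) -(ler_pM2r (_ : 0 < (p ^ (2 * s))%:R^-1)) ?invr_gt0 //.
  rewrite !natrM mulrAC powR_pdiv ?(ltnW p1) // -mulrA => h.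
  rewrite -(ler_pM2l AR); apply: le_trans h; rewrite mulrA [leRHS]mulrC.
  rewrite ler_wpM2r ?powR_ge0 //.
  have sN' : s%:R ^+ nu <= D%:R * (N ^ nu)%:R :> R.
    case: nu nu1 {H} => [|[]] // _.
      by rewrite expr0 expn0 mulr1 ler1n (leq_trans m0).
    by rewrite expr1 expn1 -natrM ler_nat (leq_trans sN) // leq_mul2r mD orbT.
  apply: (@le_trans _ _ (A%:R * lower_const D * (D%:R * (N ^ nu)%:R))).
    by rewrite [leLHS]mulrA ler_wpM2l // mulr_ge0 // ?ltW // lower_const_gt0 // (leq_trans m0).
  rewrite mulrA ler_piMl // /lower_const !natrM.
  rewrite -mulrA invfM -mulrA mulVf ?gt_eqF // mulr1 ler_pdivrMr ?mul1r; last by rewrite mulr_gt0.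
  by rewrite -natrM ler_nat.
split=> [s s0|s0].
- have [Ns sN mN] := ceil_spec m0 s0; set N := _.+1 in Ns sN mN.
  apply: le_trans (main N s Ns sN); rewrite -mulrA ler_wpM2l //.
    by rewrite mulr_ge0 ?exprn_ge0 // ltW // lower_const_gt0 // (leq_trans m0).
  have p0 : p%:R != 0 :> R by rewrite gt_eqF // (lt_trans ltr01).
  rewrite -powR_invn // -powRD ?p0 ?implybT // ler_powR ?(ltW p1R) //.
  suff : N%:R <= s%:R / m%:R + 1 :> R by lra.
  rewrite -(ler_pM2l mR) mulrDr mulr1 mulrCA divff ?gt_eqF // mulr1.
  by rewrite -natrM -natrD ler_nat.
- exists (m * s0.+1)%N; first by rewrite leq_pmull.
  have := main s0.+1 (m * s0.+1)%N; rewrite leq_pmull // => /(_ isT (leqnn _)).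
  by rewrite natrM [_ * _ / m%:R]mulrAC mulfV ?gt_eqF // mul1r -!natrM.
Qed.

(** Here two exponents are rounded up, which loses the factor p^2 that appears
    in the general lower bound; nothing is lost when De divides s. *)
Lemma lower_vertex (t r De D p : nat) (S : nat -> nat) :
  (1 < p)%N -> (0 < t)%N -> (0 < r)%N -> (t <= De)%N -> (r <= De)%N -> (0 < D)%N ->
  (forall i j s, (i <= s)%N -> (j <= s)%N -> (t * s <= De * i)%N -> (r * s <= De * j)%N ->
     (p ^ (2 * s - (i + j)) <= S s)%N) ->
  let d : R := De%:R / (t + r)%:R in
  (forall s, (0 < s)%N ->
     lower_const D * p%:R `^ (- (s%:R / d)) * p%:R ^- 2 <=
     (S s)%:R / (p ^ (2 * s))%:R) /\
  (forall s0, exists2 s, (s0 < s)%N &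
     lower_const D * p%:R `^ (- (s%:R / d)) <=
     (S s)%:R / (p ^ (2 * s))%:R).
Proof.
move=> p1 t0 r0 tDe rDe D0 H d.
have p1R : 1 < p%:R :> R by rewrite ltr1n.
have De0 : (0 < De)%N by rewrite (leq_trans t0).
have DeR : 0 < De%:R :> R by rewrite ltr0n.
have c1 : lower_const D <= 1 by rewrite /lower_const invf_le1 ?ltr0n ?ler1n ?muln_gt0 ?D0.
have main i j s : (i <= s)%N -> (j <= s)%N -> (t * s <= De * i)%N -> (r * s <= De * j)%N ->
    lower_const D * p%:R `^ (- (i + j)%:R) <= (S s)%:R / (p ^ (2 * s))%:R.
  move=> is_ js ti rj; apply: (@le_trans _ _ (p%:R `^ (- (i + j)%:R))).
    by rewrite ler_piMl // powR_ge0.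
  rewrite -(powR_pdiv R (k := (2 * s)%N)) ?(ltnW p1) //; last by case: (sub2_split is_ js) => ->.
  by rewrite ler_wpM2r ?invr_ge0 // ler_nat H.
have sd (s : nat) : s%:R / d = (t * s)%:R / De%:R + (r * s)%:R / De%:R.
  by rewrite /d invf_div -mulrDl -natrD -mulnDl natrM [_ * s%:R]mulrC mulrA.
split=> [s s0|s0].
- have upP a : (0 < a <= De)%N -> let i := ((a * s).-1 %/ De).+1 in
      [/\ (i <= s)%N, (a * s <= De * i)%N & (De * i <= a * s + De)%N].
    case/andP=> a0 aDe i; have as0 : (0 < a * s)%N by rewrite muln_gt0 a0.
    have [_ h1 h2] := ceil_spec De0 as0; split => //.
    by rewrite /i ltn_divLR // prednK // mulnC leq_mul2l aDe orbT.
  have [i1 i2 i3] := upP t (introT andP (conj t0 tDe)).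
  have [j1 j2 j3] := upP r (introT andP (conj r0 rDe)).
  apply: le_trans (main _ _ _ i1 j1 i2 j2); rewrite -mulrA ler_wpM2l //.
    by rewrite ltW // lower_const_gt0.
  have p0 : p%:R != 0 :> R by rewrite gt_eqF // (lt_trans ltr01).
  rewrite -powR_invn // -powRD ?p0 ?implybT // ler_powR ?(ltW p1R) //.
  set ij := (_ + _)%N; suff : ij%:R <= s%:R / d + 2 :> R by lra.
  rewrite {}/ij sd -(ler_pM2l DeR) !mulrDr ![De%:R * (_ / De%:R)]mulrCA divff ?gt_eqF // !mulr1.
  by rewrite -!natrM -!natrD ler_nat; lia.
- exists (De * s0.+1)%N; first by rewrite leq_pmull.
  have := main (t * s0.+1)%N (r * s0.+1)%N (De * s0.+1)%N.
  rewrite !leq_mul2r tDe rDe !orbT mulnCA [(r * (De * _))%N]mulnCA => /(_ isT isT (leqnn _) (leqnn _)).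
  congr (_ * _ `^ (- _) <= _); rewrite sd ![(_ * (De * _))%N]mulnCA !(natrM _ De) ![De%:R * _ / _]mulrAC.
  by rewrite mulfV ?gt_eqF // !mul1r natrD.
Qed.

End LowerReal.

(** * Quasi-homogeneous bivariate polynomials *)

Section Qpoly.
Variable A : comNzRingType.
Implicit Types (F : {poly A}).

Definition qhpoly (al be t r n : nat) F : {poly {poly A}} :=
  \sum_(k < n.+1) (F`_k)%:P%:P * 'X ^+ (al + r * (n - k)) * 'Y ^+ (be + t * k).

Lemma polyYXn k : 'Y ^+ k = ('X ^+ k)%:P :> {poly {poly A}}.
Proof. by rewrite rmorphXn. Qed.

Lemma coef_monomial2 (c : A) i0 j0 i j :
  (c%:P%:P * 'X ^+ i0 * 'Y ^+ j0 : {poly {poly A}})`_i`_j = c *+ ((i == i0) && (j == j0)).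
Proof.
rewrite polyYXn coefMC coefCM coefXn mulr_natr.
case: (i == i0); rewrite ?mulr0n ?mul0r ?coef0 ?mulr1n //=.
by rewrite coefCM coefXn mulr_natr.
Qed.

Lemma coef_qhpoly al be t r n F i j : (qhpoly al be t r n F)`_i`_j =
  \sum_(k < n.+1) F`_k *+ ((i == al + r * (n - k))%N && (j == be + t * k)%N).
Proof.
by rewrite /qhpoly !coef_sum; apply: eq_bigr => k _; rewrite coef_monomial2.
Qed.

Lemma coef_qhpoly_corner al be t r n F k : (0 < t)%N -> (k <= n)%N ->
  (qhpoly al be t r n F)`_(al + r * (n - k))`_(be + t * k) = F`_k.
Proof.
move=> t0 kn; rewrite coef_qhpoly (bigD1 (inord k)) //= inordK ?ltnS // !eqxx mulr1n.
rewrite big1 ?addr0 // => i ik; rewrite [X in _ && X]eqn_add2l eqn_pmul2l //.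
case: (k =P nat_of_ord i) => [ki|]; last by rewrite andbF mulr0n.
by case/eqP: ik; apply: val_inj; rewrite /= inordK ?ltnS.
Qed.

Lemma coef_qhpoly_x al be t r n F : (0 < t)%N ->
  (qhpoly al be t r n F)`_(al + r * n)`_be = F`_0.
Proof.
move=> t0; have := coef_qhpoly_corner al be r F t0 (leq0n n).
by rewrite subn0 muln0 addn0.
Qed.

Lemma coef_qhpoly_y al be t r n F : (0 < t)%N ->
  (qhpoly al be t r n F)`_al`_(be + t * n) = F`_n.
Proof.
move=> t0; have := coef_qhpoly_corner al be r F t0 (leqnn n).
by rewrite subnn muln0 addn0.
Qed.

Lemma qhpoly_homog al be t r n F : qhpoly al be t r n F =
  'X ^+ al * 'Y ^+ be * homog n (map_poly (polyC \o polyC) F) ('X ^+ r) ('Y ^+ t).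
Proof.
rewrite /qhpoly /homog mulr_sumr; apply: eq_bigr => k _.
by rewrite coef_map /= !exprD -!exprM; ring.
Qed.

Lemma horner_qhpoly al be t r n F x y : (qhpoly al be t r n F).[x, y] =
  x ^+ al * y ^+ be * homog n F (x ^+ r) (y ^+ t).
Proof.
rewrite /qhpoly /homog mulr_sumr !horner_sum; apply: eq_bigr => k _.
rewrite polyYXn !hornerM !hornerC !hornerXn -rmorphXn /= hornerC !exprD -!exprM; ring.
Qed.

End Qpoly.

Lemma map_bipoly_qhpoly (A B : comNzRingType) (g : {rmorphism A -> B}) al be t r n F :
  map_bipoly g (qhpoly al be t r n F) = qhpoly al be t r n (map_poly g F).
Proof.
rewrite /map_bipoly /qhpoly rmorph_sum; apply: eq_bigr => k _.
by rewrite !rmorphM !rmorphXn /= !map_polyC /= map_polyX map_polyC coef_map /= map_polyX.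
Qed.

Lemma map_bipoly_inj (A B : nzRingType) (g : {rmorphism A -> B}) :
  injective g -> injective (map_bipoly g).
Proof.
move=> gi; apply: map_inj_poly; last exact: rmorph0.
by apply: map_inj_poly => //; apply: rmorph0.
Qed.

Lemma homogMXsubCX (A : comNzRingType) k n (F : {poly A}) c X Y : (size F <= n.+1)%N ->
  (size (('X - c%:P) ^+ k * F)%R <= (k + n).+1)%N /\
  homog (k + n) (('X - c%:P) ^+ k * F) X Y = (Y - c * X) ^+ k * homog n F X Y.
Proof.
move=> sF; elim: k => [|k [IH1 IH2]]; first by rewrite add0n !mul1r.
split.
  rewrite exprS -mulrA; apply: leq_trans (size_polyMleq _ _) _.
  by rewrite size_XsubC.
by rewrite addSn exprS -mulrA homogMXsubC // IH2 exprS mulrA.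
Qed.

(** Homogenizing takes the factorization of F to that of the form: this is the
    link between normal forms and univariate polynomials. *)
Lemma homog_prod (A : comNzRingType) (a : A) (zs : seq (A * nat)) X Y :
  homog (\sum_(z <- zs) z.2) (a *: \prod_(z <- zs) ('X - z.1%:P) ^+ z.2) X Y =
  a * \prod_(z <- zs) (Y - z.1 * X) ^+ z.2.
Proof.
rewrite homogZ; congr (_ * _).
suff [] : (size (\prod_(z <- zs) ('X - z.1%:P) ^+ z.2)%R <= (\sum_(z <- zs) z.2).+1)%N /\
  homog (\sum_(z <- zs) z.2) (\prod_(z <- zs) ('X - z.1%:P) ^+ z.2) X Y =
  \prod_(z <- zs) (Y - z.1 * X) ^+ z.2 by [].
elim: zs => [|z zs [IH1 IH2]].
  by rewrite !big_nil size_poly1; split => //; rewrite /homog big_ord1 coef1 !mul1r.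
rewrite !big_cons; have [h1 ->] := homogMXsubCX z.2 z.1 X Y IH1; split => //.
by rewrite IH2.
Qed.

Section HomogMul.
Variable A : comNzRingType.
Implicit Types (F G : {poly A}) (X Y : A).

Lemma homogS n F X Y : (size F <= n.+1)%N -> homog n.+1 F X Y = X * homog n F X Y.
Proof.
move=> sF; rewrite /homog big_ord_recr /= (nth_default _ sF) !mul0r addr0 mulr_sumr.
by apply: eq_bigr => k _; rewrite subSn -1?ltnS // exprS; ring.
Qed.

Lemma homogXnM i n m G X Y : (i <= n)%N -> (size G <= m.+1)%N ->
  homog (n + m) ('X^i * G) X Y = X ^+ (n - i) * Y ^+ i * homog m G X Y.
Proof.
move=> le_in sG; have [h1 h2] := homogMXsubCX i 0 X Y sG.
rewrite subr0 mul0r subr0 in h1 h2.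
have : homog (n - i + (i + m)) ('X^i * G) X Y = X ^+ (n - i) * homog (i + m) ('X^i * G) X Y.
  elim: (n - i)%N => [|k IH]; first by rewrite add0n mul1r.
  by rewrite addSn homogS ?IH ?exprS ?mulrA // (leq_trans h1) // ltnS leq_addl.
by rewrite addnA subnK // h2 mulrA.
Qed.

Lemma homog_sum n I (r : seq I) (H : I -> {poly A}) X Y :
  homog n (\sum_(i <- r) H i) X Y = \sum_(i <- r) homog n (H i) X Y.
Proof.
rewrite /homog exchange_big /=; apply: eq_bigr => k _.
by rewrite coef_sum !mulr_suml.
Qed.

Lemma homogM n m F G X Y : (size F <= n.+1)%N -> (size G <= m.+1)%N ->
  homog (n + m) (F * G) X Y = homog n F X Y * homog m G X Y.
Proof.
move=> sF sG; have FE : F = \sum_(i < n.+1) F`_i *: 'X^i.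
  by apply/polyP => i; rewrite -poly_def coef_poly; case: ltnP => // /(leq_trans sF)/(nth_default 0).
rewrite {1}FE mulr_suml homog_sum [in RHS]/homog mulr_suml; apply: eq_bigr => i _.
by rewrite -scalerAl homogZ homogXnM -1?ltnS // !mulrA.
Qed.

Lemma homogX n F X Y e : (size F <= n.+1)%N ->
  homog (n * e) (F ^+ e) X Y = homog n F X Y ^+ e.
Proof.
move=> sF; suff [] : (size (F ^+ e) <= (n * e).+1)%N /\
  homog (n * e) (F ^+ e) X Y = homog n F X Y ^+ e by [].
elim: e => [|e [IH1 IH2]].
  by rewrite muln0 !expr0 size_poly1; split => //; rewrite /homog big_ord1 coef1 !mul1r.
rewrite mulnS !exprS homogM // IH2; split => //.
apply: leq_trans (size_polyMleq _ _) _; rewrite -subn1 leq_subLR add1n -addnS -addSn.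
exact: leq_add.
Qed.

End HomogMul.

(** The coefficients of P are coefficients of f, hence lie in the base ring. *)
Lemma qhpoly_descent (A B : comNzRingType) (g : {rmorphism A -> B}) al be t r n
    (f : {poly {poly A}}) (P : {poly B}) :
  injective g -> (0 < t)%N -> size P = n.+1 ->
  map_bipoly g f = qhpoly al be t r n P ->
  exists F, [/\ f = qhpoly al be t r n F, map_poly g F = P & size F = n.+1].
Proof.
move=> gi t0 sP fE; exists (\poly_(k < n.+1) f`_(al + r * (n - k))`_(be + t * k)).
set F := \poly_(k < _) _.
have FE : map_poly g F = P.
  apply/polyP => k; rewrite coef_map coef_poly /=; case: ltnP => kn; last first.
    by rewrite rmorph0 nth_default // sP.
  by rewrite -(coef_qhpoly_corner al be r P t0 (ltnSE kn)) -fE !coef_map.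
split => //; last by rewrite -(size_map_inj_poly gi) ?rmorph0 // FE.
by apply: (map_bipoly_inj gi); rewrite map_bipoly_qhpoly FE.
Qed.

(** * The estimates for a polynomial in normal form *)

(** The integral version of the normal form: the product over the nonzero
    roots is replaced by the univariate polynomial F having them as roots. It
    is symmetric in x and y, and it includes the monomials, with n = 0 and
    t = r = 1. *)
Record int_form (D : nat) (f : {poly {poly int}}) (al be t r n : nat)
    (F : {poly int}) : Prop := IntForm {
  if_t : (0 < t <= D)%N;
  if_r : (0 < r <= D)%N;
  if_coprime : coprime t r;
  if_size : size F = n.+1;
  if_F0 : F`_0 != 0;
  if_tDe : (t <= t * al + r * be + t * r * n)%N;
  if_rDe : (r <= t * al + r * be + t * r * n)%N;
  if_x : (al + r * n <= D)%N;
  if_y : (be + t * n <= D)%N;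
  if_E : f = qhpoly al be t r n F }.

(** The roots of F in Z_p have order at most e, said with congruences only: G
    is separable modulo p, and G(w) has at least 1/e times the valuation of
    F(w). For e = 0 it says that F has no root modulo p. *)
Definition order_le (p e D : nat) (F : {poly int}) : Prop :=
  exists G : {poly int}, [/\ ((size G).-1 <= D)%N,
    forall w : int, (p %| G.[w])%Z -> ~~ (p %| (G^`()).[w])%Z &
    forall (k : nat) (w : int), ((p ^ k)%N %| F.[w])%Z ->
     exists a, [/\ (a <= k)%N, (k <= e * a)%N & ((p ^ a)%N %| G.[w])%Z]].

(** F has a root of order at least e in Z_p; z is an approximation of it. *)
Definition order_ge (p e : nat) (F : {poly int}) : Prop :=
  forall s, exists z : int, forall (k : nat) (w : int), (k <= s)%N ->
    ((p ^ k)%N %| (w - z)%R)%Z -> ((p ^ (e * k))%N %| F.[w])%Z.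

Section Estimates.
Variable R : realType.

(** Two distinct candidates for the height are multiples of 1/(t+r) and at most
    D, with t + r <= 2 D: this is their least relative distance. *)
Definition gap (D : nat) : R := (2 * D * D)%:R^-1.

(** All the exponents are compared after multiplication by t + r, which makes
    them integers: [H] stands for the height, [De] for d. The polynomial g in
    normal form is f or f with its variables interchanged. The last hypothesis
    tells which set of points attains the bound. *)
Theorem estimates_int_form (D : nat) f g al be t r n F (p e nu H : nat) :
  let De := (t * al + r * be + t * r * n)%N in
  prime p -> int_form D g al be t r n F ->
  (forall s, nsols p s (fun x y => f.[x, y]) = nsols p s (fun x y => g.[x, y])) ->
  ~~ (p %| t)%N ->
  ~~ (p %| F`_0)%Z -> ~~ (p %| F`_n)%Z -> order_le p e D F ->
  height R f = H%:R / (t + r)%:R -> (nu <= 1)%N ->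
  (al * (t + r) <= H)%N -> (be * (t + r) <= H)%N -> (De <= H)%N -> (e * (t + r) <= H)%N ->
  (H <= (t + r) * D)%N ->
  (nu = 0%N -> (De < H)%N \/
     [/\ (al * (t + r) < H)%N, (be * (t + r) < H)%N & (e * (t + r) < H)%N]) ->
  [\/ nu = 0%N /\ H = De,
      H = (al * (t + r))%N /\ (nu = 0%N \/ al <= be + t * n)%N,
      H = (be * (t + r))%N /\ (nu = 0%N \/ be <= al + r * n)%N |
      exists e', [/\ t = 1%N, H = (e' * (t + r))%N, order_ge p e' F &
        (nu = 0%N \/ e' * (1 + r) <= De)%N]] ->
  estimates (upper_const D (gap D)) (lower_const R D) (lower_const R D) f p nu.
Proof.
move=> De p_pr [/andP[t0 tD] /andP[r0 rD] cop sF F0 tDe rDe xD yD gE] fg pt pF0 pFn.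
move=> [G [sG simpleG rootFG]] hE nu1 alH beH DeH eH HD gapH low.
have D0 : (0 < D)%N by apply: leq_trans tD.
have tr0 : (0 < t + r)%N by rewrite addn_gt0 t0.
have trR : 0 < (t + r)%:R :> R by rewrite ltr0n.
have DR : 0 < D%:R :> R by rewrite ltr0n.
have De0 : (0 < De)%N by apply: leq_trans tDe.
have H0 : (0 < H)%N by apply: leq_trans DeH.
have HR : 0 < H%:R :> R by rewrite ltr0n.
have h0 : 0 < height R f by rewrite hE divr_gt0.
have sF' : (size F <= n.+1)%N by rewrite sF.
have nsE s : nsols p s (fun x y => f.[x, y]) = nsols p s (qhom al be t r n F).
  by rewrite fg; apply: eq_bigr => x _; apply: eq_bigr => y _; rewrite gE horner_qhpoly.
have ga0 : 0 < gap D by rewrite invr_gt0 ltr0n !muln_gt0 D0.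
have le_h a : (a * (t + r) <= H)%N -> a%:R <= height R f.
  by move=> aH; rewrite hE ler_pdivlMr // -natrM ler_nat.
have le_gap a : (a < H)%N -> gap D <= 1 - a%:R / (t + r)%:R / height R f.
  move=> aH; have -> : 1 - a%:R / (t + r)%:R / height R f = (H%:R - a%:R) / H%:R.
    by rewrite hE; field; rewrite ?gt_eqF //; rewrite -natrD.
  apply: (@le_trans _ _ H%:R^-1).
    rewrite lef_pV2 ?posrE ?ltr0n ?muln_gt0 ?D0 // ler_nat (leq_trans HD) // leq_mul2r.
    by rewrite mul2n -addnn leq_add ?orbT.
  by rewrite ler_peMl ?invr_ge0 ?ler0n // -natrB 1?ltnW // ler1n subn_gt0.
have le_gap' a : (a * (t + r) < H)%N -> gap D <= 1 - a%:R / height R f.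
  by move=> /le_gap; rewrite natrM mulfK // gt_eqF.
have upper s : (0 < s)%N -> nsol R f p s <=
    upper_const D (gap D) * s%:R ^+ nu * p%:R `^ (- (s%:R / height R f)).
  move=> s0; rewrite nsol_nsols // nsE.
  apply: (@nsols_upper R D p s al be t r n e nu F G) => //; rewrite ?t0 ?r0 //.
  - exact: le_h.
  - exact: le_h.
  - exact: le_h.
  - by rewrite hE ler_pM2r ?invr_gt0 // ler_nat.
  - move/gapH => [lt|[lt1 lt2 lt3]]; [by left; apply: le_gap|by right; split; apply: le_gap'].
suff [L1 L2] : (forall s, (0 < s)%N ->
     lower_const R D * s%:R ^+ nu * p%:R `^ (- (s%:R / height R f)) * p%:R ^- 2 <=
     (nsols p s (qhom al be t r n F))%:R / (p ^ (2 * s))%:R) /\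
  (forall s0, exists2 s, (s0 < s)%N &
     lower_const R D * s%:R ^+ nu * p%:R `^ (- (s%:R / height R f)) <=
     (nsols p s (qhom al be t r n F))%:R / (p ^ (2 * s))%:R).
  split=> [s s0|s0].
    by rewrite /two_sided_bound upper // andbT nsol_nsols // nsE; apply: L1.
  have [s lt_s Hs] := L2 s0; exists s => //.
  by rewrite /sharp_lower_bound nsol_nsols ?nsE // (leq_trans _ lt_s).
have p1 := prime_gt1 p_pr.
have A0 : (0 < 2 * (t + r) <= 4 * D)%N.
  by rewrite muln_gt0 tr0 /= -[4%N]/(2 * 2)%N -mulnA leq_mul2l mul2n -addnn leq_add.
pose S s := nsols p s (qhom al be t r n F).
have hm m : H = (m * (t + r))%N -> height R f = m%:R /\ (0 < m <= D)%N.
  move=> Hm; split; first by rewrite hE Hm natrM mulfK // gt_eqF.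
  move: H0 HD; rewrite Hm muln_gt0 => /andP[-> _]; rewrite mulnC leq_pmul2l //.
case: low => [[nu0 HDe]|[Hm hyp]|[Hm hyp]|[e' [t1 Hm ge hyp]]].
- have := @lower_vertex R t r De D p _ p1 t0 r0 tDe rDe D0
    (fun i j s => @nsols_ge_vertex p al be t r n F p_pr i j s De0).
  rewrite hE HDe nu0; case=> L1 L2; split=> [s s0|s0].
    by rewrite expr0 mulr1; apply: L1.
  by have [s lt_s Hs] := L2 s0; exists s; rewrite ?expr0 ?mulr1.
- have [-> mD] := hm _ Hm; apply: (@lower_integral R _ _ _ _ _ S p1 mD A0 nu1) => N s Ns sN.
  exact: nsols_ge_alpha.
- have [-> mD] := hm _ Hm; apply: (@lower_integral R _ _ _ _ _ S p1 mD A0 nu1) => N s Ns sN.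
  exact: nsols_ge_beta.
- have [-> mD] := hm _ Hm; apply: (@lower_integral R _ _ _ _ _ S p1 mD A0 nu1) => N s Ns sN.
  have [z zP] := ge s; apply: (@nsols_ge_root p al be t r n F p_pr t0 e' z) => //.
Qed.

End Estimates.

(** * Orders of the roots modulo large primes *)

Local Notation pZtoQ := (map_poly (intr : int -> rat)).
Local Notation pQtoC := (map_poly (ratr : rat -> algC)).

(** The polynomial with leading coefficient [a] and roots [z.1] of
    multiplicity [z.2]. *)
Definition rootpoly (a : algC) (zs : seq (algC * nat)) : {poly algC} :=
  a *: \prod_(z <- zs) ('X - z.1%:P) ^+ z.2.

Lemma pZtoQ_inj : injective pZtoQ.
Proof. by apply: map_inj_poly => //; apply: intr_inj. Qed.

Lemma pZtoC_pZtoQ (F : {poly int}) : map_poly intr F = pQtoC (pZtoQ F) :> {poly algC}.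
Proof. by rewrite -map_poly_comp; apply: eq_map_poly => x /=; rewrite ratr_int. Qed.

Lemma rat_poly_lift (p : {poly rat}) :
  exists (q : {poly int}) (a : int), a != 0 /\ pZtoQ q = a%:~R *: p.
Proof.
have [q [a a0 ->]] := rat_poly_scale p; exists q, a; split => //.
by rewrite scalerA mulfV ?scale1r // intr_eq0.
Qed.

(** So G stays separable modulo every prime that does not divide k. *)
Lemma bezout_int (G : {poly int}) : coprimep (pZtoQ G) (pZtoQ G)^`() ->
  exists U V (k : int), k != 0 /\ U * G + V * G^`() = k%:P.
Proof.
move=> /Bezout_coprimepP[[u v] /= uv1].
have [c c0 uvE] : exists2 c, c != 0 & u * pZtoQ G + v * (pZtoQ G)^`() = c%:P.
  by move: uv1; rewrite -size_poly_eq1 => /size_poly1P.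
have [U [a [a0 UE]]] := rat_poly_lift u; have [V [b [b0 VE]]] := rat_poly_lift v.
have E : pZtoQ (b *: U * G + a *: V * G^`()) = (a%:~R * b%:~R * c)%:P.
  rewrite rmorphD !rmorphM /= !linearZ /= UE VE -deriv_map !scalerA [b%:~R * _]mulrC.
  by rewrite -!scalerAl -scalerDr uvE -mul_polyC -polyCM.
exists (b *: U), (a *: V), (b *: U * G + a *: V * G^`())`_0.
have k0 : ((b *: U * G + a *: V * G^`())`_0)%:~R = a%:~R * b%:~R * c :> rat.
  by rewrite -coef_map /= E coefC.
split; first by rewrite -(intr_eq0 rat) k0 !mulf_neq0 ?intr_eq0.
by apply: pZtoQ_inj; rewrite E map_polyC /= k0.
Qed.

Lemma prod_XsubC_dvd (zs : seq (algC * nat)) (P : {poly algC}) :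
  uniq (unzip1 zs) -> (forall z, z \in zs -> ('X - z.1%:P) ^+ z.2 %| P) ->
  \prod_(z <- zs) ('X - z.1%:P) ^+ z.2 %| P.
Proof.
elim: zs => [|z zs IH] /=; first by rewrite big_nil dvd1p.
case/andP=> nz uz H; rewrite big_cons Gauss_dvdp.
  rewrite H ?mem_head //; apply: IH => // y yz; apply: H.
  by rewrite inE yz orbT.
apply: coprimep_expl; rewrite coprimep_sym coprimep_XsubC /root horner_prod.
rewrite prodf_seq_neq0; apply/allP => y yz /=.
rewrite horner_exp hornerXsubC expf_neq0 // subr_eq0.
by apply: contraNneq nz => ->; apply: map_f.
Qed.

(** If z were not a root of the squarefree part, its multiplicity in gcd(F, F')
    would be that in F, whereas it drops by one in F'. *)
Lemma root_squarefree (F : {poly rat}) (z : algC) (n : nat) : F != 0 -> (0 < n)%N ->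
  ('X - z%:P) ^+ n %| pQtoC F -> ~~ (('X - z%:P) ^+ n.+1 %| pQtoC F) ->
  root (pQtoC (F %/ gcdp F F^`())) z.
Proof.
move=> F0; case: n => // n _ dn ndn; apply: contraT => nr.
have FE : pQtoC F = pQtoC (F %/ gcdp F F^`()) * pQtoC (gcdp F F^`()).
  by rewrite -rmorphM /= divpK // dvdp_gcdl.
have : ('X - z%:P) ^+ n.+1 %| (pQtoC F)^`().
  apply: (@dvdp_trans _ (pQtoC (gcdp F F^`()))).
    have cop : coprimep (('X - z%:P) ^+ n.+1) (pQtoC (F %/ gcdp F F^`())).
      by rewrite coprimep_expl // coprimep_sym coprimep_XsubC.
    by rewrite -(Gauss_dvdpr _ cop) -FE.
  by rewrite deriv_map dvdp_map dvdp_gcdr.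
case/dvdpP: dn => Q QE; rewrite QE derivM deriv_exp derivXsubC mul1r /=.
rewrite dvdp_addr; last by apply: dvdp_mull; apply: dvdpp.
rewrite -mulr_natr mulrCA exprSr.
rewrite dvdp_mul2l ?expf_neq0 ?polyXsubC_eq0 //.
rewrite dvdp_XsubCl rootM -polyC_natr rootC pnatr_eq0 orbF => rQ.
case/negP: ndn; rewrite QE exprS dvdp_mul2r ?expf_neq0 ?polyXsubC_eq0 //.
by rewrite dvdp_XsubCl.
Qed.

Lemma rootpoly_neq0 a zs : a != 0 -> rootpoly a zs != 0.
Proof.
move=> a0; rewrite /rootpoly scaler_eq0 negb_or a0 prodf_seq_neq0.
by apply/allP => z _ /=; rewrite expf_neq0 // polyXsubC_eq0.
Qed.

Lemma rootpoly_rem a zs z : z \in zs ->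
  rootpoly a zs = ('X - z.1%:P) ^+ z.2 * rootpoly a (rem z zs).
Proof. by move=> zz; rewrite /rootpoly (big_rem z) //= scalerAr. Qed.

Lemma rootpoly_notroot a zs z : a != 0 -> uniq (unzip1 zs) -> z \in zs ->
  ~~ root (rootpoly a (rem z zs)) z.1.
Proof.
move=> a0 uz zz; rewrite /root hornerZ mulf_neq0 // horner_prod prodf_seq_neq0.
apply/allP => y yz /=; rewrite horner_exp hornerXsubC expf_neq0 // subr_eq0.
have : uniq (unzip1 (z :: rem z zs)) by rewrite -(perm_uniq (perm_map _ (perm_to_rem zz))).
by case/andP=> nz _; apply: contraNneq nz => ->; apply: map_f.
Qed.

(** Since p^k | F(w) and F divides a multiple of G^e for the squarefree part G,
    the valuation of G(w) is at least k/e. *)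
Lemma exists_order_le (F : {poly int}) (a : algC) zs (e D : nat) :
  a != 0 -> uniq (unzip1 zs) -> all (fun z => 0 < z.2 <= e)%N zs -> (0 < e)%N ->
  map_poly intr F = rootpoly a zs -> ((size F).-1 <= D)%N ->
  exists M : nat, (0 < M)%N /\ forall p, prime p -> ~~ (p %| M)%N -> order_le p e D F.
Proof.
move=> a0 uz ze e0 FE sF.
have F0 : F != 0.
  have := rootpoly_neq0 zs a0; rewrite -FE; apply: contraNneq => ->; by rewrite rmorph0.
pose FQ := pZtoQ F.
have FQ0 : FQ != 0 by rewrite map_poly_eq0_id0 ?intr_eq0 ?lead_coef_eq0.
pose GQ := FQ %/ gcdp FQ FQ^`().
have dG : FQ %| GQ ^+ e.
  rewrite -(dvdp_map (ratr : {rmorphism rat -> algC})) -pZtoC_pZtoQ FE /rootpoly dvdpZl //.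
  rewrite rmorphXn /=; apply: prod_XsubC_dvd => // z zz.
  have /andP[z0 zle] := allP ze z zz.
  apply: dvdp_trans (dvdp_exp2l _ zle) _; apply: dvdp_exp2r; rewrite dvdp_XsubCl.
  apply: (@root_squarefree FQ z.1 z.2) => //; rewrite -pZtoC_pZtoQ FE (rootpoly_rem a zz).
    exact: dvdp_mulr.
  rewrite exprSr dvdp_mul2l ?expf_neq0 ?polyXsubC_eq0 // dvdp_XsubCl.
  exact: rootpoly_notroot.
have [G [g [g0 GE]]] := rat_poly_lift GQ.
have gR : g%:~R != 0 :> rat by rewrite intr_eq0.
have [U [V [k [k0 UV]]]] : exists U V (k : int), k != 0 /\ U * G + V * G^`() = k%:P.
  apply: bezout_int; rewrite GE derivZ coprimepZl // coprimepZr //.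
  by have := make_separable FQ0; rewrite /GQ; rewrite unlock.
have : F %| G ^+ e.
  by rewrite -dvdp_rat_int rmorphXn /= GE exprZn dvdpZr ?expf_neq0.
case/Pdiv.Idomain.dvdpP => -[c S] /= c0 cE.
exists (absz (k * c)%R); split; first by rewrite absz_gt0 mulf_neq0.
move=> p p_pr; rewrite -[p in (p %| _)%N]absz_nat -dvdzE prime_dvdz_mul // negb_or => /andP[pk pc].
exists G; split.
- have : (size G <= size F)%N.
    rewrite -(size_rat_int_poly G) GE size_scale // -(size_rat_int_poly F).
    by rewrite /GQ; apply: leq_divp.
  by move=> sG; apply: leq_trans sF; case: (size G) (size F) sG => [|?] [].
- move=> w pG; apply: contra pk => pG'.
  move/(congr1 (fun P : {poly int} => P.[w])): UV; rewrite !hornerE => <-.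
  by rewrite rpredD // dvdz_mull.
- move=> m w dF; apply: dvdz_pexp_root => //.
  rewrite -(@Gauss_pexp p p_pr m c) //.
  move/(congr1 (fun P : {poly int} => P.[w])): cE; rewrite !hornerE => ->.
  by rewrite dvdz_mull.
Qed.

(** Otherwise the minimal polynomial would divide its derivative. *)
Lemma minCpoly_simple (x : algC) (q : {poly rat}) : minCpoly x = pQtoC q ->
  q \is monic -> (forall g, root (pQtoC g) x = (q %| g)) ->
  exists2 q1, pQtoC q = ('X - x%:P) * q1 & ~~ root q1 x.
Proof.
move=> qE mq qP; have : root (pQtoC q) x by rewrite qP.
case/factor_theorem => q1 q1E; exists q1; first by rewrite q1E mulrC.
have sq : (1 < size q)%N by have := size_minCpoly x; rewrite qE size_map_poly.
apply/negP => rq1; have : q %| q^`().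
  rewrite -qP -deriv_map q1E derivM derivXsubC mulr1 /root hornerD hornerM hornerXsubC.
  by rewrite subrr mulr0 add0r.
have q'0 : q^`() != 0.
  have s2 : ((size q).-2.+1 = (size q).-1)%N by rewrite prednK // -subn1 subn_gt0.
  apply/eqP => q'0; have := congr1 (fun g : {poly rat} => g`_(size q).-2) q'0.
  rewrite coef_deriv coef0 s2 -/(lead_coef q) (monicP mq) => /eqP.
  by rewrite pnatr_eq0 -s2.
by move/(dvdp_leq q'0); rewrite leqNgt lt_size_deriv // monic_neq0.
Qed.

(** Conjugate roots have the same multiplicity. *)
Lemma minpoly_exp_dvd (x : algC) (q P : {poly rat}) n : minCpoly x = pQtoC q ->
  q \is monic -> (forall g, root (pQtoC g) x = (q %| g)) ->
  ('X - x%:P) ^+ n %| pQtoC P -> q ^+ n %| P.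
Proof.
move=> qE mq qP; have [q1 q1E rq1] := minCpoly_simple qE mq qP.
elim: n P => [|n IH] P d; first by rewrite [q ^+ _]expr0 dvd1p.
have : q %| P.
  by rewrite -qP -dvdp_XsubCl; apply: dvdp_trans d; rewrite exprS dvdp_mulr.
case/dvdpP => P1 P1E; rewrite P1E exprSr dvdp_mul2r ?monic_neq0 //; apply: IH.
move: d; rewrite P1E rmorphM /= q1E mulrCA exprS dvdp_mul2l ?polyXsubC_eq0 //.
by rewrite Gauss_dvdpl // coprimep_expl // coprimep_sym coprimep_XsubC.
Qed.

(** If w is close to z then Q(w) is close to Q(z), which is almost 0, and F(w)
    is divisible by Q(w)^e up to a constant prime to p. *)
Lemma exists_order_ge (Q F : {poly int}) e : pZtoQ Q ^+ e %| pZtoQ F ->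
  exists M : nat, (0 < M)%N /\ forall p, prime p -> ~~ (p %| M)%N ->
    (forall s, exists z, ((p ^ s)%N %| Q.[z])%Z) -> order_ge p e F.
Proof.
rewrite -rmorphXn dvdp_rat_int => /Pdiv.Idomain.dvdpP[[c S] /= c0 cE].
exists (absz c); split; first by rewrite absz_gt0.
move=> p p_pr; rewrite -[p in (p %| _)%N]absz_nat -dvdzE => pc H s.
have [z zs] := H s; exists z => k w ks wz.
have Qw : ((p ^ k)%N %| Q.[w])%Z.
  by rewrite -(subrK Q.[z] Q.[w]) rpredD ?(dvdz_expl ks zs) // dvdz_horner.
rewrite -(@Gauss_pexp p p_pr _ c) //.
move/(congr1 (fun P : {poly int} => P.[w])): cE; rewrite !hornerE => ->.
by rewrite dvdz_mull // [(e * k)%N]mulnC -pexpzX dvdz_exp2r.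
Qed.

(** A rational number is a p-adic integer for every p prime to its denominator. *)
Lemma exists_order_ge_rat (F : {poly int}) (x : algC) e : x \in Crat ->
  ('X - x%:P) ^+ e %| map_poly intr F ->
  exists M : nat, (0 < M)%N /\ forall p, prime p -> ~~ (p %| M)%N -> order_ge p e F.
Proof.
case/CratP => a ->; rewrite pZtoC_pZtoQ => d.
pose Q : {poly int} := denq a *: 'X - (numq a)%:P.
have QE : pZtoQ Q = (denq a)%:~R *: ('X - a%:P).
  rewrite rmorphB /= linearZ /= map_polyX map_polyC /= scalerBr; congr (_ - _).
  by rewrite -mul_polyC -polyCM mulrC -numqE.
have dQ : pZtoQ Q ^+ e %| pZtoQ F.
  rewrite QE exprZn dvdpZl ?expf_neq0 ?intr_eq0 ?denq_neq0 //.
  rewrite -(dvdp_map (ratr : {rmorphism rat -> algC})) rmorphXn /= rmorphB /= map_polyX.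
  by rewrite map_polyC.
have [M [M0 MP]] := exists_order_ge dQ.
exists (M * absz (denq a))%N; split; first by rewrite muln_gt0 M0 absz_gt0 denq_neq0.
move=> p p_pr; rewrite Euclid_dvdM // negb_or => /andP[pM pd]; apply: MP => // s.
have cop : coprimez (denq a) (p ^ s)%N%:Z.
  by rewrite /coprimez gcdzC /gcdz absz_nat eqz_nat -/(coprime _ _) coprimeXl // prime_coprime.
have /coprimezP[[u v] /= uv] := cop.
exists (u * numq a).
have -> : Q.[u * numq a] = (- (v * numq a)) * (p ^ s)%N%:Z.
  rewrite /Q hornerD hornerN hornerZ hornerX hornerC.
  have -> : - (v * numq a) * (p ^ s)%N%:Z = (u * denq a - (u * denq a + v * (p ^ s)%N%:Z)) * numq a by ring.
  by rewrite uv; ring.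
exact: dvdz_mull.
Qed.

(** * Normal forms *)

Section Monomials.
Variable A : nzRingType.
Implicit Type f : {poly {poly A}}.

Lemma mem_monomials f j k : ((j, k) \in monomials f) = (f`_j`_k != 0).
Proof.
rewrite mem_filter /=; case: (boolP (f`_j`_k != 0)) => //= fjk.
apply/allpairsPdep; exists j, k; split => //; rewrite mem_iota add0n /=.
  by rewrite ltnNge; apply: contra fjk => /(nth_default 0) ->; rewrite coef0.
by rewrite ltnNge; apply: contra fjk => /(nth_default 0) ->.
Qed.

Lemma monomials_uniq f : uniq (monomials f).
Proof.
rewrite filter_uniq // allpairs_uniq_dep ?iota_uniq // => [j _|].
  exact: iota_uniq.
by move=> [a b] [c d] _ _ [-> ->].
Qed.

Lemma le_total_degree f j k : f`_j`_k != 0 -> (j + k <= total_degree f)%N.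
Proof.
rewrite -mem_monomials => jk; rewrite /total_degree.
exact: (@leq_bigmax_seq _ _ xpredT (fun jk : nat * nat => (jk.1 + jk.2)%N) (j, k)).
Qed.

Lemma monomials_exists f : f != 0 -> exists j k, f`_j`_k != 0.
Proof.
move=> f0; exists (size f).-1, (size f`_(size f).-1).-1.
by rewrite -!/(lead_coef _) !lead_coef_eq0.
Qed.

End Monomials.

Lemma rootpoly_size a (zs : seq (algC * nat)) : let n := (\sum_(z <- zs) z.2)%N in
  [/\ (size (rootpoly a zs) <= n.+1)%N, (rootpoly a zs)`_n = a &
      all (fun z => z.1 != 0) zs -> a != 0 -> (rootpoly a zs)`_0 != 0].
Proof.
move=> n; split.
- apply: leq_trans (size_scale_leq _ _) _; rewrite /n.
  elim: zs {n} => [|z zs IH]; first by rewrite !big_nil size_poly1.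
  by rewrite !big_cons; case: (homogMXsubCX z.2 z.1 0 0 IH).
- have := homog_prod a zs 0 1; rewrite homog0l expr1n mulr1 => ->.
  by rewrite big1 ?mulr1 // => z _; rewrite mulr0 subr0 expr1n.
- move=> zs0 a0; have := homog_prod a zs 1 0; rewrite homog0r expr1n mulr1 => ->.
  rewrite mulf_neq0 // prodf_seq_neq0; apply/allP => z zz /=.
  by rewrite expf_neq0 // mulr1 sub0r oppr_eq0 (allP zs0).
Qed.

Lemma qhpoly_rootpoly a (zs : seq (algC * nat)) al be t r :
  qhpoly al be t r (\sum_(z <- zs) z.2)%N (rootpoly a zs) =
  a%:P%:P * 'X ^+ al * 'Y ^+ be *
        \prod_(z <- zs) ('Y ^+ t - z.1%:P%:P * 'X ^+ r) ^+ z.2.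
Proof.
rewrite qhpoly_homog.
pose zs' := [seq (z.1%:P%:P : {poly {poly algC}}, z.2) | z <- zs].
have -> : map_poly (polyC \o polyC) (rootpoly a zs) =
    a%:P%:P *: \prod_(z <- zs') ('X - z.1%:P) ^+ z.2.
  rewrite /rootpoly map_polyZ /= rmorph_prod big_map; congr (_ *: _).
  by apply: eq_bigr => z _; rewrite rmorphXn rmorphB /= map_polyX map_polyC.
have -> : (\sum_(z <- zs) z.2 = \sum_(z <- zs') z.2)%N by rewrite big_map.
rewrite homog_prod big_map /=; ring.
Qed.

Section NormalForm.
Variable R : realType.

Lemma normal_form_int_form (f : {poly {poly int}}) a al be t r zs :
  normal_form R f a al be t r zs -> (0 < \sum_(z <- zs) z.2)%N ->
  exists F, int_form (total_degree f) f al be t r (\sum_(z <- zs) z.2)%N F /\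
    map_poly intr F = rootpoly a zs.
Proof.
set n := (\sum_(z <- zs) z.2)%N => -[_ [t1 tr cop] [a0 uz za] fE] n0.
have [sP Pn P0] := rootpoly_size a zs; rewrite -/n in sP Pn.
rewrite -qhpoly_rootpoly -/n in fE.
have sPn : size (rootpoly a zs) = n.+1.
  apply/eqP; rewrite eqn_leq sP ltnNge; apply: contra a0 => /(nth_default 0).
  by rewrite Pn => ->.
have inj : injective (intr : {rmorphism int -> algC}) by apply: intr_inj.
have [F [fq FE sF]] := qhpoly_descent inj t1 sPn fE.
have F0 : F`_0 != 0.
  rewrite -(intr_eq0 algC) -coef_map /= FE P0 //.
  by apply/allP => z /(allP za) /andP[].
have Fn : F`_n != 0 by rewrite -(intr_eq0 algC) -coef_map /= FE Pn.
have le_x : (al + r * n + be <= total_degree f)%N.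
  by apply: le_total_degree; rewrite fq coef_qhpoly_x.
have le_y : (al + (be + t * n) <= total_degree f)%N.
  by apply: le_total_degree; rewrite fq coef_qhpoly_y.
have r0 : (0 < r)%N by apply: leq_trans tr.
exists F; split => //; split => //.
- rewrite t1; apply: leq_trans le_y; rewrite addnA; apply: leq_trans (leq_addl _ _).
  by rewrite leq_pmulr.
- rewrite r0; apply: leq_trans le_x; rewrite addnAC; apply: leq_trans (leq_addl _ _).
  by rewrite leq_pmulr.
- by rewrite coprime_sym.
- apply: leq_trans (leq_addl _ _); rewrite -mulnA leq_pmulr // muln_gt0 r0 n0 //.
- by apply: leq_trans (leq_addl _ _); rewrite mulnAC leq_pmull // muln_gt0 t1 n0.
- by apply: leq_trans le_x; rewrite leq_addr.
- by apply: leq_trans le_y; rewrite leq_addl.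
Qed.

End NormalForm.

(** * Weights and existence of a normal form *)

Lemma poly_nat_roots (A : idomainType) (p : {poly A}) :
  injective (fun n : nat => n%:R : A) -> (forall n : nat, p.[n%:R] = 0) -> p = 0.
Proof.
move=> inj p0; apply/eqP; apply: contraT => pn0.
have := @max_poly_roots _ p [seq n%:R | n <- iota 0 (size p)] pn0.
rewrite map_inj_uniq // iota_uniq size_map size_iota ltnn; apply => //.
by apply/allP => _ /mapP[n _ ->]; rewrite /root p0.
Qed.

Lemma horner2E (A : comNzRingType) (f : {poly {poly A}}) x y :
  f.[x, y] = \sum_(j < size f) \sum_(k < size f`_j) f`_j`_k * x ^+ j * y ^+ k.
Proof.
rewrite (horner_coef f) horner_sum; apply: eq_bigr => j _.
rewrite -rmorphXn hornerM hornerC horner_coef mulr_suml.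
by apply: eq_bigr => k _; rewrite mulrAC.
Qed.

Section Weights.
Variable R : realType.

(** Compare the coefficients of f(2^k1 x, 2^k2 y) and 2 f(x, y): they satisfy
    2^(k1 j + k2 k) = 2 as soon as the monomial occurs. *)
Lemma weights_monomial (f : {poly {poly int}}) (k1 k2 : R) :
  quasi_homogeneous_for f k1 k2 -> forall j k, f`_j`_k != 0 -> k1 * j%:R + k2 * k%:R = 1.
Proof.
case=> k10 k20 Hf j k fjk; pose g : {poly {poly R}} := map_bipoly intr f.
have gE i l : g`_i`_l = (f`_i`_l)%:~R by rewrite !coef_map.
pose u i l := g`_i`_l * ((2 `^ k1) ^+ i * (2 `^ k2) ^+ l - 2).
pose h : {poly {poly R}} := \poly_(i < size g) \poly_(l < size g`_i) u i l.
have hu i l : h`_i`_l = u i l.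
  rewrite coef_poly; case: ltnP => [_|gi]; last by rewrite coef0 /u (nth_default 0 gi) coef0 mul0r.
  by rewrite coef_poly; case: ltnP => // gl; rewrite /u (nth_default 0 gl) mul0r.
have h0 : h = 0.
  have injR : injective (fun n : nat => n%:R : R) by move=> a b /eqP; rewrite eqr_nat => /eqP.
  apply: poly_nat_roots => [a b|a]; first by rewrite -!polyC_natr => /polyC_inj /injR.
  apply: poly_nat_roots => // b; rewrite -polyC_natr.
  have hE x y : h.[x, y] = g.[2 `^ k1 * x, 2 `^ k2 * y] - 2 * g.[x, y].
    rewrite [g.[_, _]]horner2E [g.[x, y]]horner2E mulr_sumr -sumrB horner_poly horner_sum.
    apply: eq_bigr => i _; rewrite -rmorphXn hornerM hornerC horner_poly mulr_sumr -sumrB mulr_suml.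
    by apply: eq_bigr => l _; rewrite /u !exprMn; ring.
  by rewrite hE Hf // subrr.
have : u j k = 0 by rewrite -hu h0 !coef0.
move/eqP; rewrite /u mulf_eq0 gE intr_eq0 (negPf fjk) /= subr_eq0 => /eqP.
rewrite -!powR_mulrn ?powR_ge0 // -!powRrM -powRD ?pnatr_eq0 ?implybT // => /(congr1 (@ln R)).
rewrite ln_powR => e; apply: (mulIf (_ : ln 2 != 0 :> R)); last by rewrite mul1r.
by rewrite gt_eqF // ln_gt0 // ltr1n.
Qed.

Lemma quasi_homogeneous_swap (f : {poly {poly int}}) (k1 k2 : R) :
  quasi_homogeneous_for f k1 k2 -> quasi_homogeneous_for (swapXY f) k2 k1.
Proof.
case=> k10 k20 H; split => // a x y a0.
have sE (u v : R) : (map_bipoly intr (swapXY f)).[u, v] = (map_bipoly intr f).[v, u].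
  by rewrite /map_bipoly -swapXY_map horner2_swapXY.
by rewrite !sE H.
Qed.

(** Two distinct monomials force k2/k1 to be a rational number r/t, and then
    the exponents of all the monomials lie on one line of slope -t/r: dividing
    by the largest x^al y^be leaves a homogeneous polynomial in x^r and y^t,
    which is split over the algebraic numbers. *)
Lemma exists_normal_form_le (f : {poly {poly int}}) (k1 k2 : R) j1 l1 j2 l2 :
  quasi_homogeneous_for f k1 k2 -> k1 <= k2 ->
  f`_j1`_l1 != 0 -> f`_j2`_l2 != 0 -> (j1, l1) != (j2, l2) ->
  exists a al be t r zs, normal_form R f a al be t r zs.
Proof.
move=> qf k12 m1 m2 ne; have [k10 k20 _] := qf.
have W := weights_monomial qf.
have k1n : k1 != 0 by rewrite gt_eqF.
have k2n : k2 != 0 by rewrite gt_eqF.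
wlog lt_j : j1 l1 j2 l2 m1 m2 ne / (j2 < j1)%N.
  move=> th; case: (ltngtP j1 j2) => [lt|lt|ej].
  - by apply: (th j2 l2 j1 l1) => //; rewrite eq_sym.
  - exact: (th j1 l1 j2 l2).
  have el : l1 = l2.
    apply/eqP; rewrite -(eqr_nat R); apply/eqP/(mulfI k2n)/(@addrI _ (k1 * j1%:R)).
    by rewrite (W _ _ m1) ej (W _ _ m2).
  by move: ne; rewrite ej el eqxx.
have lt_l : (l1 < l2)%N.
  rewrite -(ltr_nat R) -(ltr_pM2l k20).
  have : k1 * j2%:R < k1 * j1%:R by rewrite ltr_pM2l // ltr_nat.
  by have := W _ _ m1; have := W _ _ m2; lra.
pose g := gcdn (j1 - j2) (l2 - l1).
have g0 : (0 < g)%N by rewrite gcdn_gt0 subn_gt0 lt_j.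
pose r := ((j1 - j2) %/ g)%N; pose t := ((l2 - l1) %/ g)%N.
have rE : (r * g = j1 - j2)%N by rewrite divnK // dvdn_gcdl.
have tE : (t * g = l2 - l1)%N by rewrite divnK // dvdn_gcdr.
have r0 : (0 < r)%N by move: lt_j; rewrite -subn_gt0 -rE muln_gt0 => /andP[].
have t0 : (0 < t)%N by move: lt_l; rewrite -subn_gt0 -tE muln_gt0 => /andP[].
have cop : coprime r t.
  rewrite /coprime -(eqn_pmul2r g0) mul1n muln_gcdl rE tE.
  exact: eqxx.
have kk : k1 * r%:R = k2 * t%:R.
  have gR : g%:R != 0 :> R by rewrite pnatr_eq0 -lt0n.
  apply: (mulIf gR); rewrite -!mulrA -!natrM rE tE !natrB 1?ltnW //.
  by have := W _ _ m1; have := W _ _ m2; lra.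
have tr : (t <= r)%N.
  rewrite -(ler_nat R) -(ler_pM2l k20) -kk ler_wpM2r //.
(* the monomials of smallest degree in x and in y *)
have exj : exists j, f`_j != 0.
  by exists j1; apply: contraNneq m1 => ->; rewrite coef0.
have exl : exists l, (swapXY f)`_l != 0.
  by exists l1; apply: contraNneq m1 => e; rewrite -coef_swapXY e coef0.
case: (ex_minnP exj) => al al_nz al_min; case: (ex_minnP exl) => be be_nz be_min.
have minj j l : f`_j`_l != 0 -> (al <= j)%N.
  by move=> m; apply: al_min; apply: contraNneq m => ->; rewrite coef0.
have minl j l : f`_j`_l != 0 -> (be <= l)%N.
  by move=> m; apply: be_min; apply: contraNneq m => e; rewrite -coef_swapXY e coef0.
have [K mK] : exists K, f`_al`_K != 0.
  by exists (size f`_al).-1; rewrite -/(lead_coef _) lead_coef_eq0.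
have [J mJ] : exists J, f`_J`_be != 0.
  by exists (size (swapXY f)`_be).-1; rewrite -coef_swapXY -/(lead_coef _) lead_coef_eq0.
have rel j l : f`_j`_l != 0 -> (t * j + r * l = t * al + r * K)%N.
  move=> m; apply/eqP; rewrite -(eqr_nat R) !natrD !natrM; apply/eqP/(mulfI k2n).
  rewrite !mulrDr !mulrA -kk.
  have -> : k1 * r%:R * j%:R + k2 * r%:R * l%:R = r%:R * (k1 * j%:R + k2 * l%:R) by ring.
  have -> : k1 * r%:R * al%:R + k2 * r%:R * K%:R = r%:R * (k1 * al%:R + k2 * K%:R) by ring.
  by rewrite !W.
have step j l : f`_j`_l != 0 -> exists2 a, j = (al + r * a)%N & (l + t * a = K)%N.
  move=> m; have e := rel _ _ m; have lj := minj _ _ m.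
  have lK : (l <= K)%N by rewrite -(leq_pmul2l r0) -(leq_add2l (t * al)) -e leq_add2r leq_mul2l lj orbT.
  have e' : (t * (j - al) = r * (K - l))%N.
    apply/eqP; rewrite -(eqn_add2r (t * al + r * l)) addnA -mulnDr subnK // e.
    by rewrite addnCA -mulnDr subnK.
  have /dvdnP[a ja] : (r %| j - al)%N.
    by rewrite -(Gauss_dvdr _ (_ : coprime r t)) // e' dvdn_mulr.
  exists a; first by rewrite mulnC -ja subnKC.
  move: e'; rewrite ja [(a * r)%N]mulnC mulnCA => /eqP; rewrite eqn_pmul2l // => /eqP ->.
  by rewrite subnKC.
have [n JE KE] := step _ _ mJ.
pose F : {poly int} := \poly_(k < n.+1) f`_(al + r * (n - k))`_(be + t * k).
have Fk k : (k <= n)%N -> F`_k = f`_(al + r * (n - k))`_(be + t * k).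
  by move=> kn; rewrite coef_poly ltnS kn.
have fF : f = qhpoly al be t r n F.
  apply/polyP => i; apply/polyP => l; have [f0|fil] := eqVneq f`_i`_l 0.
    rewrite coef_qhpoly big1 // => k _; rewrite Fk; last by rewrite -ltnS.
    by case: andP => [[/eqP <- /eqP <-]|_]; rewrite ?f0 ?mul0rn // mulr0n.
  have [a iE lE] := step _ _ fil; have := minl _ _ fil => bl.
  have an : (a <= n)%N.
    by rewrite -(leq_pmul2l t0) -(leq_add2l be) KE -lE leq_add2r.
  have -> : i = (al + r * (n - (n - a)))%N by rewrite subKn.
  have -> : l = (be + t * (n - a))%N.
    by apply/eqP; rewrite -(eqn_add2r (t * a)) lE -KE -addnA -mulnDr subnK.
  by rewrite coef_qhpoly_corner ?leq_subr // Fk ?leq_subr.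
have F0 : F`_0 != 0 by rewrite Fk // subn0 muln0 addn0 -JE.
have Fn : F`_n != 0 by rewrite Fk // subnn muln0 addn0 KE.
pose P : {poly algC} := map_poly intr F.
have [rs PE] := closed_field_poly_normal P.
pose zs := [seq (z, count_mem z rs) | z <- undup rs].
have PE' : P = rootpoly (lead_coef P) zs.
  by rewrite {1}PE /rootpoly big_map prodr_undup_exp_count.
have P0 : P`_0 != 0 by rewrite coef_map intr_eq0.
have aP : lead_coef P != 0.
  by rewrite lead_coef_eq0; apply: contraNneq P0 => ->; rewrite coef0.
have nE : (\sum_(z <- zs) z.2)%N = n.
  have [h1 h2 _] := rootpoly_size (lead_coef P) zs; rewrite -PE' in h1 h2.
  have sP : size P = n.+1.
    rewrite size_map_inj_poly //; last exact: intr_inj.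
    apply/eqP; rewrite eqn_leq size_poly ltnNge.
    by apply: contra Fn => /(nth_default 0) ->.
  apply/eqP; rewrite eqn_leq; apply/andP; split; last by rewrite -ltnS -sP.
  rewrite -ltnS -sP ltnNge; apply: contra aP => /(nth_default 0).
  by rewrite h2 => ->.
exists (lead_coef P), al, be, t, r, zs; split => //.
- exists k1, k2; split => //; apply: (mulIf k1n); rewrite divfK //.
  have tR : t%:R != 0 :> R by rewrite pnatr_eq0 -lt0n.
  by apply: (mulIf tR); rewrite -kk; field.
- split => //; first by rewrite /unzip1 /zs -map_comp map_id_in ?undup_uniq.
  apply/allP => _ /mapP[z zr ->] /=; rewrite mem_undup in zr.
  apply/andP; split; last by rewrite -has_count has_pred1.
  apply: contraNneq P0 => z0; rewrite -horner_coef0 PE hornerZ horner_prod.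
  by rewrite (big_rem z) //= hornerXsubC z0 subrr mul0r mulr0.
- by rewrite -qhpoly_rootpoly nE -PE' {1}fF map_bipoly_qhpoly.
Qed.

(** Interchanging x and y if necessary, a normal form exists, so that the value
    chosen by [max_order] is attained. *)
Lemma max_orderP (f : {poly {poly int}}) : quasi_homogeneous R f ->
  (1 < size (monomials f))%N -> is_max_order R f (max_order R f).
Proof.
move=> [k1 [k2 qf]] sm; rewrite /max_order; apply: (@xgetPex _ 0%N [set m | is_max_order R f m]%classic).
have [[j1 l1] [[j2 l2] [m1 m2 ne]]] : exists u v, [/\ u \in monomials f, v \in monomials f & u != v].
  move: sm (monomials_uniq f); case E : (monomials f) => [|u [|v s]] //= _ /andP[uv _].
  exists u, v; rewrite !inE !eqxx ?orbT; split => //.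
  by move: uv; rewrite inE negb_or => /andP[].
rewrite !mem_monomials in m1 m2.
have [k12|/ltW k12] := leP k1 k2.
  have [a [al [be [t [r [zs nf]]]]]] := exists_normal_form_le qf k12 m1 m2 ne.
  by eexists; exists a, al, be, t, r, zs; split; first left.
have m1' : (swapXY f)`_l1`_j1 != 0 by rewrite coef_swapXY.
have m2' : (swapXY f)`_l2`_j2 != 0 by rewrite coef_swapXY.
have ne' : (l1, j1) != (l2, j2) by apply: contraNneq ne => -[-> ->].
have [a [al [be [t [r [zs nf]]]]]] :=
  exists_normal_form_le (quasi_homogeneous_swap qf) k12 m1' m2' ne'.
by eexists; exists a, al, be, t, r, zs; split; first right.
Qed.

End Weights.

(** * Multiplicity of irrational roots and exceptional polynomials *)

(** The e-th power of the minimal polynomial of x divides F, and it has degree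
    2 e at least; if n = 2 e there is nothing left but a constant. *)
Lemma irrational_multiplicity (F : {poly int}) (a : algC) zs (x : algC) (e n : nat) :
  map_poly intr F = rootpoly a zs -> (x, e) \in zs -> x \notin Crat -> (0 < e)%N ->
  size F = n.+1 ->
  (2 * e <= n)%N /\ ((n = 2 * e)%N -> exists (c : rat) (q : {poly rat}),
    [/\ c != 0, size q = 3%N, forall y, ~~ root q y & pZtoQ F = c *: q ^+ e]).
Proof.
move=> FE xz xR e0 sF.
have [q [qE mq qP]] := minCpolyP x.
have sFQ : size (pZtoQ F) = n.+1 by rewrite size_rat_int_poly.
have F0 : pZtoQ F != 0 by rewrite -size_poly_gt0 sFQ.
have dq : q ^+ e %| pZtoQ F.
  apply: (minpoly_exp_dvd qE mq qP); rewrite -pZtoC_pZtoQ FE (rootpoly_rem a xz).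
  exact: dvdp_mulr.
have q0 := monic_neq0 mq.
have rx : root (pQtoC q) x by rewrite qP.
have sq2 : (1 < size q)%N by have := size_minCpoly x; rewrite qE size_map_poly.
have sq : (2 < size q)%N.
  rewrite ltn_neqAle sq2 andbT; apply: contra xR => /eqP s2.
  move: rx; rewrite /root horner_coef size_map_poly -s2 big_ord_recl big_ord1 /= !coef_map /=.
  have -> : q`_1 = 1 by move: mq; rewrite monicE /lead_coef -s2 => /eqP.
  rewrite expr0 mulr1 rmorph1 mul1r expr1 addrC addr_eq0 => /eqP ->.
  by rewrite rpredN; apply/CratP; exists q`_0.
have noroot y : ~~ root q y.
  apply/negP => /factor_theorem[q2 q2E].
  have : root (pQtoC q2) x.
    move: rx; rewrite q2E rmorphM rootM /= => /orP[//|].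
    rewrite rmorphB /= map_polyX map_polyC /= root_XsubC => /eqP xy.
    by case/negP: xR; rewrite xy; apply/CratP; exists y.
  rewrite qP => /dvdp_leq; have q20 : q2 != 0 by apply: contraNneq q0 => q20; rewrite q2E q20 mul0r.
  by move/(_ q20); rewrite q2E size_mul ?polyXsubC_eq0 // size_XsubC addn2 /= ltnn.
have sqe : (size (q ^+ e) = ((size q).-1 * e).+1)%N.
  by rewrite -(size_exp q e) prednK // size_poly_gt0 expf_neq0.
have le1 : ((size q).-1 * e <= n)%N by rewrite -ltnS -sqe -sFQ dvdp_leq.
have q1 : (2 <= (size q).-1)%N by rewrite -ltnS prednK // ltnW.
split=> [|n2e]; first by apply: leq_trans le1; rewrite leq_mul2r q1 orbT.
have sq3 : size q = 3%N.
  have : ((size q).-1 <= 2)%N by rewrite -(leq_pmul2r e0) -n2e.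
  by move=> h; rewrite -(prednK (ltnW sq2)); congr _.+1; apply/eqP; rewrite eqn_leq h q1.
have : q ^+ e %= pZtoQ F.
  by rewrite -dvdp_size_eqp // sqe sFQ sq3 n2e.
rewrite eqp_sym => /eqpP[[c1 c2] /= /andP[c10 c20] cE].
exists (c1^-1 * c2), q; split => //; first by rewrite mulf_neq0 ?invr_eq0.
by rewrite -scalerA -cE scalerA mulVf ?scale1r.
Qed.

(** This is how the irreducibility of the form b y^2 + c x y + d x^2 is used. *)
Definition anisotropic (b c d : rat) : Prop :=
  forall x y : rat, b * y ^+ 2 + c * x * y + d * x ^+ 2 = 0 -> x = 0 /\ y = 0.

Lemma horner_quad_form b c d x y :
  (quad_form b c d).[x, y] = b * y ^+ 2 + c * x * y + d * x ^+ 2.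
Proof.
by rewrite /quad_form !(hornerD, horner_exp, hornerM, hornerC, hornerX).
Qed.

Lemma quad_formE b c d : quad_form b c d =
  (d%:P%:P * 'X + (c%:P * 'X)%:P) * 'X + (b%:P * 'X ^+ 2)%:P.
Proof. by rewrite /quad_form polyYXn !polyCM; ring. Qed.

Lemma size_quad_form b c d : d != 0 -> size (quad_form b c d) = 3%N.
Proof.
move=> d0; have dP : d%:P%:P != 0 :> {poly {poly rat}} by rewrite !polyC_eq0.
rewrite quad_formE !size_MXaddC (negPf dP) /= size_polyC polyC_eq0 d0.
case: eqP => // e; have := congr1 (fun p : {poly {poly rat}} => size p) e.
by rewrite size_MXaddC (negPf dP) /= size_polyC polyC_eq0 d0 size_poly0.
Qed.

Lemma lead_coef_quad_form b c d : d != 0 -> lead_coef (quad_form b c d) = d%:P.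
Proof.
move=> d0; rewrite lead_coefE size_quad_form // quad_formE coefD coefMX coefD coefMX /=.
by rewrite !coefC /= !addr0.
Qed.

Lemma sum4_eq2 (x y : nat) : (0 < x -> 0 < y -> x != 1 -> y != 1 -> x + y = 4 -> x = 2)%N.
Proof. by lia. Qed.

Lemma const_unit (d : rat) (p q : {poly rat}) : d != 0 -> p * q = d%:P -> p \is a GRing.unit.
Proof.
move=> d0 pq; have : p * q \is a GRing.unit by rewrite pq poly_unitE size_polyC d0 coefC unitfE d0.
by rewrite unitrM => /andP[].
Qed.

(** As polynomials in x the factors have invertible leading coefficients, so two
    non-units are both of degree 1 in x. One of them then has a root in Q[y],
    and specializing y to 1 yields a rational zero of the form. *)
Lemma anisotropic_irreducible b c d : anisotropic b c d -> irreducible_elt (quad_form b c d).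
Proof.
move=> an; have d0 : d != 0.
  apply/eqP => d0; have [] := an 1 0; last by move/eqP; rewrite oner_eq0.
  by rewrite d0; ring.
have sz := size_quad_form b c d0.
have q0 : quad_form b c d != 0 by rewrite -size_poly_gt0 sz.
split => //; first by rewrite poly_unitE sz.
move=> u v uv; have lc : lead_coef u * lead_coef v = d%:P by rewrite -lead_coefM -uv lead_coef_quad_form.
have lu : lead_coef u \is a GRing.unit by apply: const_unit lc.
have lv : lead_coef v \is a GRing.unit by apply: (@const_unit d _ (lead_coef u)) => //; rewrite mulrC.
have u0 : u != 0 by apply: contraNneq q0 => u0; rewrite uv u0 mul0r.
have v0 : v != 0 by apply: contraNneq q0 => v0; rewrite uv v0 mulr0.
have suv : (size u + size v = 4)%N.
  have := size_mul u0 v0; rewrite -uv sz => e; rewrite -(prednK (_ : 0 < size u + size v)%N) -?e //.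
  by rewrite addn_gt0 size_poly_gt0 u0.
have unit_of (w : {poly {poly rat}}) : size w = 1%N -> lead_coef w \is a GRing.unit -> w \is a GRing.unit.
  by move=> sw lw; rewrite poly_unitE sw eqxx /=; move: lw; rewrite lead_coefE sw.
have [su|su] := eqVneq (size u) 1%N; first by left; apply: unit_of.
have [sv|sv] := eqVneq (size v) 1%N; first by right; apply: unit_of.
have su2 : size u = 2%N.
  by apply: sum4_eq2 su sv suv; rewrite size_poly_gt0.
have : (quad_form b c d).[- (u`_0 / u`_1)] = 0.
  have lu' : u`_1 \is a GRing.unit by move: lu; rewrite lead_coefE su2.
  rewrite uv hornerM (horner_coef u) su2 big_ord_recl big_ord1 /= expr0 mulr1 expr1.
  by rewrite mulrN mulrCA divrr // mulr1 subrr mul0r.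
move/(congr1 (fun p : {poly rat} => p.[1])); rewrite horner0.
pose x0 := (- (u`_0 / u`_1)).[1].
have -> : (quad_form b c d).[- (u`_0 / u`_1)].[1] = (quad_form b c d).[x0, 1].
  rewrite /x0; move: (- _) => P.
  by rewrite quad_formE !(hornerD, hornerM, hornerC, hornerX, hornerXn).
by rewrite horner_quad_form => /an[_] /eqP; rewrite oner_eq0.
Qed.

Lemma quad_form_exceptional (f : {poly {poly int}}) a b c d m : a != 0 ->
  anisotropic b c d -> map_bipoly intr f = a%:P%:P * quad_form b c d ^+ m ->
  exceptional m f.
Proof.
by move=> a0 an fE; exists a, b, c, d; split => //; apply: anisotropic_irreducible.
Qed.

Lemma anisotropic_swap b c d : anisotropic b c d -> anisotropic d c b.
Proof. by move=> an x y e; have [|-> ->] := an y x; rewrite -?e; [ring|]. Qed.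

Lemma swap_quad_form b c d : swapXY (quad_form b c d) = quad_form d c b.
Proof.
rewrite /quad_form !rmorphD !rmorphM /= !swapXY_polyC !map_polyC /= ?map_polyX !swapXY_X.
ring.
Qed.

Lemma linear_nonunit (u v : rat) : u%:P%:P * 'X + v%:P%:P * 'Y \isn't a GRing.unit.
Proof.
rewrite poly_unitE; apply/negP => /andP[_]; rewrite coefD coefMX /= add0r.
rewrite coefCM coefC /= poly_unitE => /andP[_].
by rewrite coefCM coefX mulr0 unitr0.
Qed.

(** A nontrivial rational zero would give a linear factor. *)
Lemma irreducible_anisotropic b c d : irreducible_elt (quad_form b c d) -> anisotropic b c d.
Proof.
move=> [q0 qu irr] x0 y0 e.
have nlin u v u' v' : quad_form b c d <>
    (u%:P%:P * 'X + v%:P%:P * 'Y) * (u'%:P%:P * 'X + v'%:P%:P * 'Y).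
  by move/irr; rewrite !(negPf (linear_nonunit _ _)) => -[].
have [x00|x00] := eqVneq x0 0; last first.
  pose w := y0 / x0; have wE : b * w ^+ 2 + c * w + d = 0.
    apply: (mulIf (expf_neq0 2 x00)); rewrite mul0r -e /w; field.
    exact: x00.
  case: (nlin (- w) 1 (b * w + c) b); rewrite /quad_form.
  have -> : d = - (b * w ^+ 2 + c * w) by apply/eqP; rewrite -addr_eq0 addrC wE.
  by rewrite !(polyCN, polyCD, polyCM); ring.
split => //; apply/eqP; apply: contraT => y00; case: (nlin 1 0 d c).
have b0 : b = 0.
  by move/eqP: e; rewrite x00 expr0n /= !mulr0 mul0r !addr0 mulf_eq0 sqrf_eq0 (negPf y00) orbF => /eqP.
by rewrite /quad_form b0 !polyC0 !polyC1; ring.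
Qed.

(** * The non-exceptional case *)

Lemma swapXY_cases (f g : {poly {poly int}}) : g = f \/ g = swapXY f ->
  (forall p s, nsols p s (fun x y => f.[x, y]) = nsols p s (fun x y => g.[x, y])) /\
  total_degree g = total_degree f.
Proof.
case=> -> //; split=> [p s|].
  rewrite -nsols_swap; apply: eq_bigr => x _; apply: eq_bigr => y _.
  by rewrite horner2_swapXY.
have le (h : {poly {poly int}}) : (total_degree (swapXY h) <= total_degree h)%N.
  apply/bigmax_leqP_seq => -[j k] jk _ /=; rewrite addnC; apply: le_total_degree.
  by rewrite -coef_swapXY -mem_monomials.
apply/eqP; rewrite eqn_leq le /=.
by have := le (swapXY f); rewrite swapXYK.
Qed.

Section Height.
Variable R : realType.

(** The two extreme monomials determine the weights: k1 = t/De, k2 = r/De. *)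
Lemma hdist_int_form f g D al be t r n F : (g = f \/ g = swapXY f) ->
  quasi_homogeneous R f -> int_form D g al be t r n F -> (0 < n)%N ->
  hdist R f = (t * al + r * be + t * r * n)%N%:R / (t + r)%:R.
Proof.
move=> fg [k1 [k2 qf]] [/andP[t0 _] /andP[r0 _] _ sF F0 tDe _ _ _ gE] n0.
have Fn : F`_n != 0.
  rewrite -[n]/n.+1.-1 -sF -/(lead_coef F) lead_coef_eq0.
  by apply: contraNneq F0 => ->; rewrite coef0.
have key u v : quasi_homogeneous_for g u v ->
    1 / (u + v) = (t * al + r * be + t * r * n)%N%:R / (t + r)%:R :> R.
  move=> qg; have W := weights_monomial qg.
  have w1 : u * (al + r * n)%:R + v * be%:R = 1 by apply: W; rewrite gE coef_qhpoly_x.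
  have w2 : u * al%:R + v * (be + t * n)%:R = 1 by apply: W; rewrite gE coef_qhpoly_y.
  have [u0 v0 _] := qg.
  have nR : n%:R != 0 :> R by rewrite pnatr_eq0 -lt0n.
  have ur : u * r%:R = v * t%:R.
    apply: (mulIf nR); move: w1 w2; rewrite !natrD !natrM !mulrDr !mulrA; lra.
  have trR : t%:R + r%:R != 0 :> R by rewrite -natrD pnatr_eq0 -lt0n addn_gt0 t0.
  have uv0 : u + v != 0 by rewrite gt_eqF // addr_gt0.
  rewrite [(t + r)%:R]natrD; apply/eqP; rewrite eqr_div //; apply/eqP; rewrite mul1r.
  move: w1; rewrite !natrD !natrM => w1.
  have tE : t%:R = u * (t%:R * al%:R + r%:R * be%:R + t%:R * r%:R * n%:R) :> R.
    have := congr1 (fun z => t%:R * z) w1; rewrite /= mulr1 => e; rewrite -[LHS]e.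
    transitivity (u * (t%:R * al%:R + t%:R * r%:R * n%:R) + v * t%:R * be%:R); first by ring.
    by rewrite -ur; ring.
  have rE : r%:R = v * (t%:R * al%:R + r%:R * be%:R + t%:R * r%:R * n%:R) :> R.
    have tR : t%:R != 0 :> R by rewrite pnatr_eq0 -lt0n.
    by apply: (mulIf tR); rewrite mulrAC -ur {1}tE; ring.
  set S := (_ + _ + _) in tE rE.
  by rewrite -/S mulrDr [S * u]mulrC [S * v]mulrC -tE -rE.
have keyf u v : quasi_homogeneous_for f u v ->
    1 / (u + v) = (t * al + r * be + t * r * n)%N%:R / (t + r)%:R :> R.
  case: fg => ge quv; first by apply: key; rewrite ge.
  by rewrite addrC; apply: key; rewrite ge; apply: quasi_homogeneous_swap.
rewrite /hdist.
have := @xgetPex _ (0 : R) [set d | exists u v, quasi_homogeneous_for f u v /\ d = 1 / (u + v)]%classic.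
case; first by exists (1 / (k1 + k2)), k1, k2.
by move=> u [v [quv ->]]; apply: keyf.
Qed.

(** Without nonzero roots, f would be the monomial x^al y^be. *)
Lemma normal_form_sum_gt0 (f g : {poly {poly int}}) a al be t r zs :
  (g = f \/ g = swapXY f) -> (1 < size (monomials f))%N ->
  normal_form R g a al be t r zs -> (0 < \sum_(z <- zs) z.2)%N.
Proof.
move=> fg sm [_ _ _ gE]; rewrite lt0n; apply/eqP => n0.
move: gE; rewrite -qhpoly_rootpoly n0 => gE.
have only i j : g`_i`_j != 0 -> i = al /\ j = be.
  rewrite -(intr_eq0 algC) => h.
  have : (map_bipoly intr g : {poly {poly algC}})`_i`_j != 0 by rewrite !coef_map.
  rewrite gE coef_qhpoly big_ord1 /= subn0 !muln0 !addn0.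
  by case: andP => [[/eqP -> /eqP ->]|_]; rewrite ?mulr0n ?eqxx.
have all_eq u : u \in monomials f -> u = (if g == f then (al, be) else (be, al)).
  case: u => i j; rewrite mem_monomials => fij; case: fg => ge.
    by rewrite ge eqxx; have [|-> ->] := only i j; rewrite ?ge.
  have [|-> ->] := only j i; first by rewrite ge coef_swapXY.
  case: eqP => // e; have [|h1 h2] := only i j; first by rewrite e.
  have [|h3 h4] := only j i; first by rewrite ge coef_swapXY.
  by rewrite -h1 -h4.
move: sm (monomials_uniq f) all_eq; case: (monomials f) => [|u [|v s]] //= _ /andP[uv _] H.
have vs : v \in [:: u, v & s] by rewrite inE mem_head orbT.
by case/negP: uv; rewrite (etrans (H u (mem_head _ _)) (esym (H v vs))) mem_head.
Qed.

End Height.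

Lemma bigmax_mem (T : eqType) (s : seq T) (P : pred T) (v : T -> nat) :
  (0 < \max_(z <- s | P z) v z)%N ->
  exists z, [/\ z \in s, P z & v z = \max_(z <- s | P z) v z].
Proof.
elim: s => [|x s IH]; first by rewrite big_nil.
rewrite big_cons; case: ifP => Px; last first.
  by move=> /IH[z [zs Pz e]]; exists z; rewrite inE zs orbT.
case: (leqP (v x) (\max_(z <- s | P z) v z)) => _.
  move=> /IH[z [zs Pz e]]; exists z; rewrite inE zs orbT; split => //.
move=> _; exists x; rewrite mem_head; split => //.
Qed.

Lemma qhpoly_quad_power (c : rat) (q : {poly rat}) e : size q = 3%N ->
  qhpoly 0 0 1 1 (2 * e) (c *: q ^+ e) =
    c%:P%:P * quad_form q`_2 q`_1 q`_0 ^+ e.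
Proof.
move=> sq; rewrite qhpoly_homog !expr0 !mul1r !expr1.
rewrite map_polyZ rmorphXn /= homogZ homogX ?size_map_inj_poly ?sq //.
  congr (_ * _ ^+ e); rewrite /homog !big_ord_recl big_ord0 /= !coef_map /= /quad_form.
  ring.
by move=> x y /= /polyC_inj/polyC_inj.
Qed.

Lemma noroot_anisotropic (q : {poly rat}) : size q = 3%N -> (forall y, ~~ root q y) ->
  anisotropic q`_2 q`_1 q`_0.
Proof.
move=> sq nr x y e; have qE z : q.[z] = q`_2 * z ^+ 2 + q`_1 * z + q`_0.
  by rewrite horner_coef sq !big_ord_recl big_ord0 /=; ring.
have [x0|x0] := eqVneq x 0.
  split => //; move: e; rewrite x0 expr0n /= !mulr0 mul0r !addr0 => /eqP.
  have q2 : q`_2 != 0 by rewrite -[2%N]/(3.-1)%N -sq -/(lead_coef q) lead_coef_eq0 -size_poly_eq0 sq.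
  by rewrite mulf_eq0 sqrf_eq0 (negPf q2) => /eqP.
case/negP: (nr (y / x)); rewrite /root qE; apply/eqP.
apply: (mulIf (expf_neq0 2 x0)); rewrite mul0r; apply: etrans e; field.
exact: x0.
Qed.

(** With [irrational_multiplicity], e <= d for an irrational root of order e,
    because t + r <= 2 t r; equality is the exceptional case. *)
Lemma irrational_weight (t r al be n e : nat) : (0 < t -> 0 < r -> 0 < e -> 2 * e <= n ->
  let De := t * al + r * be + t * r * n in
  e * (t + r) <= De /\
  (e * (t + r) = De -> [/\ t = 1, r = 1, al = 0, be = 0 & n = 2 * e]))%N.
Proof.
move=> t0 r0 e0 n2 De.
have h1 : (t <= t * r)%N by rewrite leq_pmulr.
have h2 : (r <= t * r)%N by rewrite leq_pmull.
have h3 : (e * (t + r) <= e * (2 * (t * r)))%N by rewrite leq_mul2l mul2n -addnn leq_add // orbT.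
have h4 : (e * (2 * (t * r)) <= t * r * n)%N.
  by rewrite mulnA mulnC [(e * 2)%N]mulnC leq_mul2l n2 orbT.
have h5 : (t * r * n <= De)%N by rewrite leq_addl.
split=> [|eE]; first by rewrite (leq_trans h3) // (leq_trans h4).
have e1 : (e * (t + r) = e * (2 * (t * r)))%N.
  by apply/eqP; rewrite eqn_leq h3 eE (leq_trans h4).
have e2 : (e * (2 * (t * r)) = t * r * n)%N.
  by apply/eqP; rewrite eqn_leq h4 -e1 eE.
have e3 : (t * r * n = De)%N by rewrite -e2 -e1.
have /eqP : (t + r = 2 * (t * r))%N by apply/eqP; rewrite -(eqn_pmul2l e0) e1.
rewrite mul2n -addnn => /eqP e4.
have e5 : (t = t * r)%N by apply/eqP; rewrite eqn_leq h1 -(leq_add2r (t * r)) -e4 leq_add2l.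
have e6 : (r = t * r)%N by apply/eqP; rewrite eqn_leq h2 -(leq_add2l (t * r)) -e4 leq_add2r.
have r1 : r = 1%N by apply/eqP; rewrite -(eqn_pmul2l t0) -e5 muln1.
have t1 : t = 1%N by apply/eqP; rewrite -(eqn_pmul2r r0) -e6 mul1n.
move: e3 e2; rewrite /De t1 r1 !muln1 !mul1n => e3 e2.
move: e3 => /eqP; rewrite -[X in X == _]add0n eqn_add2r eq_sym addn_eq0 => /andP[/eqP -> /eqP ->].
by rewrite -e2 mulnC.
Qed.

(** A root can only compete with d if t r <= t + r. *)
Lemma height_weight_t1 (t r al be n m : nat) : (0 < t -> t <= r -> coprime t r ->
  0 < m -> m <= n -> t * al + r * be + t * r * n <= m * (t + r) -> t = 1)%N.
Proof.
move=> t0 tr cop m0 mn le; apply/eqP; rewrite eqn_leq t0 andbT leqNgt; apply/negP => t2.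
have lt_tr : (t < r)%N.
  rewrite ltn_neqAle tr andbT; apply/eqP => e; move: cop; rewrite -e /coprime gcdnn => /eqP t1.
  by rewrite t1 in t2.
have : (m * (t * r) <= m * (t + r))%N.
  apply: leq_trans le; apply: leq_trans (leq_addl _ _).
  by rewrite mulnC leq_mul2l mn orbT.
rewrite leq_pmul2l // leqNgt => /negP; apply.
apply: (@leq_trans (2 * r)); first by rewrite mul2n -addnn ltn_add2r.
by rewrite leq_mul2r t2 orbT.
Qed.

Section NonExceptional.
Variable R : realType.

(** The largest order e of all roots is bounded by the height, and if it is the
    order of an irrational root it is less than d. The bad primes are those
    that divide t, the extreme coefficients of F, or the constants from
    [exists_order_le] and [exists_order_ge_rat]. *)
Lemma estimates_nonexceptional (f : {poly {poly int}}) : let D := total_degree f in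
  quasi_homogeneous R f -> (1 < size (monomials f))%N ->
  (forall m, (1 <= m)%N -> ~ exceptional m f) ->
  exists M, (0 < M)%N /\ forall p, prime p -> ~~ (p %| M)%N ->
    estimates (upper_const D (gap R D)) (lower_const R D) (lower_const R D) f p (nu R f).
Proof.
move=> D qf sm nexc.
have [a [al [be [t [r [zs [nf mE]]]]]]] := max_orderP qf sm.
set m := max_order R f in mE.
have [g fg ng] : exists2 g, g = f \/ g = swapXY f & normal_form R g a al be t r zs.
  by case: nf => h; [exists f; [left|]|exists (swapXY f); [right|]].
have n0 := normal_form_sum_gt0 fg sm ng.
have [F [IF FE]] := normal_form_int_form ng n0.
set n := (\sum_(z <- zs) z.2)%N in n0 IF.
have [fgs tdE] := swapXY_cases fg; rewrite tdE -/D in IF.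
have hd := hdist_int_form fg qf IF n0.
have [_ [t1 tr cop] [a0 uz za] _] := ng.
have [/andP[t0 tD] /andP[r0 rD] cop' sF F0 tDe rDe xD yD gE] := IF.
set De := (t * al + r * be + t * r * n)%N in hd tDe rDe.
have Fn : F`_n != 0.
  rewrite -[n]/n.+1.-1 -sF -/(lead_coef F) lead_coef_eq0.
  by apply: contraNneq F0 => ->; rewrite coef0.
have tr0 : (0 < t + r)%N by rewrite addn_gt0 t0.
have trR : 0 < (t + r)%:R :> R by rewrite ltr0n.
have le_n z : z \in zs -> (z.2 <= n)%N by move=> zz; rewrite /n (big_rem z) //= leq_addr.
pose e := \max_(z <- zs) z.2.
have e0 : (0 < e)%N.
  move: n0; rewrite /n /e; case: (zs) za => [|z s] /=; first by rewrite big_nil.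
  by case/andP=> /andP[_ z0] _ _; rewrite big_cons leq_max z0.
have irr z : z \in zs -> z.1 \notin Crat -> (z.2 * (t + r) < De)%N.
  move=> zz zR; have z20 : (0 < z.2)%N by have /andP[] := allP za z zz.
  have zz' : (z.1, z.2) \in zs by rewrite -surjective_pairing.
  have [n2 ex] := irrational_multiplicity FE zz' zR z20 sF.
  have [le eqc] := irrational_weight al be t0 r0 z20 n2; rewrite -/De in le eqc.
  rewrite ltn_neqAle le andbT; apply/eqP => /eqc[t_1 r_1 al0 be0 ne].
  have [c [q [c0 sq nr FQ]]] := ex ne.
  have an := noroot_anisotropic sq nr.
  have gq : map_bipoly intr g = c%:P%:P * quad_form q`_2 q`_1 q`_0 ^+ z.2.
    by rewrite gE t_1 r_1 al0 be0 ne map_bipoly_qhpoly FQ qhpoly_quad_power.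
  apply: (nexc z.2) => //; case: fg => ge.
    by apply: (quad_form_exceptional c0 an); rewrite -ge.
  apply: (quad_form_exceptional c0 (anisotropic_swap an)).
  rewrite -(swapXYK f) -ge /map_bipoly -swapXY_map -/(map_bipoly _ _) gq.
  by rewrite rmorphM rmorphXn /= swap_quad_form swapXY_polyC map_polyC.
have le_m : [/\ (al <= m)%N, (be <= m)%N & forall z, z \in zs -> z.1 \in Crat -> (z.2 <= m)%N].
  rewrite mE !leq_max !leqnn orbT; split => // z zz zR.
  by rewrite leq_max (@leq_bigmax_seq _ zs (fun z => z.1 \in Crat) (fun z => z.2) z) ?orbT.
have [alm bem zm] := le_m.
have e_cases : (e <= m)%N \/ (e * (t + r) < De)%N.
  have [z [zz _ ze]] := bigmax_mem e0; rewrite -/e in ze; rewrite -ze.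
  by case: (boolP (z.1 \in Crat)) => zR; [left; apply: zm|right; apply: irr].
pose H := maxn (m * (t + r)) De.
have hE : height R f = H%:R / (t + r)%:R.
  rewrite /height sm hd /H natr_max maxr_pMl ?invr_ge0 //; congr (Num.max _ _).
  by rewrite natrM mulfK // gt_eqF.
have nuE : nu R f = (m * (t + r) == De)%N.
  rewrite /nu sm hd -(inj_eq (mulIf (lt0r_neq0 trR))) (divfK (lt0r_neq0 trR)) -natrM eqr_nat.
  by [].
have zae : all (fun z => 0 < z.2 <= e)%N zs.
  apply/allP => z zz; have /andP[_ ->] := allP za z zz.
  exact: (@leq_bigmax_seq _ zs xpredT (fun z => z.2) z).
have sFD : ((size F).-1 <= D)%N.
  by rewrite sF /= (leq_trans _ yD) // (leq_trans _ (leq_addl _ _)) // leq_pmull.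
have [M1 [M10 M1P]] := exists_order_le a0 uz zae e0 FE sFD.
(* d, al, be or the order of a rational root: one of them is the height *)
have [M2 [M20 M2P]] : exists M2, (0 < M2)%N /\ forall p, prime p -> ~~ (p %| M2)%N ->
  [\/ nu R f = 0%N /\ H = De,
      H = (al * (t + r))%N /\ (nu R f = 0%N \/ al <= be + t * n)%N,
      H = (be * (t + r))%N /\ (nu R f = 0%N \/ be <= al + r * n)%N |
      exists e', [/\ t = 1%N, H = (e' * (t + r))%N, order_ge p e' F &
        (nu R f = 0%N \/ e' * (1 + r) <= De)%N]].
  have [lt|le] := ltnP (m * (t + r)) De.
    exists 1%N; split => // p _ _; apply: Or41; split; first by rewrite nuE ltn_eqF.
    by rewrite /H (maxn_idPr (ltnW lt)).
  have HE : H = (m * (t + r))%N by rewrite /H (maxn_idPl le).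
  have nu0 : nu R f = 0%N \/ (m * (t + r) = De)%N.
    by rewrite nuE; case: eqP => [->|]; [right|left].
  have m0 : (0 < m)%N.
    by move: (leq_trans (leq_trans t0 tDe) le); rewrite muln_gt0 => /andP[].
  have [ma|nma] := eqVneq m al.
    exists 1%N; split => // p _ _; apply: Or42; rewrite HE ma; split => //.
    case: nu0 => [->|e1]; [by left|right].
    have : (r * al = r * (be + t * n))%N.
      by apply/eqP; rewrite -(eqn_add2l (t * al)) -mulnDl mulnC -ma e1 /De ma; apply/eqP; ring.
    by move/eqP; rewrite eqn_pmul2l // => /eqP ->.
  have [mb|nmb] := eqVneq m be.
    exists 1%N; split => // p _ _; apply: Or43; rewrite HE mb; split => //.
    case: nu0 => [->|e1]; [by left|right].
    have : (t * be = t * (al + r * n))%N.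
      by apply/eqP; rewrite -(eqn_add2r (r * be)) -mulnDl mulnC -mb e1 /De mb; apply/eqP; ring.
    by move/eqP; rewrite eqn_pmul2l // => /eqP ->.
  have mz : m = \max_(z <- zs | z.1 \in Crat) z.2.
    move: mE nma nmb; rewrite /maxn; case: ifP => _; last by move=> -> ; case: ifP; rewrite eqxx.
    by [].
  have : (0 < \max_(z <- zs | z.1 \in Crat) z.2)%N by rewrite -mz.
  case/bigmax_mem => z [zz zR ze]; rewrite -mz in ze.
  have dF : ('X - z.1%:P) ^+ m %| map_poly intr F.
    by rewrite FE (rootpoly_rem a zz) ze dvdp_mulr.
  have [M2 [M20 M2P]] := exists_order_ge_rat zR dF.
  exists M2; split => // p p_pr pM; apply: Or44; exists m.
  have t_1 : t = 1%N.
    by apply: (height_weight_t1 t0 tr _ m0 _ le) => //; rewrite -ze le_n.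
  split => //; first exact: M2P.
  by case: nu0 => [->|e1]; [left|right; rewrite -e1 t_1].
exists (M1 * (M2 * (t * (absz (F`_0)%R * absz (F`_n)%R))))%N; split.
  by rewrite !muln_gt0 M10 M20 t0 !absz_gt0 F0 Fn.
move=> p p_pr; rewrite !Euclid_dvdM // !negb_or => /and5P[pM1 pM2 pt pF0 pFn].
apply: (@estimates_int_form R D f g al be t r n F p e (nu R f) H) => //.
- exact: M1P.
- by rewrite /nu; case: ifP => _; case: (_ == _).
- by rewrite leq_max leq_mul2r alm orbT.
- by rewrite leq_max leq_mul2r bem orbT.
- by rewrite leq_maxr.
- case: e_cases => [em|lt]; first by rewrite leq_max leq_mul2r em orbT.
  by rewrite leq_max (ltnW lt) orbT.
- rewrite geq_max mulnC; apply/andP; split.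
    rewrite leq_mul2l; apply/orP; right; rewrite mE !geq_max.
    rewrite (leq_trans (leq_addr _ _) xD) (leq_trans (leq_addr _ _) yD) /=.
    apply/bigmax_leqP_seq => z zz _; apply: leq_trans (le_n z zz) _.
    by rewrite (leq_trans _ yD) // (leq_trans _ (leq_addl _ _)) // leq_pmull.
  rewrite mulnDl; apply: (@leq_trans (t * (al + r * n) + r * be)).
    by rewrite /De mulnDr addnAC mulnA.
  rewrite leq_add // leq_mul2l ?xD ?orbT // (leq_trans (leq_addr _ _) yD) orbT //.
- rewrite nuE => /eqP; rewrite eqb0 neq_ltn => /orP[lt|lt]; [right|left].
    have mH k : (k <= m)%N -> (k * (t + r) < H)%N.
      by move=> km; rewrite /H leq_max; apply/orP; right; apply: leq_ltn_trans lt; rewrite leq_mul2r km orbT.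
    split; [exact: mH|exact: mH|]; case: e_cases => [em|lt']; first exact: mH.
    by rewrite /H leq_max lt' orbT.
  by rewrite /H leq_max lt.
- exact: M2P.
Qed.

End NonExceptional.

(** * Polynomials with a single monomial *)

Lemma max_double i j : ((i + j <= maxn i j * 2) /\ (i != j -> i + j < maxn i j * 2))%N.
Proof. by lia. Qed.

(** A monomial is treated as if it had the ray t = r = 1: then d is the mean of
    the two exponents, which is the height only if they are equal, and F is a
    constant without roots. *)
Lemma estimates_monomial (R : realType) (f : {poly {poly int}}) : let D := total_degree f in
  f != 0 -> quasi_homogeneous R f -> (size (monomials f) <= 1)%N ->
  exists M, (0 < M)%N /\ forall p, prime p -> ~~ (p %| M)%N ->
    estimates (upper_const D (gap R D)) (lower_const R D) (lower_const R D) f p (nu R f).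
Proof.
move=> D f0 [k1 [k2 qf]] sm.
have [i [j fij]] := monomials_exists f0.
have mE : monomials f = [:: (i, j)].
  have := fij; rewrite -mem_monomials; move: sm; case: (monomials f) => [|u [|]] //= _.
  by rewrite inE => /eqP ->.
have ij0 : (0 < i + j)%N.
  rewrite addn_gt0; apply: contraT; rewrite negb_or -!eqn0Ngt => /andP[/eqP i0 /eqP j0].
  have := weights_monomial qf fij; rewrite i0 j0 !mulr0 addr0 => /eqP.
  by rewrite eq_sym oner_eq0.
have ijD : (i + j <= D)%N by apply: le_total_degree.
pose c := f`_i`_j.
have fE : f = qhpoly i j 1 1 0 c%:P.
  apply/polyP => a; apply/polyP => b; rewrite coef_qhpoly big_ord1 /= coefC /= !muln0 !addn0.
  have [/eqP fab|fab] := boolP (f`_a`_b == 0).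
    rewrite fab; case: andP => [[/eqP ai /eqP bj]|]; rewrite ?mulr0n //.
    by case/eqP: fij; rewrite -ai -bj.
  by move: fab; rewrite -mem_monomials mE inE => /eqP[-> ->]; rewrite !eqxx.
have IF : int_form D f i j 1 1 0 c%:P.
  split => //.
  - by rewrite (leq_trans _ ijD).
  - by rewrite (leq_trans _ ijD).
  - by rewrite size_polyC fij.
  - by rewrite coefC.
  - by rewrite !mul1n addn0.
  - by rewrite !mul1n addn0.
  - by rewrite muln0 addn0 (leq_trans (leq_addr _ _) ijD).
  - by rewrite muln0 addn0 (leq_trans (leq_addl _ _) ijD).
have hE : height R f = (maxn i j * 2)%N%:R / (1 + 1)%N%:R.
  by rewrite /height mE /= natrM mulfK // pnatr_eq0.
have nuE : nu R f = (i == j) by rewrite /nu mE.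
have [max1 max2] := max_double i j.
exists (absz c); rewrite absz_gt0; split => // p p_pr; rewrite -[p in (p %| _)%N]absz_nat -dvdzE => pc.
apply: (@estimates_int_form R D f f i j 1 1 0 c%:P p 0 (nu R f) (maxn i j * 2)) => //.
- by rewrite dvdn1; apply: contraL p_pr => /eqP ->.
- by rewrite coefC.
- by rewrite coefC.
- exists 1; split; first by rewrite size_poly1.
    move=> w; rewrite hornerC dvdz1 absz_nat => /eqP p1.
    by have := prime_gt1 p_pr; rewrite p1.
  move=> k w; rewrite hornerC => /(dvdz_pexp_unit pc) ->.
  by exists 0%N; split => //; rewrite expn0 dvd1z.
- by rewrite nuE; case: (_ == _).
- by rewrite leq_mul2r leq_maxl orbT.
- by rewrite leq_mul2r leq_maxr orbT.
- by rewrite !mul1n addn0.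
- by rewrite mulnC leq_mul2l geq_max (leq_trans (leq_addr _ _) ijD) (leq_trans (leq_addl _ _) ijD).
- by rewrite nuE => /eqP; rewrite eqb0 => ij; left; rewrite !mul1n addn0 max2.
- have nu_cases : nu R f = 0%N \/ i = j by rewrite nuE; case: eqP => [->|]; [right|left].
  case: (leqP j i) => h; [apply: Or42|apply: Or43]; split => //.
    by case: nu_cases => [->|->]; [left|right; rewrite leq_addr].
  by case: nu_cases => [->|ij]; [left|right; rewrite ij leq_addr].
Qed.

(** * Roots in the p-adic field *)

Local Notation "x %:F" := (FracField.tofrac x).

Lemma fraction_numden (A : idomainType) (x : {fraction A}) :
  exists n d : A, d != 0 /\ x = n%:F / d%:F.
Proof.
elim/quotW: x => y; exists (\n_y), (\d_y); split; first exact: denom_ratioP.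
have d0 : (\d_y)%:F != 0 :> {fraction A} by rewrite tofrac_eq0 denom_ratioP.
apply: (mulIf d0); rewrite divfK //.
unlock FracField.tofrac; rewrite -[LHS]FracField.pi_mul.
apply/eqmodP => /=; rewrite FracField.equivfE /FracField.mulf /=.
rewrite !numden_Ratio ?mulf_neq0 ?oner_eq0 ?denom_ratioP //.
by rewrite !mulr1 mulrC.
Qed.

(** The iteration u - v Q(u) with a fixed inverse v of Q'(w) modulo p gains one
    power of p at each step. *)
Lemma hensel p (Q : {poly int}) (w : int) : prime p ->
  (p %| Q.[w])%Z -> ~~ (p %| Q^`().[w])%Z ->
  exists u : nat -> int, forall n,
    (u n.+1 = u n %[mod (p ^ n)%N%:Z])%Z /\ ((p ^ n)%N %| Q.[u n])%Z.
Proof.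
move=> p_pr pQ pQ'.
have cop : coprimez Q^`().[w] p%:Z.
  by rewrite coprimez_sym /coprimez /gcdz absz_nat eqz_nat -/(coprime _ _) prime_coprime // -dvdzE.
have /coprimezP[[v v'] /= vE] := cop.
pose u n := iter n (fun x => x - v * Q.[x]) w.
have inv n : ((p ^ n.+1)%N %| Q.[u n])%Z /\ (p %| (u n - w)%R)%Z.
  elim: n => [|n [IH1 IH2]]; first by rewrite expn1 /= subrr dvdz0.
  have pQn : (p %| Q.[u n])%Z by have := @dvdz_expl p 1 n.+1 _ isT IH1; rewrite expn1.
  have uS : u n.+1 = u n - v * Q.[u n] by [].
  split; last first.
    by rewrite uS addrAC rpredB // dvdz_mull.
  have [h hE] := horner_taylor2 Q (u n) (u n.+1).
  have -> : Q.[u n.+1] = Q.[u n] * ((1 - v * Q^`().[u n]) + v ^+ 2 * Q.[u n] * h).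
    by rewrite hE uS; ring.
  rewrite expnSr PoszM; apply: dvdz_mul => //; apply: rpredD.
    have -> : 1 - v * Q^`().[u n] = v' * p%:Z - v * (Q^`().[u n] - Q^`().[w]).
      by rewrite -vE; ring.
    by rewrite rpredB ?dvdz_mull // dvdz_horner.
  by rewrite mulrAC dvdz_mull.
exists u => n; have [h _] := inv n; split; last by apply: dvdz_expl h.
apply/eqP; rewrite eqz_mod_dvd /= addrAC subrr add0r rpredN dvdz_mull //.
exact: dvdz_expl h.
Qed.

Section Padic.
Variables (p : nat) (p_pr : prime p).
Local Notation Zp := (padic_int p_pr).
Local Notation q n := ((p ^ n)%N%:Z).

Lemma padic_seqD (x y : Zp) n : ((x + y : Zp) n = x n + y n %[mod q n])%Z.
Proof. exact: padic_mkE. Qed.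

Lemma padic_seqM (x y : Zp) n : ((x * y : Zp) n = x n * y n %[mod q n])%Z.
Proof. exact: padic_mkE. Qed.

Lemma padic_seqN (x : Zp) n : ((- x : Zp) n = - x n %[mod q n])%Z.
Proof. exact: padic_mkE. Qed.

Lemma padic_seq_trunc (x : Zp) n i : (q n %| (x (n + i)%N - x n)%R)%Z.
Proof.
elim: i => [|i IH]; first by rewrite addn0 subrr dvdz0.
rewrite addnS -(subrK (x (n + i)%N) (x (n + i).+1)) -addrA rpredD //.
have : (q (n + i) %| (x (n + i).+1 - x (n + i)%N)%R)%Z.
  by rewrite -eqz_mod_dvd -padic_seqS padic_seq_mod.
by apply: dvdz_expl; rewrite leq_addr.
Qed.

Lemma padic_seq_int (k : int) n : ((k%:~R : Zp) n = k %[mod q n])%Z.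
Proof.
have nat_case (m : nat) : ((m%:R : Zp) n = m%:Z %[mod q n])%Z.
  elim: m => [|m IH]; first exact: padic_mkE.
  rewrite -natr1 padic_seqD -modzDml IH modzDml -addn1 PoszD -modzDmr.
  have -> : ((1 : Zp) n %% q n = 1 %% q n)%Z by exact: padic_mkE.
  by rewrite modzDmr.
case: k => m; first by rewrite -pmulrn nat_case.
by rewrite NegzE mulrNz -pmulrn padic_seqN -modzNm nat_case modzNm.
Qed.

Lemma padic_seq_horner (P : {poly int}) (x : Zp) n :
  ((map_poly intr P).[x] n = P.[x n] %[mod q n])%Z.
Proof.
elim/poly_ind: P => [|P c IH].
  by rewrite rmorph0 !horner0; exact: padic_mkE.
rewrite rmorphD rmorphM /= map_polyX map_polyC /= !hornerD !hornerM !hornerX !hornerC.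
rewrite padic_seqD -modzDm padic_seqM -modzMml IH modzMml padic_seq_int.
by rewrite modzDm.
Qed.

Lemma padic_int_char0 (k : int) : k%:~R = 0 :> Zp -> k = 0.
Proof.
move=> k0; apply/eqP; apply: contraT => kn0.
have : (q `|k|.+1 %| k)%Z.
  apply/dvdz_mod0P; rewrite -padic_seq_int k0.
  by have := @padic_seq_int 0 `|k|.+1; rewrite mod0z.
rewrite dvdzE absz_nat => /dvdn_leq; rewrite absz_gt0 => /(_ kn0).
by rewrite leqNgt (leq_trans _ (ltnW (ltn_expl _ (prime_gt1 p_pr)))).
Qed.

Lemma padic_char0 (k : int) : (k%:~R == 0 :> padic p_pr) = (k == 0).
Proof.
apply/eqP/eqP => [|->]; last by rewrite mulr0z.
have -> : k%:~R = (k%:~R : Zp)%:F :> padic p_pr by rewrite rmorph_int.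
by move/eqP; rewrite tofrac_eq0 => /eqP/padic_int_char0.
Qed.

Lemma padic_root_of_seq (Q : {poly int}) (u : nat -> int) :
  (forall n, (u n.+1 = u n %[mod q n])%Z /\ (q n %| Q.[u n])%Z) ->
  exists z : padic p_pr, (map_poly intr Q).[z] = 0.
Proof.
move=> H; pose z := padic_mk p_pr (fun n => (H n).1).
exists (z%:F); have -> : (map_poly intr Q : {poly padic p_pr}).[z%:F] = ((map_poly intr Q).[z])%:F.
  rewrite -horner_map -map_poly_comp; congr (_.[_]); apply: eq_map_poly => k /=.
  by rewrite rmorph_int.
have -> : (map_poly intr Q).[z] = 0; last by rewrite rmorph0.
apply: padic_eqP => n; rewrite padic_seq_horner.
have -> : ((0 : Zp) n %% q n)%Z = 0 by have := @padic_seq_int 0 n; rewrite mod0z.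
have zu : (q n %| (z n - u n)%R)%Z by rewrite -eqz_mod_dvd; apply/eqP; exact: padic_mkE.
apply/dvdz_mod0P; rewrite -(subrK Q.[u n] Q.[z n]) rpredD ?dvdz_horner //.
by case: (H n).
Qed.

(** With y = a/b one has a^2 = k b^2 in Z_p. At a precision of more than twice
    the valuation of b, dividing by the exact power of p in b leaves an
    equation modulo p between integers, where b has become invertible. *)
Lemma padic_square_mod (k : int) (y : padic p_pr) : ~~ (p %| k)%Z ->
  y ^+ 2 = k%:~R -> exists w : int, (p %| (w ^+ 2 - k)%R)%Z.
Proof.
move=> pk; have [a [b [b0 ->]]] := fraction_numden y.
have bF : b%:F != 0 by rewrite tofrac_eq0.
rewrite expr_div_n => /(canRL (mulfVK (expf_neq0 2 bF))).
have -> : k%:~R = (k%:~R : Zp)%:F :> padic p_pr by rewrite rmorph_int.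
rewrite -!rmorphXn -rmorphM /= => /eqP; rewrite tofrac_eq => /eqP ab.
have [n bn] : exists n, ~~ (q n %| b n)%Z.
  apply: contrapT => H; case/eqP: b0; apply: padic_eqP => n.
  have -> : ((0 : Zp) n %% q n)%Z = 0 by have := @padic_seq_int 0 n; rewrite mod0z.
  by apply/dvdz_mod0P; apply: contrapT => /negP h; apply: H; exists n.
pose m := (n + n)%N.
have abm : (q m %| (a m ^+ 2 - k * b m ^+ 2)%R)%Z.
  rewrite -eqz_mod_dvd; apply/eqP; rewrite !expr2.
  have := congr1 (fun x : Zp => (x m %% q m)%Z) ab; rewrite !expr2 /=.
  by rewrite !padic_seqM => ->; rewrite modzMmr -modzMml padic_seq_int modzMml modz_mod.
have bnm : ~~ (q n %| b m)%Z.
  apply: contra bn => d.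
  suff : (q n %| (b m - b n)%R)%Z.
    by move=> d'; rewrite -(subKr (b m) (b n)) rpredB.
  exact: padic_seq_trunc.
have [k0|bm0] := eqVneq (b m) 0; first by rewrite k0 dvdz0 in bnm.
have bm1 : (0 < `|b m|)%N by rewrite absz_gt0.
pose i := logn p `|b m|.
have i_n : (i < n)%N by rewrite ltnNge -pfactor_dvdn // -[(p ^ n)%N]absz_nat -dvdzE.
have [c cE] : exists c, b m = q i * c.
  have : (q i %| b m)%Z by rewrite dvdzE absz_nat pfactor_dvdn.
  by case/dvdzP => c ->; exists c; rewrite mulrC.
have pc : ~~ (p %| c)%Z.
  apply: contraT; rewrite negbK => /dvdzP[d dE].
  have : (q i.+1 %| b m)%Z by rewrite cE dE expnSr PoszM mulrCA dvdz_mull.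
  by rewrite dvdzE absz_nat pfactor_dvdn // ltnn.
have i2 : (i * 2 <= m)%N by rewrite muln2 -addnn /m leq_add // ltnW.
have [d dE] : exists d, a m = q i * d.
  have : (q (i * 2) %| a m ^+ 2)%Z.
    rewrite -(subrK (k * b m ^+ 2) (a m ^+ 2)) rpredD //; first exact: dvdz_expl abm.
    by rewrite cE exprMn pexpzX dvdz_mull // dvdz_mulr.
  rewrite -pexpzX dvdzE !abszX dvdn_pexp2r // -dvdzE => /dvdzP[d ->].
  by exists d; rewrite mulrC.
have pdc : (p %| (d ^+ 2 - k * c ^+ 2)%R)%Z.
  have : (q (i * 2 + 1) %| (a m ^+ 2 - k * b m ^+ 2)%R)%Z.
    by apply: dvdz_expl abm; rewrite muln2 -addnn addn1 -addSn /m leq_add // ltnW.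
  have -> : a m ^+ 2 - k * b m ^+ 2 = q (i * 2) * (d ^+ 2 - k * c ^+ 2).
    by rewrite dE cE -pexpzX; ring.
  by rewrite pexpzD dvdz_mul2l ?pexpz_neq0 // expn1.
have cop : coprimez c p%:Z.
  by rewrite coprimez_sym /coprimez /gcdz absz_nat eqz_nat -/(coprime _ _) prime_coprime // -dvdzE.
have /coprimezP[[v v'] /= vE] := cop.
exists (v * d).
have -> : (v * d) ^+ 2 - k = v ^+ 2 * (d ^+ 2 - k * c ^+ 2) - k * (v' * (v * c + 1)) * p%:Z.
  have -> : (v * d) ^+ 2 - k = v ^+ 2 * (d ^+ 2 - k * c ^+ 2)
      - k * (v' * p%:Z) * ((v * c + v' * p%:Z) + v * c)
      + k * ((v * c + v' * p%:Z) ^+ 2 - 1) by ring.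
  by rewrite vE; ring.
by rewrite rpredB ?dvdz_mull.
Qed.

End Padic.

(** * The exceptional case *)

Definition quadp (A : nzRingType) (b c d : A) : {poly A} := b *: 'X^2 + c *: 'X + d%:P.

Lemma coef_quadp (A : nzRingType) (b c d : A) :
  [/\ (quadp b c d)`_2 = b, (quadp b c d)`_1 = c & (quadp b c d)`_0 = d].
Proof.
rewrite /quadp !coefD !coefZ !coefXn !coefX !coefC /= !mulr0 !mulr1 !addr0 !add0r.
by [].
Qed.

Lemma size_quadp (A : idomainType) (b c d : A) : b != 0 -> size (quadp b c d) = 3%N.
Proof.
move=> b0; rewrite /quadp -addrA size_polyDl size_scale ?size_polyXn //.
apply: leq_ltn_trans (size_polyD _ _) _; rewrite gtn_max.
by rewrite (leq_ltn_trans (size_scale_leq _ _)) ?size_polyX // (leq_ltn_trans (size_polyC_leq1 _)).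
Qed.

Lemma horner_quadp (A : comNzRingType) (b c d z : A) :
  (quadp b c d).[z] = b * z ^+ 2 + c * z + d.
Proof. by rewrite /quadp !hornerD !hornerZ hornerXn hornerX hornerC. Qed.

Lemma map_quadp (A B : nzRingType) (g : {rmorphism A -> B}) b c d :
  map_poly g (quadp b c d) = quadp (g b) (g c) (g d).
Proof. by rewrite /quadp !rmorphD /= !map_polyZ map_polyXn map_polyX map_polyC. Qed.

Lemma horner_deriv_quadp (A : comNzRingType) (b c d z : A) :
  ((quadp b c d)^`()).[z] = 2 * b * z + c.
Proof.
rewrite /quadp !derivD !derivZ derivXn derivX derivC !hornerD !hornerZ hornerMn hornerX.
by rewrite hornerC horner0 -mulr_natl; ring.
Qed.

(** The identity behind the quadratic formula. *)
Lemma quadp_disc (A : comNzRingType) (B C E : int) (z : A) :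
  (2 * B%:~R * z + C%:~R) ^+ 2 =
  (C ^+ 2 - 4 * B * E)%:~R + 4 * B%:~R * (map_poly intr (quadp B C E)).[z].
Proof.
by rewrite map_quadp horner_quadp /=; ring.
Qed.

(** The other root is -c/b - z, and it is distinct from z if 2 b z + c <> 0. *)
Lemma quadp_conj (K : fieldType) (b c d z : K) : b != 0 ->
  2 * b * z + c = b * (z - (- (c / b) - z)) /\
  (quadp b c d).[- (c / b) - z] = (quadp b c d).[z].
Proof. by move=> b0; rewrite !horner_quadp; split; field. Qed.

Lemma quadp_scale (A : comNzRingType) (N b c d B C E z : A) :
  N * b = B -> N * c = C -> N * d = E ->
  N * (b * z ^+ 2 + c * z + d) = (quadp B C E).[z].
Proof. by move=> <- <- <-; rewrite horner_quadp; ring. Qed.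

Section QuadPadic.
Variables (p : nat) (p_pr : prime p) (B C E : int).
Let Q := quadp B C E.
Let disc := C ^+ 2 - 4 * B * E.
Hypotheses (pB : ~~ (p %| B)%Z) (pdisc : ~~ (p %| disc)%Z).

Lemma quadp_simple_root w : (p %| Q.[w])%Z -> ~~ (p %| Q^`().[w])%Z.
Proof.
move=> pQ; apply: contra pdisc => pQ'.
have -> : disc = Q^`().[w] ^+ 2 - 4 * B * Q.[w].
  by rewrite horner_deriv_quadp horner_quadp /disc; ring.
by rewrite rpredB // ?dvdz_mull // expr2 dvdz_mull.
Qed.

Lemma quadp_lift w : (p %| Q.[w])%Z -> forall s, exists z, ((p ^ s)%N %| Q.[z])%Z.
Proof.
move=> pQ s; have [u uP] := hensel p_pr pQ (quadp_simple_root pQ).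
by exists (u s); case: (uP s).
Qed.

Let K := padic p_pr.
Let QK : {poly K} := map_poly intr Q.

Lemma quadp_two_roots w : (p %| Q.[w])%Z ->
  exists z z' : K, [/\ z != z', QK.[z] = 0 & QK.[z'] = 0].
Proof.
move=> pQ; have [u uP] := hensel p_pr pQ (quadp_simple_root pQ).
have [z z0] := padic_root_of_seq p_pr uP.
have BK : B%:~R != 0 :> K by rewrite padic_char0; apply: contraNneq pB => ->.
have dK : disc%:~R != 0 :> K by rewrite padic_char0; apply: contraNneq pdisc => ->.
exists z, (- (C%:~R / B%:~R) - z); rewrite -/QK in z0; split => //.
  apply: contraNneq dK => zz.
  have e : 2 * B%:~R * z + C%:~R = 0 :> K.
    by have [-> _] := quadp_conj C%:~R 0 z BK; rewrite -zz subrr mulr0.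
  have := quadp_disc B C E z; rewrite e -/Q -/QK z0 mulr0 addr0 expr0n /= => <-.
  exact: eqxx.
move: z0; rewrite /QK map_quadp /= => <-.
by have [_ ->] := quadp_conj C%:~R E%:~R z BK.
Qed.

(** Since the discriminant is a square in Q_p, it is one modulo p, and the
    quadratic formula makes sense modulo p. *)
Lemma quadp_root_solvable (z : K) : ~~ (p %| 2)%N -> QK.[z] = 0 ->
  exists w, (p %| Q.[w])%Z.
Proof.
move=> p2 z0; have [w wP] : exists w : int, (p %| (w ^+ 2 - disc)%R)%Z.
  apply: (@padic_square_mod _ p_pr disc (2 * B%:~R * z + C%:~R)) => //.
  by have := quadp_disc B C E z; rewrite -/Q -/QK z0 mulr0 addr0.
have p2B : ~~ (p %| 2 * B)%Z by rewrite prime_dvdz_mul // negb_or dvdzE p2.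
have cop : coprimez (2 * B) p%:Z.
  by rewrite coprimez_sym /coprimez /gcdz absz_nat eqz_nat -/(coprime _ _) prime_coprime // -dvdzE.
have /coprimezP[[v v'] /= vE] := cop.
exists (v * (w - C)).
have p4B : ~~ (p %| 4 * B)%Z.
  have -> : 4 * B = 2 * (2 * B) by ring.
  by rewrite prime_dvdz_mul // negb_or p2B dvdzE p2.
rewrite -[(p %| _)%Z]orFb -(negPf p4B) -prime_dvdz_mul //.
have -> : 4 * B * Q.[v * (w - C)] = (w ^+ 2 - disc) +
   (v' * (C - w)) * p%:Z * (2 * B * (v * (w - C)) + C + w).
  have e : 2 * B * (v * (w - C)) + C - w = (v' * (C - w)) * p%:Z.
    have -> : 2 * B * (v * (w - C)) + C - w =
      (v * (2 * B) + v' * p%:Z - 1) * (w - C) + v' * (C - w) * p%:Z by ring.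
    by rewrite vE subrr mul0r add0r.
  by rewrite -e horner_quadp /disc; ring.
by rewrite rpredD // dvdz_mulr // dvdz_mull.
Qed.

End QuadPadic.

Lemma anisotropic_neq0 b c d : anisotropic b c d ->
  [/\ b != 0, d != 0 & c ^+ 2 - 4 * b * d != 0].
Proof.
move=> an; have b0 : b != 0.
  apply/eqP => b0; have [] := an 0 1; last by move=> _ /eqP; rewrite oner_eq0.
  by rewrite b0; ring.
split => //.
  apply/eqP => d0; have [] := an 1 0; last by move/eqP; rewrite oner_eq0.
  by rewrite d0; ring.
apply/eqP => disc0; have [] := an (2 * b) (- c); last first.
  by move/eqP; rewrite mulf_eq0 pnatr_eq0 (negPf b0).
have -> : b * (- c) ^+ 2 + c * (2 * b) * - c + d * (2 * b) ^+ 2 = - b * (c ^+ 2 - 4 * b * d) by ring.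
by rewrite disc0 mulr0.
Qed.

(** The constants N, L and A clear the denominators of the quadratic polynomial
    and of its m-th power; the bad primes come from them. *)
Lemma exceptional_data (f : {poly {poly int}}) m a b c d :
  (1 <= m)%N -> exceptional_with m f a b c d ->
  exists (F : {poly int}) (N B C E L A : int),
  [/\ f = qhpoly 0 0 1 1 (2 * m) F, size F = (2 * m).+1,
      [/\ N != 0, B%:~R = N%:~R * b, C%:~R = N%:~R * c & E%:~R = N%:~R * d],
      [/\ L != 0, A != 0 & L *: F = A *: quadp B C E ^+ m] & F`_0 != 0].
Proof.
move=> m1 [a0 irr fE]; have an := irreducible_anisotropic irr.
have [b0 d0 _] := anisotropic_neq0 an.
have [q2 q1 q0] := coef_quadp b c d.
have sq := size_quadp c d b0.
have sP : size (a *: quadp b c d ^+ m) = (2 * m).+1.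
  rewrite size_scale // -[LHS]prednK ?size_exp ?sq //.
  by rewrite size_poly_gt0 expf_neq0 // -size_poly_gt0 sq.
have [F [fF FE sF]] : exists F, [/\ f = qhpoly 0 0 1 1 (2 * m) F,
    pZtoQ F = a *: quadp b c d ^+ m & size F = (2 * m).+1].
  apply: (@qhpoly_descent _ _ (intr : {rmorphism int -> rat})) => //; first exact: intr_inj.
  by rewrite qhpoly_quad_power // q2 q1 q0.
have [Q [N [N0 QE]]] := rat_poly_lift (quadp b c d).
have QE' : Q = quadp Q`_2 Q`_1 Q`_0.
  apply: pZtoQ_inj; rewrite map_quadp /= -!coef_map /= QE !coefZ q2 q1 q0.
  by rewrite /quadp -!mul_polyC !polyCM; ring.
exists F, N, Q`_2, Q`_1, Q`_0, (denq a * N ^+ m), (numq a).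
have FZ : (denq a * N ^+ m) *: F = numq a *: Q ^+ m.
  apply: pZtoQ_inj; rewrite !map_polyZ /= rmorphXn /= FE QE exprZn !scalerA.
  by congr (_ *: _); rewrite numqE rmorphM rmorphXn /=; ring.
split => //.
- split => //; first by rewrite -coef_map /= QE coefZ q2.
  + by rewrite -coef_map /= QE coefZ q1.
  + by rewrite -coef_map /= QE coefZ q0.
- by rewrite mulf_neq0 ?expf_neq0 ?denq_neq0 // numq_eq0 a0 -QE'.
- rewrite -(intr_eq0 rat) -coef_map /= FE coefZ mulf_neq0 // -horner_coef0 horner_exp.
  by rewrite horner_coef0 q0 expf_neq0.
Qed.

Section NuPadic.
Variables (p : nat) (p_pr : prime p).
Let K := padic p_pr.

Lemma ratr_intr (b : rat) (B N : int) : B%:~R = N%:~R * b -> N%:~R * ratr b = B%:~R :> K.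
Proof.
move=> BE; have dK : (denq b)%:~R != 0 :> K by rewrite padic_char0 denq_neq0.
apply: (mulIf dK); rewrite /ratr -mulrA divfK // -!rmorphM /=; congr _%:~R.
apply: (@intr_inj rat); rewrite !rmorphM /= BE numqE mulrA.
by [].
Qed.

Lemma ratr_quadp (b c d : rat) (N B C E : int) (z : K) :
  B%:~R = N%:~R * b -> C%:~R = N%:~R * c -> E%:~R = N%:~R * d ->
  N%:~R * (ratr b * z ^+ 2 + ratr c * z + ratr d) = (map_poly intr (quadp B C E)).[z].
Proof.
move=> BE CE EE; rewrite map_quadp.
exact: quadp_scale (ratr_intr BE) (ratr_intr CE) (ratr_intr EE).
Qed.

(** The right-hand side does not mention b, c, d: so the roots in Q_p, and the
    exponent nu_p, do not depend on how f is written, and one set of bad primes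
    serves for all the ways. *)
Lemma exceptional_root (f : {poly {poly int}}) m a b c d (z : K) :
  (1 <= m)%N -> exceptional_with m f a b c d ->
  (ratr b * z ^+ 2 + ratr c * z + ratr d = 0) <-> (map_bipoly intr f).[1, z] = 0.
Proof.
move=> m1 ex.
have [F [N [B [C [E [L [A [fF sF [N0 BE CE EE] [L0 A0 LF] F0]]]]]]]] := exceptional_data m1 ex.
have NK : N%:~R != 0 :> K by rewrite padic_char0.
have LK : L%:~R != 0 :> K by rewrite padic_char0.
have AK : A%:~R != 0 :> K by rewrite padic_char0.
have -> : (map_bipoly intr f).[1, z] = (map_poly intr F).[z].
  rewrite fF map_bipoly_qhpoly horner_qhpoly /= !expr0 !mul1r !expr1.
  have := @homog_mul _ (2 * m) (map_poly intr F) 1 z; rewrite !mul1r expr1n mul1r => -> //.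
  by apply: leq_trans (size_poly _ _) _; rewrite sF.
have LFK : L%:~R * (map_poly intr F).[z] = A%:~R * (map_poly intr (quadp B C E)).[z] ^+ m.
  have := congr1 (fun P : {poly int} => (map_poly intr P : {poly K}).[z]) LF.
  by rewrite !map_polyZ /= rmorphXn /= !hornerZ horner_exp.
have QE := ratr_quadp z BE CE EE.
split=> [h|h].
  apply: (mulfI LK); rewrite mulr0 LFK -QE h mulr0 expr0n.
  by case: (m) m1 => // k _; rewrite mulr0.
apply: (mulfI NK); rewrite mulr0 QE; apply/eqP.
move/eqP: LFK; rewrite h mulr0 eq_sym mulf_eq0 (negPf AK) /= expf_eq0 => /andP[_ //].
Qed.

Lemma nu_padicE (f : {poly {poly int}}) m a b c d :
  (1 <= m)%N -> exceptional_with m f a b c d ->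
  nu_padic p_pr b c d = `[< exists z z' : K, [/\ z != z',
     (map_bipoly intr f).[1, z] = 0 & (map_bipoly intr f).[1, z'] = 0] >].
Proof.
move=> m1 ex; rewrite /nu_padic; congr nat_of_bool; apply/asbool_equiv_eq.
by split=> -[z [z' [zz h h']]]; exists z, z'; split => //; apply/(exceptional_root _ m1 ex).
Qed.

End NuPadic.

Section Exceptional.
Variable R : realType.

(** Any normal form of f has al = be = 0 and t = r = 1, since x^(2m) and y^(2m)
    occur in f, and none of its roots is rational: the maximal order is 0 and
    the height is d = m. *)
Lemma exceptional_height (f : {poly {poly int}}) m a b c d F :
  (1 <= m)%N -> exceptional_with m f a b c d -> quasi_homogeneous R f ->
  int_form (total_degree f) f 0 0 1 1 (2 * m) F -> size F = (2 * m).+1 ->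
  height R f = (2 * m)%N%:R / (1 + 1)%N%:R.
Proof.
move=> m1 ex qf IF sF.
have an : anisotropic b c d by case: ex => _ /irreducible_anisotropic.
have fE : map_bipoly intr f = a%:P%:P * quad_form b c d ^+ m by case: ex.
have a0 : a != 0 by case: ex.
have m20 : (0 < 2 * m)%N by rewrite muln_gt0.
have [_ _ _ _ F0 _ _ _ _ fF] := IF.
have F2 : F`_(2 * m) != 0.
  by rewrite -[(2 * m)%N]/((2 * m).+1.-1) -sF -/(lead_coef F) lead_coef_eq0 -size_poly_gt0 sF.
have fx : f`_(2 * m)`_0 != 0.
  by have := coef_qhpoly_x 0 0 1 (2 * m) F (isT : 0 < 1)%N; rewrite mul1n add0n -fF => ->.
have fy : f`_0`_(2 * m) != 0.
  by have := coef_qhpoly_y 0 0 1 (2 * m) F (isT : 0 < 1)%N; rewrite mul1n add0n -fF => ->.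
have sm : (1 < size (monomials f))%N.
  have : uniq [:: (2 * m, 0)%N; (0, 2 * m)%N] by rewrite /= !inE; case: eqP => // -[e]; rewrite e in m20.
  move/uniq_leq_size; apply => u; rewrite !inE => /orP[/eqP ->|/eqP ->]; by rewrite mem_monomials.
have hd := hdist_int_form (or_introl erefl) qf IF m20.
rewrite /height sm hd /=.
have -> : (1 * 0 + 1 * 0 + 1 * 1 * (2 * m) = 2 * m)%N by rewrite !muln0 !mul1n.
have -> : (2 * m)%:R / (1 + 1)%N%:R = m%:R :> R by rewrite natrM mulrC mulKf // pnatr_eq0.
apply/max_idPr; rewrite ler_nat.
have [a' [al [be [t [r [zs [nf ->]]]]]]] := max_orderP qf sm.
have [g fg ng] : exists2 g, g = f \/ g = swapXY f & normal_form R g a' al be t r zs.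
  by case: nf => h; [exists f; [left|]|exists (swapXY f); [right|]].
have n0 := normal_form_sum_gt0 fg sm ng.
have [F' [IF' FE']] := normal_form_int_form ng n0.
set n := (\sum_(z <- zs) z.2)%N in n0 IF'.
have [/andP[t0 _] /andP[r0 _] cop _ _ _ _ _ _ gE] := IF'.
have gx : g`_(2 * m)`_0 != 0 by case: fg => ->; rewrite ?coef_swapXY.
have gy : g`_0`_(2 * m) != 0 by case: fg => ->; rewrite ?coef_swapXY.
have ex_k i j : g`_i`_j != 0 -> exists2 k, (k <= n)%N & i = (al + r * (n - k))%N /\ j = (be + t * k)%N.
  rewrite gE coef_qhpoly => h; apply: contrapT => H; case/eqP: h; apply: big1 => k _.
  case: andP => [[/eqP ei /eqP ej]|]; last by rewrite mulr0n.
  by case: H; exists k; rewrite -1?ltnS.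
have [k1 k1n [e1 e2]] := ex_k _ _ gx; have [k2 k2n [e3 e4]] := ex_k _ _ gy.
have al0 : al = 0%N by move/eqP: e3; rewrite eq_sym addn_eq0 => /andP[/eqP].
have be0 : be = 0%N by move/eqP: e2; rewrite eq_sym addn_eq0 => /andP[/eqP].
have k10 : k1 = 0%N by move/eqP: e2; rewrite eq_sym addn_eq0 muln_eq0 (gtn_eqF t0) => /andP[_ /eqP].
have k2E : k2 = n.
  move/eqP: e3; rewrite eq_sym addn_eq0 muln_eq0 (gtn_eqF r0) /= => /andP[_].
  by rewrite subn_eq0 => nk; apply/eqP; rewrite eqn_leq k2n.
have rt : r = t.
  by apply/eqP; rewrite -(eqn_pmul2r n0); move: e1 e4; rewrite al0 be0 !add0n k10 subn0 k2E => <- <-.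
have t1 : t = 1%N by move: cop; rewrite rt /coprime gcdnn => /eqP.
rewrite al0 be0 !max0n; apply/bigmax_leqP_seq => z zz /CratP[x zx].
have /andP[_ z20] : (z.1 != 0) && (0 < z.2)%N by case: ng => _ _ [_ _ /allP/(_ z zz)].
exfalso; have rx : root (pZtoQ F') x.
  rewrite -(fmorph_root (ratr : {rmorphism rat -> algC})) /= -zx -pZtoC_pZtoQ FE' (rootpoly_rem a' zz).
  by rewrite rootM {1}/root horner_exp hornerXsubC subrr expr0n (gtn_eqF z20) eqxx.
have gx0 : (map_bipoly intr g : {poly {poly rat}}).[1, x] = 0.
  rewrite gE map_bipoly_qhpoly horner_qhpoly al0 be0 rt t1 /= !expr0 !mul1r !expr1.
  have := @homog_mul _ n (pZtoQ F') 1 x; rewrite !mul1r expr1n mul1r => -> //; first exact/rootP.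
  by case: IF' => _ _ _ sF' _ _ _ _ _ _; rewrite size_rat_int_poly sF'.
have f0 (u v : rat) : (map_bipoly intr f : {poly {poly rat}}).[u, v] = 0 -> u = 0 /\ v = 0.
  rewrite fE hornerM horner_exp !hornerC hornerM horner_exp hornerC horner_quad_form => /eqP.
  by rewrite mulf_eq0 (negPf a0) /= expf_eq0 => /andP[_ /eqP /an].
case: fg => ge; first by rewrite ge in gx0; have [/eqP] := f0 _ _ gx0; rewrite oner_eq0.
move: gx0; rewrite ge /map_bipoly -swapXY_map horner2_swapXY => /f0[_ /eqP].
by rewrite oner_eq0.
Qed.

End Exceptional.

(** If the quadratic polynomial Q has a root modulo p, it has two in Q_p, of
    order m = d, and the logarithm appears. Otherwise F has no root modulo p,
    the ray contributes nothing beyond its own valuation, and e = 0. *)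
Lemma estimates_exceptional (R : realType) (f : {poly {poly int}}) m a b c d :
  let D := total_degree f in
  (1 <= m)%N -> exceptional_with m f a b c d -> quasi_homogeneous R f ->
  exists M, (0 < M)%N /\ forall p (p_pr : prime p), ~~ (p %| M)%N ->
    estimates (upper_const D (gap R D)) (lower_const R D) (lower_const R D) f p
      (nu_padic p_pr b c d).
Proof.
move=> D m1 ex qf.
have [F [N [B [C [E [L [A [fF sF [N0 BE CE EE] [L0 A0 LF] F0]]]]]]]] := exceptional_data m1 ex.
have an : anisotropic b c d by case: ex => _ /irreducible_anisotropic.
have [b0 d0 disc0] := anisotropic_neq0 an.
have m20 : (0 < 2 * m)%N by rewrite muln_gt0.
have F2 : F`_(2 * m) != 0.
  by rewrite -[(2 * m)%N]/((2 * m).+1.-1) -sF -/(lead_coef F) lead_coef_eq0 -size_poly_gt0 sF.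
have mD : (2 * m <= D)%N.
  rewrite -[(2 * m)%N]addn0; apply: le_total_degree.
  by have := coef_qhpoly_x 0 0 1 (2 * m) F (isT : 0 < 1)%N; rewrite mul1n add0n -fF => ->.
have D0 : (0 < D)%N by apply: leq_trans mD.
have IF : int_form D f 0 0 1 1 (2 * m) F.
  by split; rewrite ?muln0 ?mul1n ?add0n.
have hE := exceptional_height m1 ex qf IF sF.
have B0 : B != 0 by rewrite -(intr_eq0 rat) BE mulf_neq0 ?intr_eq0.
pose disc := C ^+ 2 - 4 * B * E.
have discZ : disc != 0.
  rewrite -(intr_eq0 rat); have -> : disc%:~R = N%:~R ^+ 2 * (c ^+ 2 - 4 * b * d) :> rat.
    have -> : disc%:~R = C%:~R ^+ 2 - 4 * B%:~R * E%:~R :> rat by rewrite /disc; ring.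
    by rewrite BE CE EE; ring.
  by rewrite mulf_neq0 ?expf_neq0 ?intr_eq0.
have dQ : pZtoQ (quadp B C E) ^+ m %| pZtoQ F.
  have := congr1 (fun P : {poly int} => pZtoQ P) LF.
  rewrite !map_polyZ rmorphXn /= => e.
  by rewrite -(dvdpZr _ _ (_ : L%:~R != 0)) ?intr_eq0 // e dvdpZr ?intr_eq0.
have [M3 [M30 M3P]] := exists_order_ge dQ.
exists (2 * (M3 * (absz A * (absz B * (absz disc * (absz (F`_0)%R * absz (F`_(2 * m))%R))))))%N; split.
  by rewrite !muln_gt0 M30 !absz_gt0 A0 B0 discZ F0 F2.
move=> p p_pr; rewrite 6!(Euclid_dvdM _ _ p_pr) !negb_or.
case/and5P=> p2 pM3 pA pB /and3P[pdisc pF0 pF2].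
have FQ k w : ((p ^ k)%N %| F.[w])%Z -> ((p ^ k)%N %| (quadp B C E).[w] ^+ m)%Z.
  move=> dF; rewrite -(@Gauss_pexp p p_pr k A) //.
  move/(congr1 (fun P : {poly int} => P.[w])): LF; rewrite !hornerZ horner_exp => <-.
  exact: dvdz_mull.
have pt : ~~ (p %| 1)%N by rewrite dvdn1; apply: contraL p_pr => /eqP ->.
have De : (1 * 0 + 1 * 0 + 1 * 1 * (2 * m) = 2 * m)%N by rewrite !muln0 !mul1n.
have le2m : (2 * m <= (1 + 1) * D)%N by rewrite (leq_trans mD) // leq_pmull.
case: (pselect (exists w, (p %| (quadp B C E).[w])%Z)) => [[w pw]|nw].
- (* the roots lie in Q_p *)
  have nu1 : nu_padic p_pr b c d = 1%N.
    rewrite /nu_padic; suff -> : `[< exists z z' : padic p_pr,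
        [/\ z != z', ratr b * z ^+ 2 + ratr c * z + ratr d = 0 &
         ratr b * z' ^+ 2 + ratr c * z' + ratr d = 0] >] by [].
    have [z [z' [zz h h']]] := quadp_two_roots p_pr pB pdisc pw.
    have NK : N%:~R != 0 :> padic p_pr by rewrite padic_char0.
    have back x : (map_poly intr (quadp B C E) : {poly padic p_pr}).[x] = 0 ->
        ratr b * x ^+ 2 + ratr c * x + ratr d = 0.
      by move=> x0; apply: (mulfI NK); rewrite mulr0 -x0; apply: ratr_quadp.
    by apply/asboolP; exists z, z'; split => //; apply: back.
  rewrite nu1; apply: (@estimates_int_form R D f f 0 0 1 1 (2 * m) F p m 1 (2 * m)) => //.
  + exists (quadp B C E); split; first by rewrite size_quadp //= (leq_trans _ mD) // leq_pmulr.
      by move=> x; apply: quadp_simple_root.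
    by move=> k x /FQ; apply: dvdz_pexp_root.
  + by rewrite De.
  + by rewrite mulnC.
  + apply: Or44; exists m; split => //; first by rewrite mulnC.
      by apply: M3P => //; apply: quadp_lift pw.
    by right; rewrite De mulnC.
- have nu0 : nu_padic p_pr b c d = 0%N.
    rewrite /nu_padic; case: asboolP => // -[z [_ [_ h _]]]; case: nw.
    apply: (@quadp_root_solvable p p_pr B C E pB pdisc z p2).
    by rewrite -(ratr_quadp z BE CE EE) h mulr0.
  rewrite nu0; apply: (@estimates_int_form R D f f 0 0 1 1 (2 * m) F p 0 0 (2 * m)) => //.
  + exists 1; split; first by rewrite size_poly1.
      move=> w; rewrite hornerC dvdz1 absz_nat => /eqP p1.
      by have := prime_gt1 p_pr; rewrite p1.
    move=> k w /FQ dQw; have -> : k = 0%N.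
      apply: (@dvdz_pexp_unit p k _ _ dQw); apply: prime_dvdz_expN => //.
      by apply/negP => pw; apply: nw; exists w.
    by exists 0%N; split => //; rewrite expn0 dvd1z.
  + by rewrite De.
  + by move=> _; right; rewrite !mul0n.
  + by apply: Or41; rewrite De.
Qed.

(** * The theorem *)

Theorem theorem1p2 (R : realType) (D : nat) :
  exists C c c' : R,
    [/\ 0 < C, 0 < c & 0 < c'] /\
    forall f : {poly {poly int}},
      f != 0 -> quasi_homogeneous R f -> total_degree f = D ->
      exists P : seq nat,
        [/\ all prime P,
            (forall m : nat, (1 <= m)%N -> ~ exceptional m f) ->
            forall p : nat, prime p -> p \notin P ->
              estimates C c c' f p (nu R f)
          & forall (m : nat) (qa qb qc qd : rat), (1 <= m)%N ->
            exceptional_with m f qa qb qc qd ->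
            forall (p : nat) (p_pr : prime p), p \notin P ->
              estimates C c c' f p (nu_padic p_pr qb qc qd)].
Proof.
(* no quasi-homogeneous polynomial is constant, so any constants do for D = 0 *)
case: (posnP D) => [->|D0].
  exists 1, 1, 1; split=> // f f0 [k1 [k2 qf]] td; exfalso.
  have [j [k fjk]] := monomials_exists f0.
  have := le_total_degree fjk; rewrite td leqn0 addn_eq0 => /andP[/eqP j0 /eqP k0].
  have := weights_monomial qf fjk; rewrite j0 k0 !mulr0 addr0 => /eqP.
  by rewrite eq_sym oner_eq0.
have ga0 : 0 < gap R D by rewrite invr_gt0 ltr0n !muln_gt0 D0.
exists (upper_const D (gap R D)), (lower_const R D), (lower_const R D); split.
  by rewrite lower_const_gt0 // mulr_gt0 ?ltr0n ?cone_const_gt0.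
move=> f f0 qf td.
have primesP M p : (0 < M)%N -> prime p -> p \notin primes M -> ~~ (p %| M)%N.
  by move=> M0 p_pr; rewrite mem_primes p_pr M0.
have all_primes M : all prime (primes M).
  by apply/allP => p; rewrite mem_primes => /andP[].
case: (pselect (exists2 m, (1 <= m)%N & exceptional m f)) => [[m m1 [a [b [c [d ex]]]]]|nex].
  have [M [M0 HM]] := estimates_exceptional m1 ex qf; rewrite td in HM.
  exists (primes M); split => // [nex|m' a' b' c' d' m1' ex' p p_pr pM].
    by case: (nex m m1); exists a, b, c, d.
  rewrite (nu_padicE _ m1' ex') -(nu_padicE _ m1 ex).
  by apply: HM; apply: primesP.
have [M [M0 HM]] : exists M, (0 < M)%N /\ forall p, prime p -> ~~ (p %| M)%N ->
    estimates (upper_const D (gap R D)) (lower_const R D) (lower_const R D) f p (nu R f).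
  rewrite -td; have [sm|sm] := leqP (size (monomials f)) 1%N.
    exact: estimates_monomial.
  apply: estimates_nonexceptional => // m m1 em.
  by apply: nex; exists m.
exists (primes M); split => // [_ p p_pr pM|m a b c d m1 ex].
  by apply: HM => //; apply: primesP.
by case: nex; exists m => //; exists a, b, c, d.
Qed.
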